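(* There exists a set $\mathcal F$ of at most $6854$ partial patterns, each of size at most $80\times 80$, such that the sequence $\{C_n(\mathcal F)\}$ is not P-recursive.
   Context: A partial pattern is a $0$-$1$ matrix in which every row and column contains at most one $1$. An $n\times n$ permutation matrix $M$ contains a partial pattern $L$ if $L$ can be obtained from $M$ by deleting some rows and columns, and avoids it otherwise. $C_n(\mathcal F)$ is the number of $n\times n$ permutation matrices avoiding every partial pattern in $\mathcal F$. An integer sequence $\{a_n\}$ is P-recursive if it satisfies a nontrivial linear recurrence $q_0(n)a_n+q_1(n)a_{n-1}+\dots+q_k(n)a_{n-k}=0$ with polynomials $q_i\in\mathbb Z[x]$ not all zero. *)

(* Defs.v *)
From HB Require Import structures.
From mathcomp Require Import all_boot all_order all_algebra all_fingroup.
Set Implicit Arguments. Unset Strict Implicit. Unset Printing Implicit Defensive.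
Import GRing.Theory.

Definition bmatrix (k l : nat) := 'M[bool]_(k, l).

Definition is_partial_pattern (k l : nat) (L : bmatrix k l) : Prop :=
  (forall i j1 j2, L i j1 -> L i j2 -> j1 = j2) /\
  (forall i1 i2 j, L i1 j -> L i2 j -> i1 = i2).

Record pattern := Pattern { prows : nat; pcols : nat; pmx : bmatrix prows pcols }.

Definition perm_bmx (n : nat) (s : 'S_n) : bmatrix n n :=
  (\matrix_(i < n, j < n) (s i == j))%R.

(* M contains L: L is obtained from M by deleting rows and columns, i.e. there
   are strictly increasing row and column selections reproducing L exactly. *)
Definition contains (m n k l : nat) (M : bmatrix m n) (L : bmatrix k l) : bool :=
  [exists r : {ffun 'I_k -> 'I_m}, exists c : {ffun 'I_l -> 'I_n},
    [&& [forall i1 : 'I_k, forall i2 : 'I_k, (i1 < i2)%N ==> (r i1 < r i2)%N],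
        [forall j1 : 'I_l, forall j2 : 'I_l, (j1 < j2)%N ==> (c j1 < c j2)%N] &
        [forall i, forall j, M (r i) (c j) == L i j]]].

Definition avoids (n : nat) (s : 'S_n) (P : pattern) : bool :=
  ~~ contains (perm_bmx s) (pmx P).

(* C_n(F): number of n x n permutation matrices (in bijection with the
   permutations s of 'I_n via perm_bmx) avoiding every pattern in F. *)
Definition Cn (F : seq pattern) (n : nat) : nat :=
  #|[set s : 'S_n | all (avoids s) F]|.

(* P-recursive: q_0(n) a_n + q_1(n) a_(n-1) + ... + q_k(n) a_(n-k) = 0 for all
   n >= k, with q_i in Z[x] not all zero (qs = [:: q_0; ...; q_k]). *)
Definition P_recursive (a : nat -> int) : Prop :=
  exists qs : seq {poly int},
    has (fun q => q != 0%R) qs /\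
    forall n : nat, (size qs <= n.+1)%N ->
      (\sum_(i < size qs) (nth 0%R qs i).[n%:Z] * a (n - i)%N = 0)%R.

(* Main.v *)
(* Two sets of patterns F1 and F2 are used, such that C_n(F1) - C_n(F2) counts the permutations which
   avoid F1 and contain a starting block.  Each block contains two adjacent points, and the exchange
   of these two points preserves all the patterns involved, except those of F1 which only forbid the
   exchanged form of a block linked to a next block.  Hence exchanging the points of the first
   unlinked block is an involution, and modulo 2 only the permutations all of whose blocks are linked
   count.  These are rigid: they consist of a chain of blocks
   L H HX HXX HXXX ... H R in which the links work as a first-in first-out queue, where an X-block pops
   a link and pushes one, and an H-block pops one and pushes two.  So C_n(F1) - C_n(F2) is odd exactly
   when n is the size of such a chain, which is a quadratic function f of the number of rounds.
   Now f takes all residues modulo powers of 2 and its gaps tend to infinity, so a recurrence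
   sum_i q_i(n) a(n-i) = 0, read modulo a suitable power of 2 where only one of the a(n-i) is odd, is
   impossible for such a sequence.  As P-recursive sequences are closed under subtraction, C_n(F1)
   or C_n(F2) is not P-recursive. *)
From HB Require Import structures.
Require Import Defs.
From mathcomp Require Import all_boot all_order all_algebra all_fingroup.
From Stdlib Require List.
From Stdlib Require Import ClassicalEpsilon.
From mathcomp Require Import zify ring.
Set Implicit Arguments. Unset Strict Implicit. Unset Printing Implicit Defensive.

(** * Patterns and occurrences *)

(** The toggle must not create a forbidden pattern, so the forbidden list has to be closed, up to
    forbidden links, under exchanging labels that are adjacent in both orders. For this reason most
    patterns mention a block only through its frame: the point 2 is left out, and what remains is a
    simple permutation, which has no adjacent pair. Closure is then a finite computation. The empty
    rows and columns of partial patterns serve as upper bounds: nothing lies inside a block, and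
    only a given number of rows or columns separates consecutive blocks. The links give the matching
    lower bounds, so the coordinates along a chain are forced. A block must not be imitated by
    points taken from several places of a chain. Hence every block starts with a decreasing run of
    length four, while the links, the low points tying consecutive blocks, and the points of
    distinct blocks are all increasing. With its gap, an X-block takes eleven rows (nine of its own,
    one link, one low point) and an H-block twelve; as the number of blocks is quadratic in the
    number of rounds, so is the size. *)

Definition pt := (nat * nat)%type.

(* The labels of the rows and of the columns, in order.  A label on both sides is an entry 1, a label
   on one side only is an empty row or column. *)
Definition pat := (seq nat * seq nat)%type.

Definition pat_mx (q : pat) : bmatrix (size q.1) (size q.2) :=
  (\matrix_(i, j) (nth 0%N q.1 i == nth 0%N q.2 j))%R.

Definition pat_of (q : pat) : pattern := Pattern (pat_mx q).

(** The last condition excludes having both an empty row and an empty column: an occurrence could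
    send their two labels to one point, whereas containment requires a 0 where the two lines
    cross. *)
Definition wf_pat (q : pat) : bool :=
  [&& uniq q.1, uniq q.2 & all (mem q.1) q.2 || all (mem q.2) q.1].

(* [v] also sends the label of an empty row or column to the point of the permutation on that line. *)
Definition occ (P : pt -> Prop) (q : pat) (v : nat -> pt) : Prop :=
  [/\ forall l, l \in q.1 ++ q.2 -> P (v l),
      sorted ltn [seq (v l).1 | l <- q.1] & sorted ltn [seq (v l).2 | l <- q.2]].

Definition graph n (s : 'S_n) : pt -> Prop :=
  fun p => exists i : 'I_n, p = (nat_of_ord i, nat_of_ord (s i)).

Lemma pat_mx_partial q : wf_pat q -> is_partial_pattern (pat_mx q).
Proof.
case/and3P=> uR uC _; split=> [i j1 j2|i1 i2 j]; rewrite !mxE => /eqP e1 /eqP e2.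
  by apply/ord_inj/eqP; rewrite -(@nth_uniq _ 0 q.2) // -e1 -e2.
by apply/ord_inj/eqP; rewrite -(@nth_uniq _ 0 q.1) // e1 e2.
Qed.

Lemma sorted_ltn_map_nth (f : nat -> nat) s i j :
  sorted ltn (map f s) -> i < j < size s -> f (nth 0 s i) < f (nth 0 s j).
Proof.
move=> so /andP[ij js]; have is_ := ltn_trans ij js.
rewrite -!(nth_map 0 0 f) //.
by apply: (sorted_ltn_nth ltn_trans 0 so); rewrite ?inE ?size_map.
Qed.

Lemma sorted_ltn_map_inj (f : nat -> nat) s :
  sorted ltn (map f s) -> {in s &, injective f}.
Proof.
move=> so x y xs ys e; rewrite -(nth_index 0 xs) -(nth_index 0 ys).
case: (ltngtP (index x s) (index y s)) => [l|l|-> //].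
  have := @sorted_ltn_map_nth f s _ _ so (_ : index x s < index y s < size s).
  by rewrite l index_mem ys => /(_ isT); rewrite !nth_index // e ltnn.
have := @sorted_ltn_map_nth f s _ _ so (_ : index y s < index x s < size s).
by rewrite l index_mem xs => /(_ isT); rewrite !nth_index // e ltnn.
Qed.

Lemma graph_inj1 n (s : 'S_n) x y y' : graph s (x, y) -> graph s (x, y') -> y = y'.
Proof. by case=> i [-> ->] [j [/val_inj <- ->]]. Qed.

Lemma graph_inj2 n (s : 'S_n) x x' y : graph s (x, y) -> graph s (x', y) -> x = x'.
Proof. by case=> i [-> ->] [j [-> /val_inj/perm_inj ->]]. Qed.

Lemma occ_contains n (s : 'S_n) q :
  wf_pat q -> contains (perm_bmx s) (pat_mx q) <-> exists v, occ (graph s) q v.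
Proof.
case: q => R C /and3P[/= uR uC sub]; split.
- case/existsP=> r /existsP[c /and3P[/forallP rinc /forallP cinc /forallP rc]].
  have {rinc}rinc (i j : 'I_(size R)) : i < j -> r i < r j.
    by move: (rinc i) => /forallP/(_ j)/implyP.
  have {cinc}cinc (i j : 'I_(size C)) : i < j -> c i < c j.
    by move: (cinc i) => /forallP/(_ j)/implyP.
  have {}rc (i : 'I_(size R)) (j : 'I_(size C)) :
      (s (r i) == c j) = (nth 0 R i == nth 0 C j).
    by move: (rc i) => /forallP/(_ j)/eqP; rewrite !mxE.
  pose v l : pt := if insub (index l R) is Some i then (nat_of_ord (r i), nat_of_ord (s (r i)))
    else if insub (index l C) is Some j then (nat_of_ord ((s^-1)%g (c j)), nat_of_ord (c j)) else (0, 0).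
  have vR (i : 'I_(size R)) : v (nth 0 R i) = (nat_of_ord (r i), nat_of_ord (s (r i))).
    by rewrite /v index_uniq // valK.
  have vC (j : 'I_(size C)) : (v (nth 0 C j)).2 = c j.
    rewrite /v; case: insubP => [i iR iv|_]; last by rewrite index_uniq // valK.
    have -> : s (r i) = c j by apply/eqP; rewrite rc iv nth_index // -index_mem.
    by [].
  exists v; split => /=.
  + move=> l; rewrite mem_cat /v; case: insubP => [i _ _ _|]; first by exists (r i).
    rewrite index_mem => /negbTE -> /= lC; case: insubP => [j _ _|]; last by rewrite index_mem lC.
    by exists ((s^-1)%g (c j)); rewrite permKV.
  + apply/(sortedP 0) => i; rewrite size_map => iR.
    have iR' : i < size R by apply: ltnW.
    rewrite !(nth_map 0) // (vR (Ordinal iR)) (vR (Ordinal iR')) /=; exact: rinc.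
  + apply/(sortedP 0) => i; rewrite size_map => iR.
    have iR' : i < size C by apply: ltnW.
    rewrite !(nth_map 0) // (vC (Ordinal iR)) (vC (Ordinal iR')) /=; exact: cinc.
- case=> v [/= vg vR vC].
  have [i|r rP] := @fin_all_exists _ _ (fun (i : 'I_(size R)) (x : 'I_n) =>
      v (nth 0 R i) = (nat_of_ord x, nat_of_ord (s x))).
    by apply: vg; rewrite mem_cat mem_nth.
  have [i|c cP] := @fin_all_exists _ _ (fun (i : 'I_(size C)) (x : 'I_n) =>
      v (nth 0 C i) = (nat_of_ord x, nat_of_ord (s x))).
    by apply: vg; rewrite mem_cat orbC mem_nth.
  apply/existsP; exists (finfun r); apply/existsP; exists [ffun j => s (c j)]; apply/and3P; split.
  + apply/forallP => i; apply/forallP => j; apply/implyP => ij; rewrite !ffunE.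
    have := @sorted_ltn_map_nth (fun l => (v l).1) R i j vR.
    by rewrite ij ltn_ord !rP => /(_ isT).
  + apply/forallP => i; apply/forallP => j; apply/implyP => ij; rewrite !ffunE.
    have := @sorted_ltn_map_nth (fun l => (v l).2) C i j vC.
    by rewrite ij ltn_ord !cP => /(_ isT).
  + apply/forallP => i; apply/forallP => j; rewrite !mxE !ffunE (inj_eq perm_inj).
    apply/eqP; apply/eqP/eqP => [e|e].
      have ev : v (nth 0 R i) = v (nth 0 C j) by rewrite rP cP e.
      case/orP: sub => /allP sub.
        apply: (sorted_ltn_map_inj vR); rewrite ?mem_nth ?ev //.
        by apply: sub; rewrite mem_nth.
      apply: (sorted_ltn_map_inj vC); rewrite ?mem_nth ?ev //.
      by apply: sub; rewrite mem_nth.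
    by have := rP i; rewrite e cP => -[/val_inj ->].
Qed.

(** * Toggling adjacent points *)

Definition asb (P : Prop) : bool := if excluded_middle_informative P then true else false.

Lemma asbP P : reflect P (asb P).
Proof. by rewrite /asb; case: excluded_middle_informative => ?; constructor. Qed.

Definition swp a x := if x == a then a.+1 else if x == a.+1 then a else x.

Lemma swp_sorted a s :
  sorted ltn s -> ~~ ((a \in s) && (a.+1 \in s)) -> sorted ltn (map (swp a) s).
Proof.
move=> so nas; have al : all (mem s) s by apply/allP.
apply: (homo_sorted_in _ al so).
move=> x y xs ys /= xy; rewrite /swp.
case: (x =P a) => [xa|xa]; case: (y =P a) => [ya|ya]; case: (x =P a.+1) => [xa'|xa'];
  case: (y =P a.+1) => [ya'|ya']; subst; try lia.
by case/negP: nas; apply/andP.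
Qed.

Definition swap_labels (l l' : nat) (C : seq nat) :=
  [seq if x == l then l' else if x == l' then l else x | x <- C].

Definition adjacent_in (C : seq nat) l l' :=
  [&& l \in C, l' \in C & (index l C == (index l' C).+1) || (index l' C == (index l C).+1)].

Lemma sorted_succ_index (f : nat -> nat) s x y :
  sorted ltn (map f s) -> x \in s -> y \in s -> f y = (f x).+1 -> index y s = (index x s).+1.
Proof.
move=> so xs ys fxy.
have key i j : i < size s -> j < size s -> i < j -> f (nth 0 s i) < f (nth 0 s j).
  by move=> si sj ij; apply: sorted_ltn_map_nth so _; rewrite ij.
have ix : index x s < size s by rewrite index_mem.
have iy : index y s < size s by rewrite index_mem.
case: (ltngtP (index y s) (index x s).+1) => // h.
  case: (ltngtP (index y s) (index x s)) => [h'|h'|h'].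
  - by have := key _ _ iy ix h'; rewrite !nth_index // fxy; lia.
  - by lia.
  - have := f_equal (nth 0 s) h'; rewrite !nth_index // => yx.
    by rewrite yx in fxy; lia.
have h1 := key _ _ (ltn_trans h iy) iy h.
have h2 := key _ _ ix (ltn_trans h iy) (ltnSn _).
by move: h1 h2; rewrite !nth_index // fxy; lia.
Qed.

Section Transfer.

Variables (P P' : pt -> Prop) (r c : nat).
Hypothesis swp_col : forall x y, P (x, y) -> P' (x, swp c y).
Hypothesis swp_row : forall x y, P (x, y) -> P' (swp r x, y).
Hypothesis pairP : forall x y, P (x, y) ->
  (x == r) || (x == r.+1) = (y == c) || (y == c.+1).
Hypothesis inj1 : forall x y y', P (x, y) -> P (x, y') -> y = y'.

(** If the occurrence misses one of the columns [c], [c.+1], exchanging these columns keeps it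
    sorted; if it misses one of the rows, exchanging the rows does. Otherwise both points of the
    pair are used, by two labels consecutive in both words, and the pattern with these labels
    swapped occurs. When every column label is a row label, using both columns entails using both
    rows, so the row exchange never happens. *)
Lemma occ_transfer q v : wf_pat q -> occ P q v ->
  (exists v', occ P' q v' /\ (all (mem q.1) q.2 -> forall l, (v' l).1 = (v l).1)) \/
  exists l l' v', [/\ l \in q.1 /\ l' \in q.1, index l' q.1 = (index l q.1).+1 /\ (v l).1 = r,
    adjacent_in q.2 l l', occ P' (q.1, swap_labels l l' q.2) v' & forall k, (v' k).1 = (v k).1].
Proof.
case: q => R C /and3P[/= uR uC sub] [/= vP vR vC].
have vPR l : l \in R -> P ((v l).1, (v l).2).
  by move=> lR; rewrite -surjective_pairing; apply: vP; rewrite mem_cat lR.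
have vPC l : l \in C -> P ((v l).1, (v l).2).
  by move=> lC; rewrite -surjective_pairing; apply: vP; rewrite mem_cat lC orbT.
pose v1 l : pt := ((v l).1, swp c (v l).2).
have v1P l : l \in R ++ C -> P' (v1 l).
  by rewrite mem_cat => /orP[/vPR|/vPC]; apply: swp_col.
have [cc|ncc] := boolP ((c \in [seq (v l).2 | l <- C]) && (c.+1 \in [seq (v l).2 | l <- C])); last first.
  left; exists v1; split=> //; split=> //=.
  by rewrite (map_comp (swp c) (fun l => (v l).2)); apply: swp_sorted.
case/andP: cc => /mapP[m mC cm] /mapP[m' m'C cm'].
have mm' : m != m' by apply/eqP => e; move: cm'; rewrite -e -cm; lia.
have [rr|nrr] := boolP ((r \in [seq (v l).1 | l <- R]) && (r.+1 \in [seq (v l).1 | l <- R])); last first.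
  left; exists (fun l => (swp r (v l).1, (v l).2)); split.
    split=> //= [l|]; first by rewrite mem_cat => /orP[/vPR|/vPC]; apply: swp_row.
    by rewrite (map_comp (swp r) (fun l => (v l).1)); apply: swp_sorted.
  move=> /allP CR; case/negP: nrr.
  have := pairP (vPC _ mC); have := pairP (vPC _ m'C); rewrite -cm -cm' !eqxx !orbT /=.
  have ne : (v m).1 <> (v m').1.
    by move=> e; have := inj1 (vPC _ mC); rewrite e => /(_ _ (vPC _ m'C)); lia.
  move=> /orP[]/eqP e' /orP[]/eqP e; rewrite ?e ?e' in ne *; try by [];
    apply/andP; split; apply/mapP; by [exists m => //; apply: CR|exists m' => //; apply: CR].
case/andP: rr => /mapP[l lR rl] /mapP[l' l'R rl'].
have ll' : l != l' by apply/eqP => e; move: rl'; rewrite -e -rl; lia.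
have injR := sorted_ltn_map_inj vR.
have injC := sorted_ltn_map_inj vC.
have {sub} ml : (l == m) && (l' == m') || (l == m') && (l' == m).
  case/orP: sub => /allP sub.
    have := pairP (vPC _ mC); have := pairP (vPC _ m'C); rewrite -cm -cm' !eqxx !orbT /=.
    have e1 x : x \in C -> (v x).1 == r -> x = l.
      by move=> xC /eqP e; apply: injR => //; rewrite -?rl //; apply: sub.
    have e2 x : x \in C -> (v x).1 == r.+1 -> x = l'.
      by move=> xC /eqP e; apply: injR => //; rewrite -?rl' //; apply: sub.
    move=> /orP[] h' /orP[] h; move: mm';
      rewrite ?(e1 _ mC h) ?(e2 _ mC h) ?(e1 _ m'C h') ?(e2 _ m'C h') ?eqxx ?orbT //.
  have := pairP (vPR _ lR); have := pairP (vPR _ l'R); rewrite -rl -rl' !eqxx !orbT /=.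
  have e1 x : x \in R -> (v x).2 == c -> x = m.
    by move=> xC /eqP e; apply: injC => //; rewrite -?cm //; apply: sub.
  have e2 x : x \in R -> (v x).2 == c.+1 -> x = m'.
    by move=> xC /eqP e; apply: injC => //; rewrite -?cm' //; apply: sub.
  move=> /esym/orP[] h' /esym/orP[] h; move: ll';
    rewrite ?(e1 _ lR h) ?(e2 _ lR h) ?(e1 _ l'R h') ?(e2 _ l'R h') ?eqxx ?orbT //.
have im := sorted_succ_index vC mC m'C (etrans (esym cm') (f_equal S cm)).
have swl x : x \in C -> swp c (v (if x == l then l' else if x == l' then l else x)).2 = (v x).2.
  move=> xC.
  have hx : (if x == l then l' else if x == l' then l else x) = (if x == m then m' else if x == m' then m else x).
    case/orP: ml => /andP[/eqP-> /eqP->] //.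
    by case: (x =P m) => // ->; rewrite (negbTE mm').
  rewrite hx; case: (x =P m) => [->|xm]; first by rewrite -cm' -cm /swp eqxx; case: eqP => //; lia.
  case: (x =P m') => [->|xm']; first by rewrite -cm' -cm /swp eqxx.
  rewrite /swp; case: eqP => [e|_]; first by case: xm; apply: injC => //; rewrite e.
  by case: eqP => [e|//]; case: xm'; apply: injC => //; rewrite e.
have [lC l'C] : l \in C /\ l' \in C by case/orP: ml => /andP[/eqP-> /eqP->].
right; exists l, l', v1; split=> //.
- split=> //; apply: (sorted_succ_index vR lR l'R); by rewrite -rl -rl'.
- rewrite /adjacent_in lC l'C /=; case/orP: ml => /andP[/eqP-> /eqP->]; by rewrite im eqxx ?orbT.
- split=> //= [k|].
    rewrite mem_cat => /orP[kR|]; first by apply: v1P; rewrite mem_cat kR.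
    case/mapP => x xC ->; apply: v1P; rewrite mem_cat; apply/orP; right.
    by case: ifP => // _; case: ifP.
rewrite /swap_labels -map_comp (_ : map _ _ = [seq (v x).2 | x <- C]) //.
by apply/eq_in_map => x xC /=; apply: swl.
Qed.

End Transfer.

Lemma odd_card_involution (T : finType) (A : {set T}) (f : T -> T) :
  {in A, forall x, f x \in A} -> {in A, forall x, f (f x) = x} ->
  odd #|A| = odd #|[set x in A | f x == x]|.
Proof.
have [m] := ubnP #|A|; elim: m A => // m IH A Am fA fK.
have [/existsP[x /andP[xA fx]]|] := boolP [exists x, (x \in A) && (f x != x)]; last first.
  rewrite negb_exists => /forallP h; congr (odd #|pred_of_set _|); apply/setP => x.
  by rewrite inE; case: (boolP (x \in A)) => //= xA; have := h x; rewrite xA /= negbK => ->.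
pose B := A :\ x :\ f x.
have fxA := fA _ xA.
have cA : #|A| = #|B|.+2.
  by rewrite (cardsD1 x) xA (cardsD1 (f x) (A :\ x)) !inE fx fxA.
have fB : {in B, forall y, f y \in B}.
  move=> y; rewrite !inE => /and3P[yfx yx yA]; rewrite fA // andbT; apply/andP; split.
    by apply: contra yx => /eqP/(f_equal f); rewrite !fK // => ->.
  by apply: contra yfx => /eqP <-; rewrite fK.
rewrite cA /= negbK IH //; last first.
- by move=> y; rewrite !inE => /and3P[_ _ yA]; apply: fK.
- by move: Am; rewrite cA; lia.
congr (odd #|pred_of_set _|); apply/setP => y; rewrite !inE.
case: (y =P x) => [->|_]; first by rewrite (negbTE fx) !andbF.
by case: (y =P f x) => [->|_] //=; rewrite fK // eq_sym (negbTE fx) andbF.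
Qed.

Definition contains_pat n (s : 'S_n) q := exists v, occ (graph s) q v.

(* The toggled labels 1 and 2 may leave [Q] only for the patterns of [Ex]. *)
Definition toggle_closed (Q Ex : seq pat) :=
  all (fun q => all (fun k => let l := nth 0 q.1 k in let l' := nth 0 q.1 k.+1 in
    adjacent_in q.2 l l' ==>
      (((q.1, swap_labels l l' q.2) \in Q) || ((q \in Ex) && (l == 1))))
    (iota 0 (size q.1).-1)) Q.

Lemma toggle_closedP Q Ex q l l' : toggle_closed Q Ex -> q \in Q -> l \in q.1 -> l' \in q.1 ->
  index l' q.1 = (index l q.1).+1 -> adjacent_in q.2 l l' ->
  (q.1, swap_labels l l' q.2) \in Q \/ q \in Ex /\ l = 1.
Proof.
move=> /allP cl qQ lq l'q il adj.
have := index_mem l' q.1; rewrite l'q il => il'.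
have /allP/(_ (index l q.1)) := cl q qQ.
rewrite mem_iota /= -il !nth_index // adj /= => h. case/orP: (h ltac:(by rewrite il; case: (size q.1) il')) => [|/andP[? /eqP]]; by [left|right].
Qed.

Section Toggle.

Variables (n : nat) (s : 'S_n) (i j : 'I_n).
Hypothesis ij : nat_of_ord j = i.+1.
Hypothesis sij : (nat_of_ord (s j) == (s i).+1) || (nat_of_ord (s i) == (s j).+1).

Definition toggled : 'S_n := (tperm i j * s)%g.

Let swpE (x : 'I_n) : swp i x = tperm i j x.
Proof.
rewrite /swp -ij !(inj_eq (@ord_inj _)); case: tpermP => [->|->|/eqP xi /eqP xj].
- by rewrite eqxx.
- by case: (j =P i) => [->|_]; rewrite ?eqxx.
- by rewrite (negbTE xi) (negbTE xj).
Qed.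

Let c := minn (s i) (s j).

Let scE (x : 'I_n) : swp c (s x) = s (tperm i j x) :> nat.
Proof.
have cc (y : 'I_n) : (nat_of_ord (s y) == s i) = (y == i) by rewrite (inj_eq (@ord_inj _)) (inj_eq perm_inj).
have cc' (y : 'I_n) : (nat_of_ord (s y) == s j) = (y == j) by rewrite (inj_eq (@ord_inj _)) (inj_eq perm_inj).
rewrite /swp /c; case: tpermP => [->|->|/eqP xi /eqP xj].
- by case: ifP => h1; last case: ifP => h2; lia.
- by case: ifP => h1; last case: ifP => h2; lia.
- by move: xi xj; rewrite -cc -cc'; case: ifP => h1; last case: ifP => h2; lia.
Qed.

Lemma toggled_occ q v : wf_pat q -> occ (graph s) q v ->
  (exists v', occ (graph toggled) q v' /\ (all (mem q.1) q.2 -> forall l, (v' l).1 = (v l).1)) \/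
  exists l l' v', [/\ l \in q.1 /\ l' \in q.1, index l' q.1 = (index l q.1).+1 /\ (v l).1 = i,
    adjacent_in q.2 l l', occ (graph toggled) (q.1, swap_labels l l' q.2) v' & forall k, (v' k).1 = (v k).1].
Proof.
apply: (@occ_transfer _ _ i c).
- by move=> _ _ [x [-> ->]]; exists x; rewrite scE permM.
- by move=> _ _ [x [-> ->]]; exists (tperm i j x); rewrite swpE permM tpermK.
- move=> _ _ [x [-> ->]].
  have cc (y : 'I_n) : (nat_of_ord (s y) == s i) = (y == i) by rewrite (inj_eq (@ord_inj _)) (inj_eq perm_inj).
  have cc' (y : 'I_n) : (nat_of_ord (s y) == s j) = (y == j) by rewrite (inj_eq (@ord_inj _)) (inj_eq perm_inj).
  rewrite -ij !(inj_eq (@ord_inj _)) -cc -cc' /c; lia.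
- exact: graph_inj1.
Qed.

Lemma toggled_at : toggled i = s j /\ toggled j = s i.
Proof. by rewrite /toggled !permM tpermL tpermR. Qed.

End Toggle.

Lemma toggledK n (s : 'S_n) i j : toggled (toggled s i j) i j = s.
Proof. by rewrite /toggled mulgA tperm2 mul1g. Qed.

(* [B], [K] and [P] are meant to be the blocks, the links and the starting blocks, and [N] the forbidden
   links. *)
Section Parity.

Variables (F B K N P : seq pat).
Hypothesis wfF : all wf_pat F.
Hypothesis wfB : all (fun q => wf_pat q && all (mem q.1) q.2) (B ++ K ++ P).
Hypothesis clF : toggle_closed F N.
Hypothesis clB : toggle_closed B [::].
Hypothesis clK : toggle_closed K [::].
Hypothesis clP : toggle_closed P [::].
Hypothesis NK : {subset N <= K}.

Variable n : nat.
Implicit Type s : 'S_n.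

Definition avoids_all s := forall q, q \in F -> ~ contains_pat s q.

Hypothesis blockadj : forall s q v, avoids_all s -> q \in B -> occ (graph s) q v ->
  (v 2).1 = (v 1).1.+1 /\ ((v 2).2 == (v 1).2.+1) || ((v 1).2 == (v 2).2.+1).
Hypothesis Blabels : forall q, q \in B -> (1 \in q.1) && (2 \in q.1).

Definition occ_at (Q : seq pat) s r := exists q v, [/\ q \in Q, occ (graph s) q v & (v 1).1 = r].

Definition unlinked s r := occ_at B s r /\ ~ occ_at K s r.

Definition candidate s := avoids_all s /\ exists2 q, q \in P & contains_pat s q.

Let unl s r := asb (unlinked s r).

Let adj s (i j : 'I_n) :=
  nat_of_ord j = i.+1 /\ (nat_of_ord (s j) == (s i).+1) || (nat_of_ord (s i) == (s j).+1).

Lemma unlinked_adj s r : avoids_all s -> occ_at B s r ->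
  exists i j : 'I_n, nat_of_ord i = r /\ adj s i j.
Proof.
move=> av [q [v [qB oc vr]]].
have /andP[q1 q2] := Blabels qB.
have [e1 e2] := blockadj av qB oc.
have [vP _ _] := oc.
have [i iv] : graph s (v 1) by apply: vP; rewrite mem_cat q1.
have [j jv] : graph s (v 2) by apply: vP; rewrite mem_cat q2.
by exists i, j; move: vr e1 e2; rewrite iv jv /= /adj.
Qed.

Lemma adj_toggled s (i j : 'I_n) : adj s i j -> adj (toggled s i j) i j.
Proof. by case=> ij sij; have [a b] := toggled_at s i j; split=> //; rewrite a b orbC. Qed.

Lemma occ_at_toggled1 Q s (i j : 'I_n) r :
  {subset Q <= B ++ K ++ P} -> toggle_closed Q [::] -> adj s i j ->
  occ_at Q s r -> occ_at Q (toggled s i j) r.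
Proof.
move=> sub cl [ij sij] [q [v [qQ oc vr]]].
have /allP/(_ q (sub _ qQ))/andP[wq fq] := wfB.
case: (toggled_occ ij sij wq oc) => [[v' [oc' /(_ fq) e]]|[l [l' [v' [[lq l'q] [il _] ad oc' e]]]]].
  by exists q, v'; rewrite e.
have [qQ'|[]//] := toggle_closedP cl qQ lq l'q il ad.
by exists (q.1, swap_labels l l' q.2), v'; rewrite e.
Qed.

Lemma occ_at_toggled Q s (i j : 'I_n) r :
  {subset Q <= B ++ K ++ P} -> toggle_closed Q [::] -> adj s i j ->
  occ_at Q (toggled s i j) r <-> occ_at Q s r.
Proof.
move=> sub cl a; split=> h; last exact: occ_at_toggled1.
by rewrite -(toggledK s i j); apply: occ_at_toggled1 => //; apply: adj_toggled.
Qed.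

Lemma unlinked_toggled s (i j : 'I_n) r : adj s i j ->
  unlinked (toggled s i j) r <-> unlinked s r.
Proof.
move=> a; rewrite /unlinked !occ_at_toggled //.
  by move=> q qK; rewrite !mem_cat qK orbT.
by move=> q qB; rewrite !mem_cat qB.
Qed.

(** A forbidden pattern created by the toggle must be a link of [N] at row [i]; as [K] is closed
    under toggling, [s] itself would have a link at [i]. *)
Lemma avoids_all_toggled s (i j : 'I_n) : adj s i j -> unlinked s i ->
  avoids_all s -> avoids_all (toggled s i j).
Proof.
move=> a u av q qF [v oc].
have [ij sij] := adj_toggled a.
have /allP/(_ q qF) wq := wfF.
case: (toggled_occ ij sij wq oc) => [[v' [oc' _]]|[l [l' [v' [[lq l'q] [il vi] ad oc' e]]]]].
  by apply: (av q qF); exists v'; rewrite toggledK in oc'.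
rewrite toggledK in oc'.
have [qF'|[qN l1]] := toggle_closedP clF qF lq l'q il ad.
  by apply: (av _ qF'); exists v'.
case: u => _; apply; rewrite -(occ_at_toggled _ _ clK a); last first.
  by move=> q' qK; rewrite !mem_cat qK orbT.
by exists q, v; rewrite -l1; split=> //; apply: NK.
Qed.

Lemma candidate_toggled s (i j : 'I_n) : adj s i j -> unlinked s i ->
  candidate s -> candidate (toggled s i j).
Proof.
move=> a u [av [q qP [v oc]]]; split; first exact: avoids_all_toggled.
have [||q' [v' [q'P oc' _]]] := @occ_at_toggled1 P s i j (v 1).1 _ clP a.
- by move=> q' q'P; rewrite !mem_cat q'P !orbT.
- by exists q, v.
by exists q' => //; exists v'.
Qed.

Let ok s (x : 'I_n * 'I_n) := asb (adj s x.1 x.2) && unl s x.1.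

Let tog s : 'S_n := if [pick x | ok s x] is Some x0
  then let x := [arg min_(x < x0 | ok s x) (x.1 : nat)] in toggled s x.1 x.2 else s.

(** This makes [tog] an involution: the least pair selected after a toggle is the one selected
    before. *)
Lemma ok_toggled s (i j : 'I_n) (x : 'I_n * 'I_n) : candidate s -> adj s i j -> unlinked s i ->
  ok (toggled s i j) x = ok s x.
Proof.
move=> cs a u; have := unlinked_toggled x.1 a => ut.
have adjE t y : (nat_of_ord (y : 'I_n * 'I_n).2 == y.1.+1) && unl t y.1 -> avoids_all t -> ok t y.
  case/andP => /eqP e uy av; rewrite /ok uy andbT; apply/asbP.
  have /asbP[ob _] := uy.
  have [i' [j' [e1 e2]]] := unlinked_adj av ob.
  have -> : y.1 = i' by apply: val_inj.
  have -> : y.2 = j' by apply: val_inj => /=; rewrite e -e1; case: e2.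
  exact: e2.
have eok t : ok t x -> (nat_of_ord x.2 == x.1.+1) && unl t x.1.
  by case/andP => /asbP[-> _] ->; rewrite eqxx.
have eu : unl (toggled s i j) x.1 = unl s x.1 by apply/asbP/asbP => /ut.
have [av _] := cs; have av' := avoids_all_toggled a u av.
apply/idP/idP => /eok; rewrite ?eu => h; apply: adjE => //.
by rewrite eu.
Qed.

Lemma tog_some s (x : 'I_n * 'I_n) : ok s x -> exists y, [/\ ok s y, tog s = toggled s y.1 y.2 &
  forall x, ok s x -> y.1 <= x.1].
Proof.
move=> okx; rewrite /tog; case: pickP => [x0 okx0|/(_ x)]; last by rewrite okx.
by case: arg_minnP => // y oky ymin; exists y.
Qed.

Lemma tog_none s : (forall x, ~~ ok s x) -> tog s = s.
Proof. by move=> h; rewrite /tog; case: pickP => // x okx; case/negP: (h x). Qed.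

Lemma ok_fun s x y : ok s x -> ok s y -> x.1 = y.1 -> x = y.
Proof.
case: x => x1 x2; case: y => y1 y2 /andP[/asbP[/= e _] _] /andP[/asbP[/= e' _] _] h.
by congr pair => //; apply: ord_inj; rewrite e e' h.
Qed.

Lemma candidate_parity :
  odd #|[set s : 'S_n | asb (candidate s)]| =
  odd #|[set s : 'S_n | asb (candidate s /\ forall r, ~ unlinked s r)]|.
Proof.
have togP s : candidate s -> candidate (tog s) /\ tog (tog s) = s.
  move=> cs; have [/existsP[x okx]|] := boolP [exists x, ok s x]; last first.
    by rewrite negb_exists => /forallP/tog_none h; rewrite !h.
  have [y [oky -> ymin]] := tog_some okx.
  have /andP[/asbP a /asbP u] := oky; split; first exact: candidate_toggled.
  have okE z := ok_toggled z cs a u.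
  have oky' : ok (toggled s y.1 y.2) y by rewrite okE.
  have [z [okz -> zmin]] := tog_some oky'.
  rewrite okE in okz.
  have -> : z = y.
    by apply: (ok_fun okz oky); apply/ord_inj/eqP; rewrite eqn_leq ymin // zmin.
  by rewrite -[RHS](toggledK s y.1 y.2).
rewrite (@odd_card_involution _ _ tog).
- congr (odd #|pred_of_set _|); apply/setP => s; rewrite !inE.
  apply/andP/asbP => [[/asbP cs /eqP e]|[cs nu]]; last first.
    split; first exact/asbP.
    by apply/eqP/tog_none => x; apply/negP => /andP[_ /asbP]; apply: nu.
  split=> // r u; have [i [j [ir a]]] := unlinked_adj cs.1 u.1.
  have okij : ok s (i, j) by rewrite /ok /= ir; apply/andP; split; apply/asbP.
  have [y [/andP[/asbP [yy _] _] ey _]] := tog_some okij.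
  move: e; rewrite ey => /(f_equal (fun s : 'S_n => s y.1)).
  have [-> _] := toggled_at s y.1 y.2; move/perm_inj => e.
  by move: yy; rewrite e; lia.
- by move=> s; rewrite !inE => /asbP/togP[h _]; apply/asbP.
- by move=> s; rewrite inE => /asbP/togP[].
Qed.

End Parity.

(** * Blocks and links *)

(* First block, block pushing one link, block pushing two links, last block. *)
Inductive kind := KL | KX | KH | KR.

Definition kind_code t := match t with KL => 0 | KX => 1 | KH => 2 | KR => 3 end.
Definition kind_decode c := match c with 0 => KL | 1 => KX | 2 => KH | _ => KR end.

Lemma kind_codeK : cancel kind_code kind_decode.
Proof. by case. Qed.

HB.instance Definition _ := Equality.copy kind (can_type kind_codeK).

(** Column by column, the row of the point. All words start with the decreasing run 7, 5, 3, 0: four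
    points of a chain decrease like this only if two of them share a block ([chain4]). Without 2 the
    words are the simple permutations of [frame_simple]. *)
Definition colword (t : kind) : seq nat :=
  match t with
  | KL => [:: 7; 5; 3; 0; 8; 1; 2; 4; 6]
  | KX => [:: 7; 5; 3; 0; 6; 1; 2; 8; 4]
  | KH => [:: 7; 5; 3; 0; 8; 1; 2; 6; 4]
  | KR => [:: 7; 5; 3; 0; 4; 8; 1; 2; 6]
  end.

Definition at_slot (k : nat) (s : seq nat) := [seq 10 * k + i | i <- s].

(* The points 1 and 2 of a block are adjacent, and exchanged if [b]; a frame is a block without its
   point 2, hence insensitive to the exchange.  Labels [10 * k + i] are in the [k]-th block of a pattern. *)
Definition block k := at_slot k (iota 0 9).
Definition blockC k t (b : bool) := at_slot k (if b then swap_labels 1 2 (colword t) else colword t).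
Definition frame k := at_slot k [:: 0; 1; 3; 4; 5; 6; 7; 8].
Definition frameC k t := at_slot k [seq i <- colword t | i != 2].

Definition kinds := [:: KL; KX; KH; KR].
Definition steps := [:: (KL, KH); (KX, KX); (KX, KH); (KH, KX); (KH, KH); (KH, KR)].
Definition signs := [:: false; true].

Definition is_L t := if t is KL then true else false.
Definition is_R t := if t is KR then true else false.

Definition blocks_of t : seq pat := [seq (block 0, blockC 0 t b) | b <- signs].
Definition blocks : seq pat := flatten [seq blocks_of t | t <- kinds].

Definition row_gap_len t := match t with KL => 1 | KX => 2 | KH => 3 | KR => 0 end.
Definition col_gap_len t t' := if is_L t || is_R t' then 1 else 2.

(* Labels 101, 105 and 106 are points below the diagonal tying each block to the next one, 100 is the
   link popped between the two blocks, 102 and 103 are the links pushed by the first block. *)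
Definition link t t' b b' : pat :=
  ((if is_L t then [::] else [:: 100]) ++ block 0 ++
     match t with KL => [:: 102] | KX => [:: 101; 102] | _ => [:: 102; 101; 103] end ++
     block 1 ++ 105 :: (if is_R t' then [::] else [:: 106]),
   (if is_L t then [::] else [:: 101]) ++ 105 :: blockC 0 t b ++
     (if is_L t then [::] else [:: 100]) ++ (if is_R t' then [::] else [:: 106]) ++
     blockC 1 t' b' ++ 102 :: (if t is KH then [:: 103] else [::])).

Definition links_signed (b : bool) : seq pat :=
  (block 0, blockC 0 KR b) :: [seq link p.1 p.2 b b' | p <- steps, b' <- signs].
Definition links : seq pat := links_signed false ++ links_signed true.

Definition blanks m := iota 110 m.

Definition insert_blank k (s : seq nat) := take k s ++ 100 :: drop k s.

(* These make blocks intervals. *)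
Definition interval_pats : seq pat :=
  [seq (insert_blank k q.1, q.2) | q <- blocks, k <- iota 1 8] ++
  [seq (q.1, insert_blank k q.2) | q <- blocks, k <- iota 1 8].

(* The rows and columns between consecutive blocks are exactly those used by the links. *)
Definition row_gap_pat t t' : pat :=
  (frame 0 ++ blanks (row_gap_len t).+1 ++ frame 1 ++ [:: 105], 105 :: frameC 0 t ++ frameC 1 t').
Definition col_gap_pat t t' : pat :=
  (frame 0 ++ frame 1 ++ [:: 105], 105 :: frameC 0 t ++ blanks (col_gap_len t t').+1 ++ frameC 1 t').
Definition gap_pats : seq pat :=
  [seq row_gap_pat p.1 p.2 | p <- steps] ++ [seq col_gap_pat p.1 p.2 | p <- steps].

Definition above_L : pat := (100 :: frame 0, frameC 0 KL).
Definition left_L : pat := (frame 0, [:: 100; 101] ++ frameC 0 KL).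
Definition below_R : pat := (frame 0 ++ [:: 100; 101], frameC 0 KR).

(* A point tying two blocks together allows no block in between, and links do not overtake each other. *)
Definition triple_pat t t' t'' : pat :=
  (frame 0 ++ frame 1 ++ frame 2 ++ [:: 105], 105 :: frameC 0 t ++ frameC 1 t' ++ frameC 2 t'').
Definition fifo_pat t t' : pat :=
  (100 :: frame 0 ++ 101 :: frame 1, frameC 0 t ++ frameC 1 t' ++ [:: 101; 100]).

(* The link 100 is pushed by a block of kind [p.1] and popped by a block of kind [p'.1].  The first link
   pushed by an H-block must be popped by an H-block, the other links by X-blocks. *)
Definition mismatch_pat m m' p p' : pat :=
  (frame 0 ++ blanks m ++ 100 :: iota 120 m' ++ frame 1 ++ 105 :: frame 2 ++ frame 3 ++ [:: 106],
   105 :: frameC 0 p.1 ++ frameC 1 p.2 ++ 106 :: frameC 2 p'.1 ++ 100 :: frameC 3 p'.2).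
Definition from_X := [:: (KX, KX); (KX, KH)].
Definition from_H := [:: (KH, KX); (KH, KH)].
Definition to_H := [:: (KH, KX); (KH, KH); (KH, KR)].
(** The three rows of the gap after an H-block hold its first link, a low point and its last link:
    two blanks after 100 make it the first link, two blanks before make it the last. An X-block
    pushes one link only and needs no blanks. *)
Definition mismatch_pats : seq pat :=
  [seq mismatch_pat 0 0 p p' | p <- from_X, p' <- to_H] ++
  [seq mismatch_pat 0 2 p p' | p <- from_H, p' <- from_X] ++
  [seq mismatch_pat 2 0 p p' | p <- from_H, p' <- to_H].

(** A mismatch pattern involves four distinct blocks, but the block at position 2 pops a link of the
    block just before it. Its kind is fixed by this separate pattern. *)
Definition start_pat : pat :=
  (frame 0 ++ frame 1 ++ 105 :: frame 2 ++ [:: 106],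
   105 :: frameC 0 KL ++ 106 :: frameC 1 KH ++ frameC 2 KX).

Definition forbidden : seq pat :=
  interval_pats ++ links_signed true ++ gap_pats ++ [:: above_L; left_L; below_R; start_pat] ++
  flatten [seq [seq triple_pat t t' t'' | t <- kinds, t' <- kinds] | t'' <- kinds] ++
  [seq fifo_pat t t' | t <- kinds, t' <- kinds] ++ mismatch_pats.

Lemma forbidden_wf : all wf_pat forbidden.
Proof. by vm_compute. Qed.

Lemma forbidden_closed : toggle_closed forbidden (links_signed true).
Proof. by vm_compute. Qed.

Lemma blocks_closed : toggle_closed blocks [::].
Proof. by vm_compute. Qed.

Lemma links_closed : toggle_closed links [::].
Proof. by vm_compute. Qed.

Lemma blocks_L_closed : toggle_closed (blocks_of KL) [::].
Proof. by vm_compute. Qed.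

Lemma blocks_links_full :
  all (fun q => wf_pat q && all (mem q.1) q.2) (blocks ++ links ++ blocks_of KL).
Proof. by vm_compute. Qed.

(** The list has 253 members; 6000 leaves room for adding the starting blocks under the required
    bound. *)
Lemma forbidden_small :
  (size forbidden <= 6000) && all (fun q : pat => (size q.1 <= 80) && (size q.2 <= 80)) forbidden.
Proof. by vm_compute. Qed.

Lemma blocks_labels q : q \in blocks -> (1 \in q.1) && (2 \in q.1).
Proof.
have h : all (fun q : pat => (1 \in q.1) && (2 \in q.1)) blocks by vm_compute.
by move/(allP h).
Qed.

Lemma links_forbidden : {subset links_signed true <= forbidden}.
Proof. by apply/allP; vm_compute. Qed.

Lemma links_split q : q \in links -> q \in links_signed false \/ q \in links_signed true.
Proof. by rewrite mem_cat => /orP[]; [left|right]. Qed.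

Lemma gap_pats_forbidden t t' : (t, t') \in steps ->
  row_gap_pat t t' \in forbidden /\ col_gap_pat t t' \in forbidden.
Proof.
have /allP h : all (fun p => (row_gap_pat p.1 p.2 \in forbidden) && (col_gap_pat p.1 p.2 \in forbidden)) steps.
  by vm_compute.
by move/h => /andP.
Qed.

Lemma corner_pats_forbidden :
  [/\ above_L \in forbidden, left_L \in forbidden, below_R \in forbidden & start_pat \in forbidden].
Proof.
have /and5P[-> -> -> -> _] : [&& above_L \in forbidden, left_L \in forbidden, below_R \in forbidden,
    start_pat \in forbidden & true] by vm_compute.
by split.
Qed.

Lemma triple_pat_forbidden t t' t'' : triple_pat t t' t'' \in forbidden.
Proof. by case: t; case: t'; case: t''; vm_cast_no_check (erefl true). Qed.

Lemma fifo_pat_forbidden t t' : fifo_pat t t' \in forbidden.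
Proof. by case: t; case: t'; vm_cast_no_check (erefl true). Qed.

Lemma mismatch_pats_forbidden t t' : t <> KR ->
  [/\ (KX, t) \in steps -> (KH, t') \in steps -> mismatch_pat 0 0 (KX, t) (KH, t') \in forbidden,
      (KH, t) \in steps -> (KX, t') \in steps -> mismatch_pat 0 2 (KH, t) (KX, t') \in forbidden &
      (KH, t) \in steps -> (KH, t') \in steps -> mismatch_pat 2 0 (KH, t) (KH, t') \in forbidden].
Proof.
have /allP h1 : all (fun p => all (fun p' => mismatch_pat 0 0 p p' \in forbidden) to_H) from_X.
  by vm_compute.
have /allP h2 : all (fun p => all (fun p' => mismatch_pat 0 2 p p' \in forbidden) from_X) from_H.
  by vm_compute.
have /allP h3 : all (fun p => all (fun p' => mismatch_pat 2 0 p p' \in forbidden) to_H) from_H.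
  by vm_compute.
have sX u : (KX, u) \in steps -> (KX, u) \in from_X by case: u.
have sH u : (KH, u) \in steps -> (KH, u) \in to_H by case: u.
have sH' : t <> KR -> (KH, t) \in steps -> (KH, t) \in from_H by case: t.
move=> tR; split=> s1 s2.
- by have /allP h := h1 _ (sX _ s1); apply: h; apply: sH.
- by have /allP h := h2 _ (sH' tR s1); apply: h; apply: sX.
- by have /allP h := h3 _ (sH' tR s1); apply: h; apply: sH.
Qed.

(** * The queue word *)

(* Position in the word L H HX HXX HXXX ...: round and offset in the round. *)
Fixpoint round_pos (i : nat) : nat * nat :=
  if i is j.+1 then
    let: (r, c) := round_pos j in if c.+1 < r then (r, c.+1) else (r.+1, 0)
  else (0, 0).

Fixpoint round_start (r : nat) : nat := if r is q.+1 then round_start q + maxn q 1 else 0.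

Definition is_first i := (round_pos i).2 == 0.
Definition word i := if i == 0 then KL else if is_first i then KH else KX.
(* The block at position [i] pops a link pushed by the block at position [origin i], its first one iff
   [is_first i]. *)
Definition origin i := round_start (round_pos i).1.-1 + (round_pos i).2.-1.

Lemma round_posP i : let: (r, c) := round_pos i in i = round_start r + c /\ c < maxn r 1.
Proof.
elim: i => //= i; case: (round_pos i) => r c [-> cr].
by case: ifP => h /=; split; lia.
Qed.

Lemma round_start_mono q r : q <= r -> round_start q <= round_start r.
Proof.
elim: r => [|r IH]; first by rewrite leqn0 => /eqP ->.
by rewrite leq_eqVlt => /orP[/eqP -> //|/IH]; rewrite /=; lia.
Qed.

Lemma round_pos_start r c : c < maxn r 1 -> round_pos (round_start r + c) = (r, c).
Proof.
elim: r c => [|r IH] c; first by case: c => //=; lia.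
elim: c => [|c IHc] cr.
  have -> : round_start r.+1 + 0 = (round_start r + (maxn r 1).-1).+1 by rewrite /=; lia.
  by rewrite /= IH; [case: ifP => // h; lia|lia].
by rewrite addnS [LHS]/= IHc; [case: ifP => // h; lia|lia].
Qed.

Lemma round_startS r : 0 < r -> round_start r.+1 = round_start r + r.
Proof. by move=> r0 /=; lia. Qed.

Lemma word_start r : 0 < r -> word (round_start r) = KH.
Proof.
move=> r0; have e : round_pos (round_start r) = (r, 0).
  by rewrite -[round_start r]addn0 round_pos_start //; lia.
rewrite /word /is_first e /=; case: eqP => // h; move: e; rewrite h /=; case: r r0 {h} => //.
Qed.

Lemma round_pos_gt0 i : 0 < i -> 0 < (round_pos i).1.
Proof.
have := round_posP i; case: (round_pos i) => r c /= [-> h].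
by case: r h => //=; lia.
Qed.

Lemma wordS r c : 0 < c -> c < r -> word (round_start r + c) = KX.
Proof.
move=> c0 cr; rewrite /word /is_first round_pos_start /=; last by lia.
by case: eqP => [|_]; [lia|case: eqP => //; lia].
Qed.

Lemma word_first i : 0 < i -> (word i = if is_first i then KH else KX).
Proof. by rewrite /word; case: i. Qed.

Lemma origin_lt i : 0 < i -> origin i < i.
Proof.
move=> i0; rewrite /origin; have := round_pos_gt0 i0; have := round_posP i.
by case: (round_pos i) => -[//|r] c /= [-> h] _; lia.
Qed.

(* An H-block pushes the next two links; otherwise the next link is pushed by the next block. *)
Lemma origin_next i : 0 < i ->
  (is_first i /\ word (origin i) = KH /\ origin i.+1 = origin i /\ ~~ is_first i.+1) \/
  ((~~ is_first i \/ word (origin i) = KL) /\ origin i.+1 = (origin i).+1 /\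
   word (origin i).+1 = if is_first i.+1 then KH else KX).
Proof.
move=> i0; rewrite /origin /is_first /=.
have := round_pos_gt0 i0; have := round_posP i.
case: (round_pos i) => r c /= [ei h] r0.
have {h r0}cr : c < r by lia.
case: c cr ei => [|c] cr ei /=.
  case: ifP => r1 /=.
    left; split=> //; split; last by rewrite addn0.
    by rewrite addn0 word_start //; lia.
  have -> : r = 1 by lia.
  by right; split; [right|].
right; split; first by left.
case: ifP => h /=.
  by split; [lia|rewrite -addnS wordS //; lia].
have e : c.+1 = r.-1 by lia.
have -> : (round_start r.-1 + c).+1 = round_start r by case: r cr {ei h} e => //= r; lia.
by split; [lia|rewrite word_start //; lia].
Qed.

Lemma origin_first i : 0 < i -> is_first i -> word (origin i) = KL \/ word (origin i) = KH.
Proof.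
move=> i0; rewrite /is_first /origin => /eqP ->; have := round_pos_gt0 i0.
case: (round_pos i) => -[//|[|r]] c _ /=; first by left.
by right; rewrite addn0 (word_start (ltn0Sn r)).
Qed.

Lemma origin_last i : ~~ is_first i -> word (origin i) = KH \/ word (origin i) = KX.
Proof.
rewrite /is_first /origin; have := round_posP i.
case: (round_pos i) => r [//|c] /= [_ cr] _.
case: c cr => [|c] cr; first by left; rewrite addn0 word_start //; lia.
by right; rewrite wordS //; lia.
Qed.

(** The key is the row which [link_at] gives to the link popped at position [i], with 10 and 12 for
    the first and the last link of a block; its growth is the first-in first-out rule. *)
Lemma link_key_lt i j : 0 < i < j ->
  20 * origin i + (if is_first i then 10 else 12) < 20 * origin j + (if is_first j then 10 else 12).
Proof.
case/andP=> i0; elim: j => // j IH; rewrite ltnS leq_eqVlt => /orP[/eqP <-|ij].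
  case: (origin_next i0) => [[-> [_ [-> /negbTE->]]]|[_ [-> _]]]; first by lia.
  by case: (is_first i); case: (is_first i.+1); lia.
have j0 : 0 < j by apply: leq_ltn_trans ij.
apply: ltn_trans (IH ij) _.
case: (origin_next j0) => [[-> [_ [-> /negbTE->]]]|[_ [-> _]]]; first by lia.
by case: (is_first j); case: (is_first j.+1); lia.
Qed.

Lemma link_key_inj i j : 0 < i -> 0 < j ->
  20 * origin i + (if is_first i then 10 else 12) = 20 * origin j + (if is_first j then 10 else 12) ->
  i = j.
Proof.
move=> i0 j0 e; case: (ltngtP i j) => // h.
  by have := @link_key_lt i j; rewrite i0 h e ltnn => /(_ isT).
by have := @link_key_lt j i; rewrite j0 h e ltnn => /(_ isT).
Qed.

(** The last link of the block at round [q] and offset [c] is popped in the next round at offset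
    [c.+1]. For blocks up to the start of round [r], the latest such pop is at
    [round_start r.+1 + 1]. *)
Lemma origin_push_last k r : k <= round_start r -> word k <> KL ->
  exists j, [/\ 0 < j <= round_start r.+1 + 1, origin j = k & is_first j = false].
Proof.
move=> kr wk; have k0 : 0 < k by case: k wk {kr} => //; case.
have := round_pos_gt0 k0; have := round_posP k.
case E : (round_pos k) => [q c] /= [ek h] q0.
exists (round_start q.+1 + c.+1); rewrite /origin /is_first round_pos_start /=; last by lia.
split=> //.
case: (ltngtP q r) => [qr|rq|qr].
- by have := @round_start_mono q.+2 r.+1 qr; rewrite /=; lia.
- by have := @round_start_mono r.+1 q rq; rewrite /=; lia.
- by move: ek kr; rewrite qr /=; lia.
Qed.

Lemma origin_push_first k r : k <= round_start r -> 0 < r -> (word k = KL \/ word k = KH) ->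
  exists j, [/\ 0 < j <= round_start r.+1 + 1, origin j = k & is_first j].
Proof.
move=> kr r0 [] wk.
  exists 1; split=> //; first by rewrite /=; lia.
  by have [-> //|k0] := posnP k; move: wk; rewrite word_first //; case: ifP.
have k0 : 0 < k by case: k wk {kr} => //.
move: wk; rewrite word_first // /is_first.
have := round_pos_gt0 k0; have := round_posP k.
case E : (round_pos k) => [q c] /= [ek h] q0; case: eqP => // c0 _.
have e : round_pos (round_start q.+1) = (q.+1, 0) by rewrite -[round_start _]addn0 round_pos_start.
exists (round_start q.+1); rewrite /origin /is_first e /= !addn0.
split=> //; last by rewrite ek c0 addn0.
have [qr|rq] := leqP q r; last by have := @round_start_mono r.+1 q rq; rewrite /=; lia.
by have := @round_start_mono q.+1 r.+1 qr; rewrite /=; lia.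
Qed.

Lemma origin_bound r j : 0 < r -> 0 < j <= round_start r.+1 + 1 -> origin j <= round_start r.
Proof.
move=> r0 /andP[j0 jr].
have e : origin (round_start r.+1 + 1) = round_start r.
  by rewrite /origin round_pos_start /= ?addn0 //; lia.
case: (ltngtP j (round_start r.+1 + 1)) jr => // [h _|-> _]; last by rewrite e.
have := @link_key_lt j (round_start r.+1 + 1); rewrite j0 h e => /(_ isT).
by case: ifP; case: ifP; lia.
Qed.

(** * Blocks in a permutation *)

(* (row, column, kind) of the corner of a block *)
Definition corner := (nat * nat * kind)%type.

Definition block_pt (d : corner) i : pt := (d.1.1 + i, d.1.2 + index i (colword d.2)).

(* Labels of block points are sent to the blocks [d0, ds], the others according to [al]. *)
Definition assign (d0 : corner) (ds : seq corner) (al : seq (nat * pt)) l : pt :=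
  if l < 100 then block_pt (nth d0 ds (l %/ 10)) (minn (l %% 10) 8)
  else nth (block_pt d0 0) (unzip2 al) (index l (unzip1 al)).

(** The lower bound lets a long label word be proved sorted from left to right, each piece handing
    its end to the next. *)
Definition increasing_from lo (f : nat -> nat) s :=
  all (fun x => lo <= f x) s && sorted ltn (map f s).

Lemma increasing_from_cons lo f x s :
  lo <= f x -> increasing_from (f x).+1 f s -> increasing_from lo f (x :: s).
Proof.
move=> lx /andP[al so]; apply/andP; split=> /=.
  by rewrite lx; apply: sub_all al => y /=; lia.
by rewrite path_min_sorted // all_map.
Qed.

Lemma increasing_from_cat lo hi f s s' : lo <= hi ->
  all (fun x => lo <= f x < hi) s -> sorted ltn (map f s) -> increasing_from hi f s' ->
  increasing_from lo f (s ++ s').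
Proof.
move=> lohi als so /andP[al' so']; apply/andP; split.
  rewrite all_cat; apply/andP; split.
    by apply: sub_all als => y /andP[].
  by apply: sub_all al' => y /=; lia.
rewrite map_cat !(sorted_pairwise ltn_trans) pairwise_cat -!(sorted_pairwise ltn_trans) so so' !andbT.
apply/allrelP => x y /mapP[a /(allP als) ha ->] /mapP[b /(allP al') hb ->] /=; lia.
Qed.

Lemma assign_block d0 ds al k i : k < 10 -> i < 9 ->
  assign d0 ds al (10 * k + i) = block_pt (nth d0 ds k) i.
Proof.
move=> k10 i9; rewrite /assign mulnC divnMDl // modnMDl.
rewrite divn_small ?modn_small ?addn0; try lia.
by rewrite (_ : minn i 8 = i) ?ifT //; lia.
Qed.

Lemma increasing_frame lo d0 ds al k s : k < 10 -> lo <= (nth d0 ds k).1.1 ->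
  increasing_from ((nth d0 ds k).1.1 + 9) (fun l => (assign d0 ds al l).1) s ->
  increasing_from lo (fun l => (assign d0 ds al l).1) (frame k ++ s).
Proof.
move=> k10 lok; apply: increasing_from_cat; first by lia.
  by rewrite /frame /at_slot /= !assign_block //=; move: (_.1.1) lok => r; lia.
by rewrite /frame /at_slot /= !assign_block //=; move: (_.1.1) lok => r; lia.
Qed.

Lemma increasing_frameC lo d0 ds al k t s : k < 10 -> lo <= (nth d0 ds k).1.2 ->
  (nth d0 ds k).2 = t ->
  increasing_from ((nth d0 ds k).1.2 + 9) (fun l => (assign d0 ds al l).2) s ->
  increasing_from lo (fun l => (assign d0 ds al l).2) (frameC k t ++ s).
Proof.
move=> k10 lok tk; apply: increasing_from_cat; first by lia.
  by rewrite /frameC /at_slot; case: t tk => tk /=; rewrite !assign_block //= /block_pt tk /=;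
    move: (_.1.2) lok => c; lia.
by rewrite /frameC /at_slot; case: t tk => tk /=; rewrite !assign_block //= /block_pt tk /=;
  move: (_.1.2) lok => c; lia.
Qed.

Lemma insert_sorted l k y : sorted ltn l -> 0 < k < size l -> nth 0 l k.-1 < y < nth 0 l k ->
  sorted ltn (take k l ++ y :: drop k l).
Proof.
move=> so /andP[k0 kl] /andP[h1 h2].
have sd : sorted ltn (drop k l) by apply: drop_sorted.
have st : sorted ltn (take k l) by apply: take_sorted.
have key i j : i < j < size l -> nth 0 l i < nth 0 l j.
  by move=> /andP[ij jl]; apply: (sorted_ltn_nth ltn_trans 0 so); rewrite ?inE //; apply: ltn_trans jl.
rewrite (sorted_pairwise ltn_trans) pairwise_cat -!(sorted_pairwise ltn_trans) st /=.
have hd z : z \in drop k l -> nth 0 l k <= z.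
  move/(nthP 0) => [i]; rewrite size_drop nth_drop => il <-.
  case: i il => [|i] il; first by rewrite addn0.
  by apply/ltnW/key; rewrite -ltn_subRL il andbT; lia.
have ht z : z \in take k l -> z <= nth 0 l k.-1.
  move/(nthP 0) => [i]; rewrite size_take kl => ik <-; rewrite nth_take //.
  have [->|ne] := eqVneq i k.-1; first by [].
  by apply/ltnW/key; apply/andP; split; [lia|apply: leq_ltn_trans kl; lia].
rewrite path_min_sorted ?sd ?andbT; last by apply/allP => z /hd /=; lia.
apply/allrelP => a b /ht ha; rewrite inE => /orP[/eqP ->|/hd hb] /=; lia.
Qed.

Section Avoiding.

Variables (n : nat) (s : 'S_n).
Hypothesis av : avoids_all forbidden s.

Let G := graph s.

Definition is_block (d : corner) := forall i, i < 9 -> graph s (block_pt d i).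

Lemma col_bound x y : G (x, y) -> x < n /\ y < n.
Proof. by case=> i [-> ->]; split. Qed.

Lemma row_point x : x < n -> exists y, G (x, y).
Proof. by move=> xn; exists (s (Ordinal xn)), (Ordinal xn). Qed.

Lemma col_point y : y < n -> exists x, G (x, y).
Proof. by move=> yn; exists ((s^-1)%g (Ordinal yn)), ((s^-1)%g (Ordinal yn)); rewrite permKV. Qed.

(** All values of [assign] are points of the permutation, since it caps offsets at 8 and defaults to
    the first block. So nothing has to be checked about the labels, only the two orders. *)
Lemma refute R C d0 ds al : (R, C) \in forbidden -> is_block d0 ->
  foldr (fun d P => is_block d /\ P) True ds ->
  foldr (fun p P => G p /\ P) True (unzip2 al) ->
  increasing_from 0 (fun l => (assign d0 ds al l).1) R ->
  increasing_from 0 (fun l => (assign d0 ds al l).2) C -> False.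
Proof.
move=> qF b0 bs ps /andP[_ so1] /andP[_ so2].
apply: (av qF); exists (assign d0 ds al); split=> // l _.
rewrite /assign; case: ifP => _.
  have bk : is_block (nth d0 ds (l %/ 10)).
    by elim: ds bs (l %/ 10) {so1 so2} => [|d ds IH] /= => [_ [|]|[bd bds] [|k]] //=; apply: IH.
  by apply: bk; rewrite gtn_min orbT.
elim: al ps {so1 so2} => [|[a p] al IH] /=; first by move=> _; rewrite ?nth_nil; apply: b0.
by case=> gp gal; case: (a == l) => //=; apply: IH.
Qed.

Lemma mem_insert_blank k s' l : l \in insert_blank k s' -> l <> 100 -> l \in s'.
Proof.
by rewrite mem_cat inE => /orP[/mem_take|/orP[/eqP|/mem_drop]].
Qed.

Lemma insert_blank_map (f f' : nat -> nat) k s' : {in s', f =1 f'} ->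
  map f' (insert_blank k s') = take k (map f s') ++ f' 100 :: drop k (map f s').
Proof.
move=> ff; rewrite /insert_blank map_cat /= !map_take !map_drop.
by rewrite (_ : map f' s' = map f s') //; apply/eq_in_map => x /ff.
Qed.

Lemma contains_row_blank R C v k p : occ G (R, C) v -> 100 \notin R -> 100 \notin C ->
  0 < k < size R -> G p -> (v (nth 0 R k.-1)).1 < p.1 < (v (nth 0 R k)).1 ->
  contains_pat s (insert_blank k R, C).
Proof.
case=> vG vR vC nR nC /andP[k0 kR] Gp pb.
pose w (l : nat) := if l == 100 then p else v l; exists w.
have wv (T : seq nat) : 100 \notin T -> {in T, v =1 w}.
  by move=> nS x xS; rewrite /w; case: eqP xS nS => // -> ->.
split.
- move=> l; rewrite /w; case: eqP => // l100; rewrite mem_cat => /orP[/mem_insert_blank/(_ l100) lR|lC];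
    apply: vG; by rewrite mem_cat ?lR ?lC ?orbT.
- rewrite (@insert_blank_map (fun l => (v l).1)); last by move=> x /(wv _ nR) ->.
  rewrite /w eqxx; apply: insert_sorted => //; rewrite ?size_map ?k0 //.
  by rewrite !(nth_map 0) //; lia.
- rewrite (_ : map _ _ = [seq (v l).2 | l <- C]) //.
  by apply/eq_in_map => x xC; rewrite (wv _ nC _ xC).
Qed.

Lemma contains_col_blank R C v k p : occ G (R, C) v -> 100 \notin R -> 100 \notin C ->
  0 < k < size C -> G p -> (v (nth 0 C k.-1)).2 < p.2 < (v (nth 0 C k)).2 ->
  contains_pat s (R, insert_blank k C).
Proof.
case=> vG vR vC nR nC /andP[k0 kR] Gp pb.
pose w (l : nat) := if l == 100 then p else v l; exists w.
have wv (T : seq nat) : 100 \notin T -> {in T, v =1 w}.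
  by move=> nS x xS; rewrite /w; case: eqP xS nS => // -> ->.
split.
- move=> l; rewrite /w; case: eqP => // l100; rewrite mem_cat => /orP[lC|/mem_insert_blank/(_ l100) lR];
    apply: vG; by rewrite mem_cat ?lR ?lC ?orbT.
- rewrite (_ : map _ _ = [seq (v l).1 | l <- R]) //.
  by apply/eq_in_map => x xC; rewrite (wv _ nR _ xC).
- rewrite (@insert_blank_map (fun l => (v l).2)); last by move=> x /(wv _ nC) ->.
  rewrite /w eqxx; apply: insert_sorted => //; rewrite ?size_map ?k0 //.
  by rewrite !(nth_map 0) //; lia.
Qed.

Definition signed_cols t (b : bool) := if b then swap_labels 1 2 (colword t) else colword t.

(** Every row and column of a permutation carries a point, so a line skipped inside a block would
    give an occurrence of the block with an empty line, which [interval_pats] forbids. *)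
Lemma block_consecutive t b v : occ G (block 0, blockC 0 t b) v ->
  (forall i, i < 9 -> (v i).1 = (v 0).1 + i) /\
  (forall i, i < 9 -> (v (nth 0 (signed_cols t b) i)).2 = (v 7).2 + i).
Proof.
move=> oc.
have Cdef : blockC 0 t b = signed_cols t b by case: t b {oc} => -[].
have C0 : nth 0 (signed_cols t b) 0 = 7 by case: t b {oc Cdef} => -[].
have sC : size (signed_cols t b) = 9 by case: t b {oc Cdef C0} => -[].
have inC : signed_cols t b =i iota 0 9.
  by apply/perm_mem; case: t b {oc Cdef C0 sC} => -[].
have qb : (block 0, blockC 0 t b) \in blocks by case: t b {oc Cdef C0 sC inC} => -[]; vm_compute.
have nC : 100 \notin signed_cols t b by rewrite inC.
rewrite Cdef in oc qb.
have [vG vR vC] := oc.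
have vGi i : i < 9 -> G (v i).
  by move=> i9; apply: vG; rewrite mem_cat; apply/orP; left; rewrite -[_.1]/(iota 0 9) mem_iota i9.
have nth9 i : i < 9 -> nth 0 (block 0) i = i by move=> i9; rewrite -[block 0]/(iota 0 9) nth_iota.
split.
- have step k : k < 8 -> (v k.+1).1 = (v k).1.+1.
    move=> k8; have lt : (v k).1 < (v k.+1).1.
      have := @sorted_ltn_map_nth (fun l => (v l).1) (block 0) k k.+1 vR.
      by rewrite ltnSn ltnS k8 => /(_ isT); rewrite !nth9 //; lia.
    apply/eqP; rewrite eqn_leq lt andbT leqNgt; apply/negP => gap.
    have := vGi k.+1; rewrite ltnS k8 => /(_ isT); move: (gap); case: (v k.+1) => x' y' /= gap' /col_bound[x'n _].
    have [y Gy] := @row_point (v k).1.+1 (ltn_trans gap' x'n).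
    have qF : (insert_blank k.+1 (block 0), signed_cols t b) \in forbidden.
      rewrite mem_cat; apply/orP; left; rewrite mem_cat; apply/orP; left.
      apply/allpairsP; exists ((block 0, signed_cols t b), k.+1); split=> //.
      by rewrite mem_iota.
    apply: (av qF); apply: (contains_row_blank oc _ _ _ Gy) => //.
    by rewrite !nth9 //=; lia.
  by elim=> [|i IH] i9; rewrite ?addn0 // step // IH ?addnS //; lia.
- have step k : k < 8 -> (v (nth 0 (signed_cols t b) k.+1)).2 = (v (nth 0 (signed_cols t b) k)).2.+1.
    move=> k8; have lt : (v (nth 0 (signed_cols t b) k)).2 < (v (nth 0 (signed_cols t b) k.+1)).2.
      have := @sorted_ltn_map_nth (fun l => (v l).2) (signed_cols t b) k k.+1 vC.
      by rewrite ltnSn sC ltnS k8 => /(_ isT).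
    apply/eqP; rewrite eqn_leq lt andbT leqNgt; apply/negP => gap.
    have : G (v (nth 0 (signed_cols t b) k.+1)).
      by apply: vG; rewrite mem_cat mem_nth ?orbT // sC.
    move: (gap); case: (v (nth 0 (signed_cols t b) k.+1)) => x' y' /= gap' /col_bound[_ y'n].
    have [x Gx] := @col_point (v (nth 0 (signed_cols t b) k)).2.+1 (ltn_trans gap' y'n).
    have qF : (block 0, insert_blank k.+1 (signed_cols t b)) \in forbidden.
      rewrite mem_cat; apply/orP; left; rewrite mem_cat; apply/orP; right.
      apply/allpairsP; exists ((block 0, signed_cols t b), k.+1); split=> //.
      by rewrite mem_iota.
    apply: (av qF); apply: (contains_col_blank oc _ _ _ Gx) => //; first by rewrite sC.
    by rewrite /=; lia.
  elim=> [|i IH] i9; first by rewrite addn0 C0.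
  by rewrite step // IH ?addnS //; lia.
Qed.

End Avoiding.

Lemma occ_sub P q q' v : occ P q v -> subseq q'.1 q.1 && subseq q'.2 q.2 -> occ P q' v.
Proof.
case=> vP vR vC /andP[s1 s2]; split.
- by move=> l; rewrite mem_cat => /orP[/(mem_subseq s1)|/(mem_subseq s2)] h;
    apply: vP; rewrite mem_cat h ?orbT.
- exact: (subseq_sorted ltn_trans (map_subseq _ s1)).
- exact: (subseq_sorted ltn_trans (map_subseq _ s2)).
Qed.

Lemma occ_lt1 P q v x y : occ P q v -> subseq [:: x; y] q.1 -> (v x).1 < (v y).1.
Proof.
case=> _ vR _ /(map_subseq (fun l => (v l).1))/(subseq_sorted ltn_trans)/(_ vR).
by rewrite /= andbT.
Qed.

Lemma occ_lt2 P q v x y : occ P q v -> subseq [:: x; y] q.2 -> (v x).2 < (v y).2.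
Proof.
case=> _ _ vR /(map_subseq (fun l => (v l).2))/(subseq_sorted ltn_trans)/(_ vR).
by rewrite /= andbT.
Qed.

Lemma occ_map P R C v f : occ P (map f R, map f C) v -> occ P (R, C) (v \o f).
Proof.
case=> /= vP vR vC; split=> /=.
- by move=> l lRC; apply: vP; rewrite -map_cat map_f.
- by rewrite -map_comp in vR.
- by rewrite -map_comp in vC.
Qed.

Lemma links_signedP q b : q \in links_signed b ->
  q = (block 0, blockC 0 KR b) \/ exists t t' b', (t, t') \in steps /\ q = link t t' b b'.
Proof.
rewrite inE => /orP[/eqP ->|]; first by left.
by case/allpairsP => -[[t t'] b'] /= [? _ ->]; right; exists t, t', b'.
Qed.

Lemma link_blocks t t' b b' :
  subseq (block 0) (link t t' b b').1 && subseq (blockC 0 t b) (link t t' b b').2 /\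
  subseq (block 1) (link t t' b b').1 && subseq (blockC 1 t' b') (link t t' b b').2.
Proof. by case: t; case: t'; case: b; case: b'; split; vm_compute. Qed.

Lemma block_shift t b :
  (block 1, blockC 1 t b) = (map (addn 10) (block 0), map (addn 10) (blockC 0 t b)).
Proof. by case: t; case: b. Qed.

(** * Successive blocks along the links *)

Section Steps.

Variables (n : nat) (s : 'S_n).
Hypothesis av : avoids_all forbidden s.
Let G := graph s.

Definition signed_pt (d : corner) b i : pt := (d.1.1 + i, d.1.2 + index i (signed_cols d.2 b)).

Definition is_signed d b := forall i, i < 9 -> G (signed_pt d b i).

Lemma occ_signed t b v : occ G (block 0, blockC 0 t b) v ->
  let d := ((v 0).1, (v 7).2, t) in (forall i, i < 9 -> v i = signed_pt d b i) /\ is_signed d b.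
Proof.
move=> oc d; have [h1 h2] := block_consecutive av oc.
have inC : signed_cols t b =i iota 0 9 by apply/perm_mem; case: t b {oc d h2} => -[].
have e i : i < 9 -> v i = signed_pt d b i.
  move=> i9; rewrite [v i]surjective_pairing h1 //; congr pair.
  have iC : i \in signed_cols t b by rewrite inC mem_iota.
  rewrite -{1}[i](nth_index 0 iC) h2 //.
  have <- : size (signed_cols t b) = 9 by case: t b {oc d h2 inC iC} => -[].
  by rewrite index_mem.
split=> // i i9; rewrite -e //; case: oc => vG _ _; apply: vG.
by rewrite mem_cat; apply/orP; left; rewrite -[_.1]/(iota 0 9) mem_iota.
Qed.

Lemma signed_occ d b : is_signed d b -> occ G (block 0, blockC 0 d.2 b) (signed_pt d b).
Proof.
move=> sd; split.
- move=> l h; apply: sd; move: h; rewrite mem_cat => /orP[h|h].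
    by have : l \in iota 0 9 by []; rewrite mem_iota.
  have : l \in iota 0 9; last by rewrite mem_iota.
  by rewrite -(@perm_mem _ (blockC 0 d.2 b)) //; case: (d.2) b {h} => -[].
- by rewrite /signed_pt /=; lia.
- by case: d sd => -[r c] t _; case: t b => -[]; rewrite /signed_pt /=; lia.
Qed.

Lemma signed_inj r c c' t t' b b' : is_signed (r, c, t) b -> is_signed (r, c', t') b' ->
  [/\ c = c', t = t' & b = b'].
Proof.
move=> h h'.
have e i (i9 : i < 9) : c + index i (signed_cols t b) = c' + index i (signed_cols t' b').
  by apply: graph_inj1 (h i i9) (h' i i9).
have := e 7 isT; have := e 1 isT; have := e 2 isT; have := e 4 isT; have := e 6 isT; have := e 8 isT.
by case: t b {h e} => -[]; case: t' b' {h'} => -[] /=; rewrite ?addn0; intros; split=> //; lia.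
Qed.

Hypothesis nu : forall r, ~ unlinked blocks links s r.

(** A link exists at the row of point 1 and is not a forbidden one, so its first block is not
    toggled. That block has the same top row as [d], hence equals it by [signed_inj]. *)
Lemma block_linked d b : is_signed d b -> b = false /\
  (d.2 <> KR -> exists t' b' w, [/\ (d.2, t') \in steps, occ G (link d.2 t' false b') w &
     forall i, i < 9 -> w i = block_pt d i]).
Proof.
move=> sd; case: (asbP (occ_at links s (d.1.1 + 1))) => [|nl]; last first.
  case: (nu (r := d.1.1 + 1)); split=> //.
  exists (block 0, blockC 0 d.2 b), (signed_pt d b); split=> //; last exact: signed_occ.
  by case: (d.2) b {sd nl} => -[]; vm_compute.
case=> q [w [ql oc w1]].
have {}ql : q \in links_signed false.
  by case: (links_split ql) => [h|/links_forbidden/av[]]; [exact: h|exists w; exact: oc].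
have own t1 : occ G (block 0, blockC 0 t1 false) w ->
    [/\ b = false, d.2 = t1 & forall i, i < 9 -> w i = block_pt d i].
  case/occ_signed => e sd1; case: d sd w1 => -[r c] t sd w1.
  have er : (w 0).1 = r by move: (f_equal fst (e 1 isT)) w1; rewrite /= => -> /=; lia.
  rewrite er in sd1 e.
  have [ec et eb] := signed_inj sd sd1.
  by subst c t b; split.
case: (links_signedP ql) => [eq|[t [t' [b' [tt eq]]]]]; rewrite {}eq in oc.
  by have [-> ->] := own _ oc.
have oc0 : occ G (block 0, blockC 0 t false) w.
  by apply: (occ_sub oc); have [] := link_blocks t t' false b'.
have [-> et e] := own _ oc0; split=> // _.
by exists t', b', w; rewrite et.
Qed.

(** The geometry of one link, with [b] the image of 105, [p] and [p'] of 102 and 103, [a] of 101,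
    [u] of 100 and [z] of 106. *)
Definition linked_step (d d' : corner) :=
  [/\ (d.2, d'.2) \in steps, is_block s d' & d.1.2 + 9 <= d'.1.2] /\
  [/\ exists b, [/\ G b, d'.1.1 + 9 <= b.1 & b.2 < d.1.2],
    match d.2 with
    | KL => exists p, [/\ G p, d.1.1 + 9 <= p.1 < d'.1.1 & d'.1.2 + 9 <= p.2]
    | KX => exists a p, [/\ G a, G p, d.1.1 + 9 <= a.1 < p.1 /\ p.1 < d'.1.1 &
        a.2 < d.1.2 /\ d'.1.2 + 9 <= p.2]
    | _ => exists p a p', [/\ [/\ G p, G a & G p'], d.1.1 + 9 <= p.1 < a.1 /\ a.1 < p'.1 < d'.1.1 &
        a.2 < d.1.2 /\ d'.1.2 + 9 <= p.2 < p'.2]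
    end,
    ~~ is_L d.2 -> exists u, [/\ G u, u.1 < d.1.1, d.1.2 + 9 <= u.2 < d'.1.2 &
      ~~ is_R d'.2 -> exists z, [/\ G z, d'.1.1 + 9 <= z.1 & u.2 < z.2 < d'.1.2]] &
    is_L d.2 -> exists z, [/\ G z, d'.1.1 + 9 <= z.1 & d.1.2 + 9 <= z.2 < d'.1.2]].

Lemma exists_step d : is_block s d -> d.2 <> KR -> exists d', linked_step d d'.
Proof.
case: d => -[r c] t bd nR; have [_ /(_ nR)[t' [b' [w [tt oc e]]]]] := @block_linked (r, c, t) false bd.
have {}oc : occ G (link t t' false b') w := oc.
have {}tt : (t, t') \in steps := tt.
have {}e : forall i, i < 9 -> w i = block_pt (r, c, t) i := e.
have oc1 : occ G (block 1, blockC 1 t' b') w.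
  by apply: (occ_sub oc); have [] := link_blocks t t' false b'.
rewrite block_shift in oc1; have [e' sd'] := occ_signed (occ_map oc1). rewrite /comp in e' sd'.
have [b'0 _] := block_linked sd'; subst b'.
move: e' sd'; set r' := (w _).1; set c' := (w _).2 => e' sd'.
exists (r', c', t').
have wG l : l \in (link t t' false false).1 -> G (w l).
  by move=> h; case: oc => vG _ _; apply: vG; rewrite mem_cat h.
have w0 : (w 0).1 = r by rewrite e // /block_pt addn0.
have w8 : (w 8).1 = r + 8 by rewrite e.
have w7 : (w 7).2 = c by rewrite e // /block_pt; case: (t) => /=; rewrite addn0.
have w18 : (w 18).1 = r' + 8 by rewrite (e' 8).
have lastE k : index (last 0 (colword k)) (colword k) = 8 by case: k.
have last9 k : last 0 (colword k) < 9 by case: k.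
have wl : (w (last 0 (colword t))).2 = c + 8 by rewrite e // /block_pt lastE.
have wl' : (w (10 + last 0 (colword t'))).2 = c' + 8 by rewrite e' // /signed_pt lastE.
have w10 : (w 10).1 = r' by [].
have w17 : (w 17).2 = c' by [].
move: (r') (c') w10 w17 w18 wl' sd' => {e e' oc1 lastE last9}.
rewrite /linked_step.
(* Only the six pairs of [steps] survive; the inequalities below are read off the row and column
   words of each link. *)
move: bd nR tt wG oc w0 w8 w7 wl; case: t; case: t' => bd nR tt wG oc w0 w8 w7 wl r1 c1 w10 w17 w18 wl' bd';
  try by [].
all: rewrite /= in wl wl'.
- have := @occ_lt1 _ _ _ 8 102 oc isT.
  have := @occ_lt1 _ _ _ 102 10 oc isT.
  have := @occ_lt1 _ _ _ 18 105 oc isT.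
  have := @occ_lt1 _ _ _ 105 106 oc isT.
  have := @occ_lt2 _ _ _ 105 7 oc isT.
  have := @occ_lt2 _ _ _ 6 106 oc isT.
  have := @occ_lt2 _ _ _ 106 17 oc isT.
  have := @occ_lt2 _ _ _ (10 + 4) 102 oc isT.
  move=> *; clear oc; split; first by split=> //; simpl; lia.
  split=> //.
  + by exists (w 105); split; [exact: wG|simpl; lia|simpl; lia].
  + by exists (w 102); split; [exact: wG|simpl; lia|simpl; lia].
  + by move=> _; exists (w 106); split; [exact: wG|simpl; lia|simpl; lia].
- have := @occ_lt1 _ _ _ 8 101 oc isT.
  have := @occ_lt1 _ _ _ 101 102 oc isT.
  have := @occ_lt1 _ _ _ 102 10 oc isT.
  have := @occ_lt1 _ _ _ 18 105 oc isT.
  have := @occ_lt1 _ _ _ 105 106 oc isT.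
  have := @occ_lt1 _ _ _ 100 0 oc isT.
  have := @occ_lt2 _ _ _ 105 7 oc isT.
  have := @occ_lt2 _ _ _ 101 7 oc isT.
  have := @occ_lt2 _ _ _ 4 100 oc isT.
  have := @occ_lt2 _ _ _ 100 106 oc isT.
  have := @occ_lt2 _ _ _ 106 17 oc isT.
  have := @occ_lt2 _ _ _ (10 + 4) 102 oc isT.
  move=> *; clear oc; split; first by split=> //; simpl; lia.
  split=> //.
  + by exists (w 105); split; [exact: wG|simpl; lia|simpl; lia].
  + by exists (w 101), (w 102); split; [exact: wG|exact: wG|simpl; lia|simpl; lia].
  + move=> _; exists (w 100); split; [exact: wG|simpl; lia|simpl; lia|].
    by move=> _; exists (w 106); split; [exact: wG|simpl; lia|simpl; lia].
- have := @occ_lt1 _ _ _ 8 101 oc isT.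
  have := @occ_lt1 _ _ _ 101 102 oc isT.
  have := @occ_lt1 _ _ _ 102 10 oc isT.
  have := @occ_lt1 _ _ _ 18 105 oc isT.
  have := @occ_lt1 _ _ _ 105 106 oc isT.
  have := @occ_lt1 _ _ _ 100 0 oc isT.
  have := @occ_lt2 _ _ _ 105 7 oc isT.
  have := @occ_lt2 _ _ _ 101 7 oc isT.
  have := @occ_lt2 _ _ _ 4 100 oc isT.
  have := @occ_lt2 _ _ _ 100 106 oc isT.
  have := @occ_lt2 _ _ _ 106 17 oc isT.
  have := @occ_lt2 _ _ _ (10 + 4) 102 oc isT.
  move=> *; clear oc; split; first by split=> //; simpl; lia.
  split=> //.
  + by exists (w 105); split; [exact: wG|simpl; lia|simpl; lia].
  + by exists (w 101), (w 102); split; [exact: wG|exact: wG|simpl; lia|simpl; lia].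
  + move=> _; exists (w 100); split; [exact: wG|simpl; lia|simpl; lia|].
    by move=> _; exists (w 106); split; [exact: wG|simpl; lia|simpl; lia].
- have := @occ_lt1 _ _ _ 8 102 oc isT.
  have := @occ_lt1 _ _ _ 102 101 oc isT.
  have := @occ_lt1 _ _ _ 101 103 oc isT.
  have := @occ_lt1 _ _ _ 103 10 oc isT.
  have := @occ_lt1 _ _ _ 18 105 oc isT.
  have := @occ_lt1 _ _ _ 105 106 oc isT.
  have := @occ_lt1 _ _ _ 100 0 oc isT.
  have := @occ_lt2 _ _ _ 105 7 oc isT.
  have := @occ_lt2 _ _ _ 101 7 oc isT.
  have := @occ_lt2 _ _ _ 4 100 oc isT.
  have := @occ_lt2 _ _ _ 100 106 oc isT.
  have := @occ_lt2 _ _ _ 106 17 oc isT.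
  have := @occ_lt2 _ _ _ (10 + 4) 102 oc isT.
  have := @occ_lt2 _ _ _ 102 103 oc isT.
  move=> *; clear oc; split; first by split=> //; simpl; lia.
  split=> //.
  + by exists (w 105); split; [exact: wG|simpl; lia|simpl; lia].
  + by exists (w 102), (w 101), (w 103); split; [split; exact: wG|simpl; lia|simpl; lia].
  + move=> _; exists (w 100); split; [exact: wG|simpl; lia|simpl; lia|].
    by move=> _; exists (w 106); split; [exact: wG|simpl; lia|simpl; lia].
- have := @occ_lt1 _ _ _ 8 102 oc isT.
  have := @occ_lt1 _ _ _ 102 101 oc isT.
  have := @occ_lt1 _ _ _ 101 103 oc isT.
  have := @occ_lt1 _ _ _ 103 10 oc isT.
  have := @occ_lt1 _ _ _ 18 105 oc isT.
  have := @occ_lt1 _ _ _ 105 106 oc isT.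
  have := @occ_lt1 _ _ _ 100 0 oc isT.
  have := @occ_lt2 _ _ _ 105 7 oc isT.
  have := @occ_lt2 _ _ _ 101 7 oc isT.
  have := @occ_lt2 _ _ _ 4 100 oc isT.
  have := @occ_lt2 _ _ _ 100 106 oc isT.
  have := @occ_lt2 _ _ _ 106 17 oc isT.
  have := @occ_lt2 _ _ _ (10 + 4) 102 oc isT.
  have := @occ_lt2 _ _ _ 102 103 oc isT.
  move=> *; clear oc; split; first by split=> //; simpl; lia.
  split=> //.
  + by exists (w 105); split; [exact: wG|simpl; lia|simpl; lia].
  + by exists (w 102), (w 101), (w 103); split; [split; exact: wG|simpl; lia|simpl; lia].
  + move=> _; exists (w 100); split; [exact: wG|simpl; lia|simpl; lia|].
    by move=> _; exists (w 106); split; [exact: wG|simpl; lia|simpl; lia].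
- have := @occ_lt1 _ _ _ 8 102 oc isT.
  have := @occ_lt1 _ _ _ 102 101 oc isT.
  have := @occ_lt1 _ _ _ 101 103 oc isT.
  have := @occ_lt1 _ _ _ 103 10 oc isT.
  have := @occ_lt1 _ _ _ 18 105 oc isT.
  have := @occ_lt1 _ _ _ 100 0 oc isT.
  have := @occ_lt2 _ _ _ 105 7 oc isT.
  have := @occ_lt2 _ _ _ 101 7 oc isT.
  have := @occ_lt2 _ _ _ 4 100 oc isT.
  have := @occ_lt2 _ _ _ 100 17 oc isT.
  have := @occ_lt2 _ _ _ (10 + 6) 102 oc isT.
  have := @occ_lt2 _ _ _ 102 103 oc isT.
  move=> *; clear oc; split; first by split=> //; simpl; lia.
  split=> //.
  + by exists (w 105); split; [exact: wG|simpl; lia|simpl; lia].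
  + by exists (w 102), (w 101), (w 103); split; [split; exact: wG|simpl; lia|simpl; lia].
  + move=> _; exists (w 100); split; [exact: wG|simpl; lia|simpl; lia|].
    by [].
Qed.

End Steps.

(** * The points of a chain *)

Lemma sorted_ltn_map_sub (a b : nat -> nat) s :
  {in s &, forall x y, a x < a y -> b x < b y} -> sorted ltn (map a s) -> sorted ltn (map b s).
Proof.
move=> h; rewrite !sorted_map; apply: (sub_in_sorted (P := mem s)); last exact/allP.
by move=> x y xs ys /= /h; apply.
Qed.

(** * Standardization of a finite set of points to a permutation *)

Section SortedPoints.

Variable l : seq pt.
Hypothesis sorted_rows : sorted ltn [seq p.1 | p <- l].
Hypothesis uniq_cols : uniq [seq p.2 | p <- l].

Let col_rank y := count (fun z => z < y) [seq p.2 | p <- l].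

Let col_rank_mono y y' : y <= y' -> col_rank y <= col_rank y'.
Proof. by move=> yy; apply: sub_count => z /=; lia. Qed.

Let col_rank_lt y y' : y \in [seq p.2 | p <- l] -> y < y' -> col_rank y < col_rank y'.
Proof.
move=> yl yy; rewrite /col_rank; have [s1 [s2 e]] : exists s1 s2, [seq p.2 | p <- l] = s1 ++ y :: s2.
  by case/splitPr: yl => s1 s2; exists s1, s2.
rewrite e !count_cat /= ltnn yy add0n add1n addnS ltnS.
by apply: leq_add; apply: sub_count => z /=; lia.
Qed.

Let col_rank_size y : y \in [seq p.2 | p <- l] -> col_rank y < size l.
Proof.
move=> yl; rewrite -(size_map snd) /col_rank.
have [s1 [s2 e]] : exists s1 s2, [seq p.2 | p <- l] = s1 ++ y :: s2.
  by case/splitPr: yl => s1 s2; exists s1, s2.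
rewrite e count_cat size_cat /= ltnn addnS ltnS add0n.
by apply: leq_add; apply: count_size.
Qed.

Let point (i : 'I_(size l)) : pt := nth (0, 0) l i.

Let point_in i : point i \in l. Proof. exact: mem_nth. Qed.

Let rank_fun i : 'I_(size l) := Ordinal (col_rank_size (map_f snd (point_in i))).

Let rank_fun_inj : injective rank_fun.
Proof.
move=> i j /(f_equal (@nat_of_ord _)) /= e.
have e2 : (point i).2 = (point j).2.
  have [h|h|//] := ltngtP (point i).2 (point j).2.
    by have := col_rank_lt (map_f snd (point_in i)) h; rewrite e ltnn.
  by have := col_rank_lt (map_f snd (point_in j)) h; rewrite e ltnn.
apply/ord_inj/eqP; rewrite -(nth_uniq 0 _ _ uniq_cols) ?size_map //.
by rewrite !(nth_map (0, 0)) //; apply/eqP.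
Qed.

Definition points_perm : 'S_(size l) := perm rank_fun_inj.

Definition to_graph (p : pt) : pt := (index p l, col_rank p.2).
Definition of_graph (p : pt) : pt := nth (0, 0) l p.1.

Let uniq_l : uniq l.
Proof. exact: map_uniq uniq_cols. Qed.

Lemma to_graphP p : p \in l -> graph points_perm (to_graph p).
Proof.
move=> pl; have il : index p l < size l by rewrite index_mem.
by exists (Ordinal il); rewrite permE; congr pair; rewrite /= /point /= nth_index.
Qed.

Lemma of_graphP p : graph points_perm p -> of_graph p \in l /\ to_graph (of_graph p) = p.
Proof.
case=> i ->; split; first by rewrite /of_graph mem_nth /=.
by rewrite /to_graph /of_graph /= index_uniq // permE.
Qed.

Let row_index p q : p \in l -> q \in l -> (index p l < index q l) = (p.1 < q.1).
Proof.
move=> pl ql.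
have key p' q' : p' \in l -> q' \in l -> index p' l < index q' l -> p'.1 < q'.1.
  move=> pl' ql' h; rewrite -{1}(nth_index (0, 0) pl') -{1}(nth_index (0, 0) ql').
  rewrite -!(nth_map (0, 0) 0) ?index_mem //.
  by apply: (sorted_ltn_nth ltn_trans 0 sorted_rows); rewrite ?inE ?size_map ?index_mem.
apply/idP/idP => [|h]; first exact: key.
have [//|h'|e] := ltngtP (index p l) (index q l).
  by have := key _ _ ql pl h'; lia.
by move: h; rewrite -(nth_index (0, 0) pl) -(nth_index (0, 0) ql) e ltnn.
Qed.

Let col_rankE p q : p \in l -> q \in l -> (col_rank p.2 < col_rank q.2) = (p.2 < q.2).
Proof.
move=> pl ql; apply/idP/idP => [h|]; last by apply: col_rank_lt; apply: map_f.
by rewrite ltnNge; apply/negP => /col_rank_mono; lia.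
Qed.

Lemma occ_to_graph q v : occ (fun p => p \in l) q v -> occ (graph points_perm) q (to_graph \o v).
Proof.
case=> vl vR vC; split.
- by move=> x /vl; apply: to_graphP.
- apply: sorted_ltn_map_sub vR => x y xq yq /=.
  by rewrite row_index //; apply: vl; rewrite mem_cat ?xq ?yq.
- apply: sorted_ltn_map_sub vC => x y xq yq /=.
  by rewrite col_rankE //; apply: vl; rewrite mem_cat ?xq ?yq orbT.
Qed.

Lemma occ_of_graph q v : occ (graph points_perm) q v -> occ (fun p => p \in l) q (of_graph \o v).
Proof.
case=> vg vR vC.
have of1 x : x \in q.1 ++ q.2 -> [/\ of_graph (v x) \in l, (v x).1 = index (of_graph (v x)) l
    & (v x).2 = col_rank (of_graph (v x)).2].
  move=> /vg/of_graphP[xl ex]; split=> //; [exact: esym (f_equal fst ex)|exact: esym (f_equal snd ex)].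
split.
- by move=> x /of1[].
- apply: sorted_ltn_map_sub vR => x y xq yq /=.
  have [|xl -> _] := of1 x; first by rewrite mem_cat xq.
  have [|yl -> _] := of1 y; first by rewrite mem_cat yq.
  by rewrite row_index.
- apply: sorted_ltn_map_sub vC => x y xq yq /=.
  have [|xl _ ->] := of1 x; first by rewrite mem_cat xq orbT.
  have [|yl _ ->] := of1 y; first by rewrite mem_cat yq orbT.
  by rewrite col_rankE.
Qed.

End SortedPoints.

(** * The model of a chain and the frames in it *)

Fixpoint masks n : seq (seq bool) :=
  if n is m.+1 then [seq b :: s | b <- [:: false; true], s <- masks m] else [:: [::]].

Lemma mem_masks m : m \in masks (size m).
Proof.
elim: m => // b m IH; apply: (@allpairs_f _ _ _ cons [:: false; true]) => //.
by case: b.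
Qed.

Definition frame_labels := [:: 0; 1; 3; 4; 5; 6; 7; 8].

Definition interval_mask (m : seq bool) (s : seq nat) :=
  let A l := nth false m (index l frame_labels) in
  all (fun l => all (fun a => all (fun a' =>
    [&& ~~ A l, A a & A a'] ==> ((index l s < index a s) == (index l s < index a' s))) s) s) s.

(* Frames are simple permutations. *)
Lemma frame_simple t : all (fun m => [&& interval_mask m frame_labels,
  interval_mask m (frameC 0 t) & 1 < count id m] ==> all id m) (masks 8).
Proof. by case: t; vm_compute. Qed.

(* An embedding of the 8 points of a frame in the 9 rows of a block shifts the [k]-th row by 0 or 1,
   according to the mask. *)
Lemma frame_in_block t t' : all (fun m =>
  sorted ltn [seq nth 0 (iota 0 8) k + nth false m k | k <- iota 0 8] &&
  sorted ltn [seq index (index l frame_labels + nth false m (index l frame_labels)) (colword t')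
             | l <- frameC 0 t] ==>
  (t == t') && all (fun l => (l == 1) || (index l frame_labels + nth false m (index l frame_labels) == l))
                 frame_labels) (masks 8).
Proof. by case: t; case: t'; vm_compute. Qed.

Section Structure.

Variable t : nat.
Hypothesis t_gt0 : 0 < t.

Let N := (round_start t).+1.
(** The blocks before position [N] push the links numbered 1 to [J] by the positions that pop them;
    those from [N] on are never popped and lie to the right of the last block. *)
Let J := round_start t.+1 + 1.

Definition kind_at i := if i == N then KR else word i.

(* Rows and columns are spaced by blocks of 20, which leaves room for the points between two blocks. *)
Definition block_at i k : pt := (20 * i + k, 20 * i.+1 + index k (colword (kind_at i))).
(** In the gap after a block, row offsets 10, 11, 12 are reserved for the first link, a low point
    and the last link, column offsets 10 and 12 for a link and a low point. The low point [j] is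
    below block [j.+1] and left of block [j], which ties the two. *)
Definition low_at j : pt := (20 * j.+1 + 11, 20 * j + 12).
Definition link_at j : pt := (20 * origin j + (if is_first j then 10 else 12), 20 * j.+1 + 10).

Definition points : seq pt :=
  [seq block_at i k | i <- iota 0 N.+1, k <- iota 0 9] ++
  [seq low_at j | j <- iota 0 N] ++ [seq link_at j | j <- iota 1 J].

Lemma pointsP p : p \in points ->
  [\/ exists i k, [/\ i <= N, k < 9 & p = block_at i k], exists2 j, j < N & p = low_at j
    | exists2 j, 0 < j <= J & p = link_at j].
Proof.
rewrite /points mem_cat => /orP[|].
  case/allpairsP => -[i k] []; rewrite !mem_iota => h1 h2 ->; constructor 1; exists i, k.
  by move: h1 h2; rewrite !add0n !leq0n.
rewrite mem_cat => /orP[] /mapP[j]; rewrite mem_iota => h ->; [constructor 2|constructor 3]; exists j => //; lia.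
Qed.

Lemma block_in i k : i <= N -> k < 9 -> block_at i k \in points.
Proof.
move=> iN k9; rewrite mem_cat; apply/orP; left; apply/allpairsP; exists (i, k); rewrite !mem_iota /=.
by split=> //; lia.
Qed.

Lemma low_in j : j < N -> low_at j \in points.
Proof.
by move=> jN; rewrite mem_cat; apply/orP; right; rewrite mem_cat map_f // mem_iota.
Qed.

Lemma link_in j : 0 < j <= J -> link_at j \in points.
Proof.
by move=> jN; rewrite mem_cat; apply/orP; right; rewrite mem_cat orbC map_f // mem_iota; lia.
Qed.

Lemma index_colword u k : k < 9 -> index k (colword u) < 9.
Proof.
move=> k9; have k_in : k \in colword u.
  by rewrite (@perm_mem _ _ (iota 0 9)) ?mem_iota //; case: u.
by rewrite -index_mem in k_in; move: k_in; rewrite (_ : size _ = 9) //; case: u.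
Qed.

Lemma index_colword_inj u k k' : k < 9 -> index k (colword u) = index k' (colword u) -> k = k'.
Proof.
move=> k9 e; have k_in : k \in colword u.
  by rewrite (@perm_mem _ _ (iota 0 9)) ?mem_iota //; case: (u).
have k'_in : k' \in colword u by rewrite -index_mem -e index_mem.
by rewrite -(nth_index 0 k_in) e nth_index.
Qed.

Lemma origin_le j : 0 < j <= J -> origin j < N.
Proof. by move=> h; rewrite ltnS; apply: origin_bound. Qed.

(** Nine points for each of the [N.+1] blocks, [N] low points and [J] links, where [J] is
    [round_start t + t + 1]. *)
Lemma size_points : size points = 11 * round_start t + t + 20.
Proof.
have := round_startS t_gt0; rewrite /points /J /N size_cat.
have -> : size [seq block_at i k | i <- iota 0 (round_start t).+2, k <- iota 0 9] = (round_start t).+2 * 9.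
  by rewrite size_allpairs !size_iota.
by rewrite size_cat !size_map !size_iota; lia.
Qed.

Lemma row_inj p q : p \in points -> q \in points -> p.1 = q.1 -> p = q.
Proof.
case/pointsP => [[i [k [_ k9 ->]]]|[j _ ->]|[j jJ ->]];
case/pointsP => [[i' [k' [_ k9' ->]]]|[j' _ ->]|[j' jJ' ->]] /= e.
- by have [-> ->] : i = i' /\ k = k' by lia.
- by lia.
- by move: e; case: ifP; lia.
- by lia.
- by have -> : j = j' by lia.
- by move: e; case: ifP; lia.
- by move: e; case: ifP; lia.
- by move: e; case: ifP; lia.
- by have -> : j = j' by apply: link_key_inj => //; lia.
Qed.

Lemma col_inj p q : p \in points -> q \in points -> p.2 = q.2 -> p = q.
Proof.
case/pointsP => [[i [k [_ k9 ->]]]|[j _ ->]|[j jJ ->]];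
case/pointsP => [[i' [k' [_ k9' ->]]]|[j' _ ->]|[j' jJ' ->]] /= e.
- have h := index_colword (kind_at i) k9; have h' := index_colword (kind_at i') k9'.
  have ii : i = i' by lia.
  rewrite ii in e *; have e' : index k (colword (kind_at i')) = index k' (colword (kind_at i')) by lia.
  by rewrite (index_colword_inj k9 e').
- by have h := index_colword (kind_at i) k9; lia.
- by have h := index_colword (kind_at i) k9; lia.
- by have h := index_colword (kind_at i') k9'; lia.
- by have -> : j = j' by lia.
- by lia.
- by have h := index_colword (kind_at i') k9'; lia.
- by lia.
- by have -> : j = j' by lia.
Qed.

Definition in_block i (p : pt) := 20 * i <= p.1 < 20 * i + 9.

Lemma in_blockP i p : p \in points -> in_block i p -> i <= N /\ exists2 k, k < 9 & p = block_at i k.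
Proof.
rewrite /in_block; case/pointsP => [[i' [k [iN k9 ->]]]|[j _ ->]|[j jJ ->]] /=.
- move=> h; have -> : i = i' by lia.
  by split=> //; exists k.
- by lia.
- by case: ifP; lia.
Qed.

Lemma in_block_col i p : p \in points -> in_block i p -> 20 * i.+1 <= p.2 < 20 * i.+1 + 9.
Proof.
by move=> pp /(in_blockP pp)[_ [k k9 ->]]; have := index_colword (kind_at i) k9; rewrite /=; lia.
Qed.

Lemma not_in_block_col i p : p \in points -> ~~ in_block i p ->
  (p.1 < 20 * i) || (20 * i + 9 <= p.1) /\ (p.2 < 20 * i.+1) || (20 * i.+1 + 9 <= p.2).
Proof.
rewrite /in_block; case/pointsP => [[i' [k [iN k9 ->]]]|[j _ ->]|[j jJ ->]] /=.
- by have := index_colword (kind_at i') k9; split; lia.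
- by split; lia.
- by case: ifP; split; lia.
Qed.

(* A decreasing sequence of length 4, as in a frame, has two points in the same block. *)
Lemma chain4 a b c d : a \in points -> b \in points -> c \in points -> d \in points ->
  a.1 < b.1 < c.1 -> c.1 < d.1 -> d.2 < c.2 < b.2 -> b.2 < a.2 ->
  exists i, 1 < in_block i a + in_block i b + in_block i c + in_block i d.
Proof.
have low2 i j : (low_at i).1 < (low_at j).1 -> (low_at j).2 < (low_at i).2 -> False.
  by rewrite /=; lia.
have link2 i j : 0 < i <= J -> 0 < j <= J ->
    (link_at i).1 < (link_at j).1 -> (link_at j).2 < (link_at i).2 -> False.
  move=> /= /andP[i0 _] /andP[j0 _] h1 h2; have ji : j < i by lia.
  by have := @link_key_lt j i; rewrite j0 ji => /(_ isT); lia.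
have block2 i k i' k' : k < 9 -> k' < 9 -> (block_at i k).1 < (block_at i' k').1 ->
    (block_at i' k').2 < (block_at i k).2 -> in_block i (block_at i k) && in_block i (block_at i' k').
  move=> k9 k9' /= h1 h2.
  have := index_colword (kind_at i) k9; have := index_colword (kind_at i') k9'.
  by rewrite /in_block /=; lia.
move=> pa pb pc pd /andP[ab bc] cd /andP[dc cb] ba.
pose B p := exists i k, [/\ i <= N, k < 9 & p = block_at i k].
pose E p := exists2 j, j < N & p = low_at j.
pose K p := exists2 j, 0 < j <= J & p = link_at j.
have BB p q : B p -> B q -> p.1 < q.1 -> q.2 < p.2 -> exists2 i, in_block i p & in_block i q.
  by case=> i [k [_ k9 ->]] [i' [k' [_ k9' ->]]] h1 h2; exists i;
    have /andP[] := block2 _ _ _ _ k9 k9' h1 h2.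
have EE p q : E p -> E q -> p.1 < q.1 -> q.2 < p.2 -> False.
  by case=> i _ -> [j _ ->]; apply: low2.
have KK p q : K p -> K q -> p.1 < q.1 -> q.2 < p.2 -> False.
  by case=> i iJ -> [j jJ ->]; apply: link2.
have cl p : p \in points -> [\/ B p, E p | K p] := @pointsP p.
have two (x y z w : bool) : [|| x && y, x && z, x && w, y && z, y && w | z && w] ->
    1 < x + y + z + w by case: x; case: y; case: z; case: w.
have ac : a.1 < c.1 by lia.
have ca : c.2 < a.2 by lia.
have ad : a.1 < d.1 by lia.
have da : d.2 < a.2 by lia.
have bd : b.1 < d.1 by lia.
have db : d.2 < b.2 by lia.
suff [i h] : exists i, [|| in_block i a && in_block i b, in_block i a && in_block i c,
    in_block i a && in_block i d, in_block i b && in_block i c, in_block i b && in_block i d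
    | in_block i c && in_block i d] by exists i; apply: two.
clear two block2 low2 link2.
case: (cl a pa) => xa; case: (cl b pb) => xb;
  try solve [by case: (EE _ _ xa xb ab ba) | by case: (KK _ _ xa xb ab ba)
            | by have [i e1 e2] := BB _ _ xa xb ab ba; exists i; rewrite e1 e2 /= ?orbT];
  case: (cl c pc) => xc;
  try solve [by case: (EE _ _ xa xc ac ca) | by case: (KK _ _ xa xc ac ca)
            | by case: (EE _ _ xb xc bc cb) | by case: (KK _ _ xb xc bc cb)
            | by have [i e1 e2] := BB _ _ xa xc ac ca; exists i; rewrite e1 e2 /= ?andbT /= ?orbT
            | by have [i e1 e2] := BB _ _ xb xc bc cb; exists i; rewrite e1 e2 /= ?andbT /= ?orbT];
  case: (cl d pd) => xd;
  try solve [by case: (EE _ _ xa xd ad da) | by case: (KK _ _ xa xd ad da)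
            | by case: (EE _ _ xb xd bd db) | by case: (KK _ _ xb xd bd db)
            | by case: (EE _ _ xc xd cd dc) | by case: (KK _ _ xc xd cd dc)
            | by have [i e1 e2] := BB _ _ xa xd ad da; exists i; rewrite e1 e2 /= ?andbT /= ?orbT
            | by have [i e1 e2] := BB _ _ xb xd bd db; exists i; rewrite e1 e2 /= ?andbT /= ?orbT
            | by have [i e1 e2] := BB _ _ xc xd cd dc; exists i; rewrite e1 e2 /= ?andbT /= ?orbT].
Qed.

Lemma mask_nth_frame (A : nat -> bool) l : l \in frame_labels ->
  nth false [seq A l | l <- frame_labels] (index l frame_labels) = A l.
Proof. by move=> lf; rewrite (nth_map 0) ?index_mem // nth_index. Qed.

Lemma frame_interval s (f : nat -> nat) (A : nat -> bool) : sorted ltn (map f s) ->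
  {subset s <= frame_labels} ->
  {in s & &, forall l a a', ~~ A l -> A a -> A a' -> (f l < f a) = (f l < f a')} ->
  interval_mask [seq A l | l <- frame_labels] s.
Proof.
move=> so sub h; apply/allP => l ls; apply/allP => a as_; apply/allP => a' a's.
rewrite !mask_nth_frame ?sub //; apply/implyP => /and3P[nl aa aa']; apply/eqP.
have key x y : x \in s -> y \in s -> (index x s < index y s) = (f x < f y).
  move=> xs ys; apply/idP/idP => [h'|].
    by have := @sorted_ltn_map_nth f s (index x s) (index y s) so; rewrite h' index_mem ys !nth_index // => ->.
  have [//|h'|e] := ltngtP (index x s) (index y s).
    have := @sorted_ltn_map_nth f s (index y s) (index x s) so.
    by rewrite h' index_mem xs !nth_index // => /(_ isT); lia.
  by rewrite -{1}(nth_index 0 xs) e nth_index // ltnn.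
by rewrite !key //; apply: h.
Qed.

(** The decreasing run of the frame puts two of its points into one model block. The block is an
    interval, so the labels landing in it form an interval of the frame; as frames are simple, all
    labels do. The finite check [frame_in_block] then identifies the kind and every label but 1,
    which may also land on 2. *)
Lemma frame_located u v : occ (fun p => p \in points) (frame 0, frameC 0 u) v ->
  exists i, [/\ i <= N, kind_at i = u, {in frame_labels, forall l, l <> 1 -> v l = block_at i l} &
    v 1 = block_at i 1 \/ v 1 = block_at i 2].
Proof.
move=> oc; have [vP vR vC] := oc.
have fE : frame 0 = frame_labels by [].
have Cs l : l \in frameC 0 u = (l \in frame_labels) by apply/perm_mem; case: (u).
have {}vP l : l \in frame_labels -> v l \in points by move=> lf; apply: vP; rewrite mem_cat fE lf.
have {}vR : sorted ltn [seq (v l).1 | l <- frame_labels] by [].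
have {}vC : sorted ltn [seq (v l).2 | l <- frameC 0 u] by [].
have r1 x y : subseq [:: x; y] frame_labels -> (v x).1 < (v y).1.
  by move=> h; apply: (occ_lt1 oc).
have [i i2] : exists i, 1 < in_block i (v 0) + in_block i (v 3) + in_block i (v 5) + in_block i (v 7).
  apply: chain4; rewrite ?vP ?r1 //.
    by rewrite !(occ_lt2 oc) //; case: (u).
  by rewrite (occ_lt2 oc) //; case: (u).
have iP := @not_in_block_col i; have iC := @in_block_col i.
pose A l := in_block i (v l).
pose m := [seq A l | l <- frame_labels].
have allA : all id m.
  have /allP/(_ m (mem_masks m))/implyP := frame_simple u; apply; apply/and3P; split.
  - apply: (frame_interval vR) => // l a a' lf af a'f nl aa aa'.
    have [h _] := iP _ (vP _ lf) nl; rewrite /A /in_block in aa aa' *.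
    by case: (v l) (v a) (v a') h aa aa' => [x1 y1] [x2 y2] [x3 y3] /= h aa aa'; apply/idP/idP; lia.
  - apply: (frame_interval vC) => [l|l a a']; rewrite !Cs // => lf af a'f nl aa aa'.
    have [_ h] := iP _ (vP _ lf) nl; have h1 := iC _ (vP _ af) aa; have h2 := iC _ (vP _ a'f) aa'.
    by case: (v l) (v a) (v a') h h1 h2 {nl aa aa'} => [x1 y1] [x2 y2] [x3 y3] /= h h1 h2; apply/idP/idP; lia.
  - by rewrite /= /A; move: i2; do 8!case: (in_block i _).
have {}allA l : l \in frame_labels -> in_block i (v l).
  by move=> lf; move/allP: allA => /(_ (A l)); apply; apply: (map_f A lf).
have iN : i <= N by have [] := in_blockP (vP 0 isT) (allA 0 isT).
pose x l := (v l).1 - 20 * i.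
have vE l : l \in frame_labels -> x l < 9 /\ v l = block_at i (x l).
  move=> lf; have [_ [k k9 e]] := in_blockP (vP l lf) (allA l lf).
  by rewrite /x e /= addKn.
have x01 y z : subseq [:: y; z] frame_labels -> y \in frame_labels -> z \in frame_labels -> x y < x z.
  move=> yz yf zf; have := r1 y z yz; have [_ ->] := vE y yf; have [_ ->] := vE z zf.
  by rewrite /= ltn_add2l.
pose b k := x (nth 0 frame_labels k) - k.
have xb : [seq x l | l <- frame_labels] = [seq nth 0 (iota 0 8) k + nth false [seq 0 < b k | k <- iota 0 8] k | k <- iota 0 8].
  have := (x01 0 1 isT isT isT, x01 1 3 isT isT isT, x01 3 4 isT isT isT, x01 4 5 isT isT isT,
           x01 5 6 isT isT isT, x01 6 7 isT isT isT, x01 7 8 isT isT isT).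
  have := (vE 8 isT).1; rewrite /b /= => h [[[[[[h0 h1] h2] h3] h4] h5] h6].
  by congr [:: _; _; _; _; _; _; _; _]; lia.
set m' := [seq 0 < b k | k <- iota 0 8] in xb.
have xE l : l \in frame_labels -> x l = index l frame_labels + nth false m' (index l frame_labels).
  move=> lf; have il : index l frame_labels < 8 by rewrite index_mem.
  have := f_equal (fun s => nth 0 s (index l frame_labels)) xb.
  by rewrite (nth_map 0) // nth_index // => ->; rewrite (nth_map 0) ?size_iota // !nth_iota.
have /allP/(_ m' (mem_masks m'))/implyP := frame_in_block u (kind_at i).
case/(_ _)/andP.
  apply/andP; split.
    by rewrite -xb; apply: sorted_ltn_map_sub vR => l l' lf lf'; rewrite (vE l lf).2 (vE l' lf').2 /= ltn_add2l.
  have h : {in frameC 0 u &, forall l l', (v l).2 < (v l').2 ->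
     index (x l) (colword (kind_at i)) < index (x l') (colword (kind_at i))}.
    by move=> l l'; rewrite !Cs => lf lf'; rewrite (vE l lf).2 (vE l' lf').2 /= ltn_add2l.
  have := sorted_ltn_map_sub h vC; rewrite (_ : map _ _ = map (fun l => index (index l frame_labels + nth false m' (index l frame_labels)) (colword (kind_at i))) (frameC 0 u)) //.
  by apply/eq_in_map => l; rewrite Cs => lf; rewrite -xE.
move=> /eqP uk /allP mE; exists i; split=> //.
  move=> l lf l1; rewrite {1}(vE l lf).2; congr block_at; rewrite xE //.
  by have /orP[/eqP //|/eqP] := mE l lf.
by rewrite (vE 1 isT).2 xE //=; case: (0 < _); [right|left].
Qed.

End Structure.

(** * The model avoids the forbidden patterns *)

Lemma word_neq_R i : word i <> KR.
Proof. by rewrite /word; case: ifP => // _; case: ifP. Qed.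

Lemma word_L i : word i = KL -> i = 0.
Proof. by rewrite /word; case: eqP => // _; case: ifP. Qed.

Definition top k := 10 * k.
Definition bottom k := 10 * k + 8.
Definition leftmost k := 10 * k + 7.
Definition rightmost k u := 10 * k + last 0 (colword u).

Arguments kind_at : simpl never.

Section Avoidance.

Variable t : nat.
Hypothesis t_gt0 : 0 < t.

Let N := (round_start t).+1.
Local Notation points := (points t).
Local Notation kind_at := (kind_at t).
Local Notation block_at := (block_at t).
Let P (p : pt) : Prop := p \in points.

Lemma block_located u b v : occ P (block 0, blockC 0 u b) v ->
  b = false /\ exists i, [/\ i <= N, kind_at i = u & forall k, k < 9 -> v k = block_at i k].
Proof.
move=> oc.
have oc1 : occ P (frame 0, frameC 0 u) v by apply: (occ_sub oc); case: u b {oc} => -[].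
(* Reading point 2 in place of point 1 gives a second frame; together the two frames pin down both
   points of the pair. *)
pose f l := if l == 1 then 2 else l.
have oc2 : occ P (frame 0, frameC 0 u) (v \o f).
  apply: occ_map; apply: (occ_sub oc); case: u b {oc oc1} => -[] //.
have [i [iN ki vi v1]] := frame_located t_gt0 oc1.
have [i' [iN' ki' vi' v2]] := frame_located t_gt0 oc2.
have n01 : 0 <> 1 by [].
have ii : i' = i.
  have := vi' 0 isT n01; rewrite /= (vi 0 isT n01) => /(f_equal fst) /=; lia.
rewrite ii /= in vi' v2; have r12 := occ_lt1 oc (x := 1) (y := 2) isT.
have [e1 e2] : v 1 = block_at i 1 /\ v 2 = block_at i 2.
  by case: v1 v2 r12 => -> [] ->; split=> //; move: r12 => /=; lia.
split.
  case: b oc => // oc.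
  have := occ_lt2 oc (x := 2) (y := 1); rewrite e1 e2 /=  ki.
  by case: (u) => /(_ isT); rewrite /=; lia.
exists i; split=> // k k9; have [->//|k1] := eqVneq k 1; have [->//|k2] := eqVneq k 2.
by apply: vi; [move: k k9 k1 k2; do 9!case=> // | apply/eqP].
Qed.

(** These four labels are extremal in the frame and different from 1, so their lines are known
    exactly, which is enough to compare other points with the block. *)
Definition slot (v : nat -> pt) k u i := [/\ i <= N, kind_at i = u,
  (v (top k)).1 = 20 * i /\ (v (bottom k)).1 = 20 * i + 8
  & (v (leftmost k)).2 = 20 * i.+1 /\ (v (rightmost k u)).2 = 20 * i.+1 + 8].

Lemma slot_located q v k u : occ P q v ->
  subseq (frame k) q.1 && subseq (frameC k u) q.2 -> exists i, slot v k u i.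
Proof.
move=> oc sub; have oc' : occ P (frame 0, frameC 0 u) (v \o addn (10 * k)).
  by apply: occ_map; apply: (occ_sub oc); rewrite /= /frameC /at_slot -map_comp; exact: sub.
have [i [iN ki vi _]] := frame_located t_gt0 oc'.
have ne k' : k' <> 1 -> k' \in frame_labels -> v (10 * k + k') = block_at i k' by move=> h1 h2; apply: vi.
exists i; split=> //.
  by rewrite /top /bottom -{1}[10 * k]addn0 !ne //= addn0.
by rewrite /leftmost /rightmost !ne /= ?ki; case: (u); rewrite /= ?addn0.
Qed.

Lemma kind_word i u : i < N -> kind_at i = u -> word i = u.
Proof. by move=> iN <-; rewrite /kind_at ltn_eqF. Qed.

Variant point_spec (p : pt) : Prop :=
  | BlockPoint i of 20 * i <= p.1 <= 20 * i + 8 & 20 * i.+1 <= p.2 <= 20 * i.+1 + 8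
  | LowPoint j of j < N & p.1 = 20 * j.+1 + 11 & p.2 = 20 * j + 12
  | FirstLink j of 0 < j & is_first j & p.1 = 20 * origin j + 10 & p.2 = 20 * j.+1 + 10
  | LastLink j of 0 < j & is_first j = false & p.1 = 20 * origin j + 12 & p.2 = 20 * j.+1 + 10.

Lemma point_specP (p : pt) : P p -> point_spec p.
Proof.
case/pointsP => [[i [k [_ k9 ->]]]|[j jN ->]|[j /andP[j0 _] ->]].
- by apply: (@BlockPoint _ i); have := index_colword (kind_at i) k9; rewrite /=; lia.
- exact: (@LowPoint _ j).
- by case E : (is_first j); [apply: (@FirstLink _ j)|apply: (@LastLink _ j)]; rewrite //= E.
Qed.

(** Blocks lie along the diagonal and links above it, so only a low point can be below a block and
    to the left of an earlier one. *)
Lemma low_point (p : pt) i k : P p -> i < k -> 20 * k + 8 < p.1 -> p.2 < 20 * i.+1 ->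
  [/\ k = i.+1, p.1 = 20 * i.+1 + 11 & p.2 = 20 * i + 12].
Proof.
case/point_specP => [i' ? ?|j _ -> ->|j j0 _ -> ->|j j0 _ -> ->] ik h1 h2; try by lia.
- have e : j = i by lia.
  by rewrite e; split=> //; lia.
- by have := origin_lt j0; lia.
- by have := origin_lt j0; lia.
Qed.

Lemma row_gap_point (p : pt) i : P p -> 20 * i + 8 < p.1 -> p.1 < 20 * i.+1 ->
  [\/ p.1 = 20 * i + 10 /\ (word i = KL \/ word i = KH), p.1 = 20 * i + 11 /\ 0 < i
    | p.1 = 20 * i + 12 /\ (word i = KH \/ word i = KX)].
Proof.
case/point_specP => [i' ? ?|j _ -> _|j j0 fj -> _|j j0 fj -> _] h1 h2; try by lia.
- by constructor 2; lia.
- have e : origin j = i by lia.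
  by constructor 1; rewrite -e; split=> //; apply: origin_first.
- have e : origin j = i by lia.
  by constructor 3; rewrite -e; split=> //; apply: origin_last; rewrite fj.
Qed.

Lemma col_gap_point (p : pt) i : P p -> 20 * i.+1 + 8 < p.2 -> p.2 < 20 * i.+2 ->
  p.2 = 20 * i.+1 + 10 /\ 0 < i \/ p.2 = 20 * i.+1 + 12 /\ i.+1 < N.
Proof.
by case/point_specP => *; lia.
Qed.

Lemma right_point (p : pt) k : P p -> p.1 < 20 * k -> 20 * k.+1 + 8 < p.2 ->
  exists j, [/\ 0 < j, p.2 = 20 * j.+1 + 10 & p.1 = 20 * origin j + (if is_first j then 10 else 12)].
Proof.
case/point_specP => [i' ? ?|j jN -> ->|j j0 fj -> ->|j j0 fj -> ->] h1 h2; try by lia.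
- by exists j; rewrite fj.
- by exists j; rewrite fj.
Qed.

Lemma avoids_interval q v : q \in interval_pats -> ~ occ P q v.
Proof.
have bl u b (R C : seq nat) : occ P (R, C) v -> subseq (block 0) R && subseq (blockC 0 u b) C ->
    b = false /\ exists2 i, kind_at i = u & forall k, k < 9 -> v k = block_at i k.
  by move=> oc sub; have [-> [i [_ ki vi]]] := block_located (occ_sub (q' := (_, _)) oc sub); split=> //; exists i.
rewrite mem_cat => /orP[] /allpairsP[[q' k] /= [q'B kR ->]] oc; have k8 : 0 < k < 9 by have := kR : k \in iota 1 8; rewrite mem_iota.
  have [u [b eq]] : exists u b, q' = (block 0, blockC 0 u b).
    by case/flatten_mapP: q'B => u _ /mapP[b _ ->]; exists u, b.
  rewrite eq /= in oc; have [|_ [i _ vi]] := bl u b _ _ oc.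
    have /allP/(_ k kR)/= -> : all (fun k => subseq (block 0) (insert_blank k (block 0))) (iota 1 8) by vm_compute.
    exact: subseq_refl.
  have h1 : (v k.-1).1 < (v 100).1.
    by apply: (occ_lt1 oc); move: k k8 {oc vi kR}; do 9!case=> //.
  have h2 : (v 100).1 < (v k).1.
    by apply: (occ_lt1 oc); move: k k8 {oc vi h1 kR}; do 9!case=> //.
  by move: h1 h2; rewrite (vi k) ?(vi k.-1) /=; lia.
have [u [b eq]] : exists u b, q' = (block 0, blockC 0 u b).
  by case/flatten_mapP: q'B => u _ /mapP[b _ ->]; exists u, b.
rewrite eq /= in oc; have [|bF [i ki vi]] := bl u b _ _ oc.
  rewrite subseq_refl /=.
  have /allP/(_ k kR)/= -> // : all (fun k => subseq (blockC 0 u b) (insert_blank k (blockC 0 u b))) (iota 1 8).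
  by case: u b {eq oc} => -[]; vm_compute.
rewrite bF in oc; clear eq bF b bl.
set C := colword u; have in9 m : m < 9 -> nth 0 C m < 9.
  by rewrite /C; case: (u); do 9!case: m => [|m] //.
have cm m : m < 9 -> (v (nth 0 C m)).2 = 20 * i.+1 + m.
  move=> m9; rewrite vi ?in9 //= ki -/C; congr (_ + _); apply: index_uniq; rewrite /C; by case: (u).
have h1 : (v (nth 0 C k.-1)).2 < (v 100).2.
  by apply: (occ_lt2 oc); rewrite /C; move: k k8 {kR oc}; case: (u); do 9!case=> //.
have h2 : (v 100).2 < (v (nth 0 C k)).2.
  by apply: (occ_lt2 oc); rewrite /C; move: k k8 {oc h1 kR}; case: (u); do 9!case=> //.
by move: h1 h2; rewrite !cm /=; lia.
Qed.

Lemma avoids_links q v : q \in links_signed true -> ~ occ P q v.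
Proof.
case/links_signedP => [->|[u [u' [b' [_ ->]]]]] oc; first by case: (block_located oc).
by have [/(occ_sub (q' := (_, _)) oc)/block_located[]] := link_blocks u u' true b'.
Qed.

End Avoidance.

Section Avoidance.

Variable t : nat.
Hypothesis t_gt0 : 0 < t.

Let N := (round_start t).+1.
Local Notation points := (points t).
Local Notation kind_at := (kind_at t).
Let P (p : pt) : Prop := p \in points.

Let occ_in q v l : occ P q v -> l \in q.1 ++ q.2 -> P (v l).
Proof. by case=> h _ _ /h. Qed.

Lemma kind_at_L i : kind_at i = KL -> i = 0.
Proof. by rewrite /kind_at; case: eqP => // _ /word_L. Qed.

Lemma kind_at_R i : i <= N -> kind_at i = KR -> i = N.
Proof. by rewrite /kind_at; case: eqP => // _ _ /word_neq_R. Qed.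

(** The label [e] is a tie: [low_point] sends it to a low point, which makes the two slots
    consecutive. *)
Lemma adjacent_slots q v k k' u u' e : occ P q v -> e \in q.1 ->
  subseq (frame k) q.1 && subseq (frameC k u) q.2 -> subseq (frame k') q.1 && subseq (frameC k' u') q.2 ->
  subseq [:: bottom k; top k'] q.1 && subseq [:: bottom k'; e] q.1 && subseq [:: e; leftmost k] q.2 ->
  exists i, [/\ i < N, word i = u, slot t v k u i & slot t v k' u' i.+1].
Proof.
move=> oc eq1 s1 s2 /andP[/andP[o1 o2] o3].
have [i sl] := slot_located t_gt0 oc s1; have [i' sl'] := slot_located t_gt0 oc s2.
have [iN ki [_ b0] [l0 _]] := sl; have [iN' ki' [t1 b1] _] := sl'.
have h1 := occ_lt1 oc o1; have h2 := occ_lt1 oc o2; have h3 := occ_lt2 oc o3.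
have pe : P (v e) by apply: (occ_in oc); rewrite mem_cat eq1.
have [|||ii _ _] := @low_point t t_gt0 (v e) i i' pe; try by lia.
have {}iN : i < N by rewrite /N; lia.
by exists i; rewrite -ii; split=> //; apply: (kind_word iN).
Qed.

(** After an X-block the offset 10, reserved for a first link, is vacant. *)
Definition first_gap_row u := if u is KX then 11 else 10.

Lemma row_gap_offset q v k k' u u' b i : occ P q v -> i < N -> word i = u ->
  slot t v k u i -> slot t v k' u' i.+1 -> b \in q.1 ->
  subseq [:: bottom k; b] q.1 && subseq [:: b; top k'] q.1 ->
  20 * i + first_gap_row u <= (v b).1 < 20 * i + first_gap_row u + row_gap_len u.
Proof.
move=> oc iN wi [_ _ [_ b0] _] [_ _ [t1 _] _] bq /andP[o1 o2].
have h1 := occ_lt1 oc o1; have h2 := occ_lt1 oc o2.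
have pb : P (v b) by apply: (occ_in oc); rewrite mem_cat bq.
have := @row_gap_point t t_gt0 (v b) i pb; rewrite wi => -[||[-> [] ->]|[-> i0]|[-> [] ->]] /=; try by lia.
by move: wi; rewrite word_first //; case: ifP => _ <- /=; lia.
Qed.

Lemma col_gap_offset q v k k' u u' b i : occ P q v -> i < N -> word i = u ->
  slot t v k u i -> slot t v k' u' i.+1 -> b \in q.2 ->
  subseq [:: rightmost k u; b] q.2 && subseq [:: b; leftmost k'] q.2 ->
  (v b).2 = 20 * i.+1 + 10 /\ ~~ is_L u \/ (v b).2 = 20 * i.+1 + 12 /\ ~~ is_R u'.
Proof.
move=> oc iN wi [_ _ _ [_ r0]] [_ ki' _ [l1 _]] bq /andP[o1 o2].
have h1 := occ_lt2 oc o1; have h2 := occ_lt2 oc o2.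
have pb : P (v b) by apply: (occ_in oc); rewrite mem_cat bq orbT.
have [||[-> i0]|[-> iN']] := @col_gap_point t t_gt0 (v b) i pb; try by lia.
  by left; split=> //; rewrite -wi word_first //; case: ifP.
right; split=> //; rewrite -ki'; apply/negP => h; have := @kind_at_R i.+1.
by move: h; case: (kind_at _) => // _ /(_ _ erefl) e; move: iN'; rewrite e ?ltnn.
Qed.

Lemma steps_ind (Q : kind -> kind -> Prop) : Q KL KH -> Q KX KX -> Q KX KH -> Q KH KX -> Q KH KH -> Q KH KR ->
  forall u u', (u, u') \in steps -> Q u u'.
Proof. by move=> q1 q2 q3 q4 q5 q6 [] []. Qed.

Lemma avoids_gaps q v : q \in gap_pats -> ~ occ P q v.
Proof.
rewrite mem_cat => /orP[] /mapP[[u u'] /= us ->] oc.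
{ have [||||i [iN wi sl sl']] := @adjacent_slots _ _ 0 1 u u' 105 oc.
  1-4: by move: u u' us {oc}; apply: steps_ind.
  move: u u' us oc wi sl sl'; apply: steps_ind => oc wi sl sl'.
  all: have h b := @row_gap_offset _ _ 0 1 _ _ b i oc iN wi sl sl'.
  all: have h0 := h 110 isT isT; have h1 := h 111 isT isT; rewrite /= in h0 h1.
  all: have o1 := occ_lt1 oc (x := 110) (y := 111) isT; try by lia.
  all: have h2 := h 112 isT isT; have o2 := occ_lt1 oc (x := 111) (y := 112) isT; rewrite /= in h2; try by lia.
  all: have h3 := h 113 isT isT; have o3 := occ_lt1 oc (x := 112) (y := 113) isT; rewrite /= in h3; by lia. }
{ have [||||i [iN wi sl sl']] := @adjacent_slots _ _ 0 1 u u' 105 oc.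
  1-4: by move: u u' us {oc}; apply: steps_ind.
  move: u u' us oc wi sl sl'; apply: steps_ind => oc wi sl sl'.
  all: have h b := @col_gap_offset _ _ 0 1 _ _ b i oc iN wi sl sl'.
  all: have h0 := h 110 isT isT; have h1 := h 111 isT isT; rewrite /= in h0 h1.
  all: have o1 := occ_lt2 oc (x := 110) (y := 111) isT; try by lia.
  all: have h2 := h 112 isT isT; have o2 := occ_lt2 oc (x := 111) (y := 112) isT; rewrite /= in h2; by lia. }
Qed.

Lemma avoids_corners q v : q \in [:: above_L; left_L; below_R; start_pat] -> ~ occ P q v.
Proof.
rewrite in_cons => /orP[/eqP -> oc|].
  have [//|i [iN ki [t0 _] _]] := @slot_located t t_gt0 _ v 0 KL oc.
  have h := occ_lt1 oc (x := 100) (y := top 0) isT.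
  by rewrite t0 (kind_at_L ki) in h.
rewrite in_cons => /orP[/eqP -> oc|].
  have [//|i [iN ki _ [l0 _]]] := @slot_located t t_gt0 _ v 0 KL oc.
  have h := occ_lt2 oc (x := 100) (y := 101) isT; have h' := occ_lt2 oc (x := 101) (y := leftmost 0) isT.
  have col p : P p -> p.2 < 20 -> p.2 = 12.
    by case/(point_specP t_gt0) => *; lia.
  rewrite (kind_at_L ki) in l0.
  by have := col _ (occ_in oc (l := 100) isT); have := col _ (occ_in oc (l := 101) isT); lia.
rewrite in_cons => /orP[/eqP -> oc|].
  have [//|i [iN ki [_ b0] _]] := @slot_located t t_gt0 _ v 0 KR oc.
  have h := occ_lt1 oc (x := 100) (y := 101) isT; have h' := occ_lt1 oc (x := bottom 0) (y := 100) isT.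
  rewrite (kind_at_R iN ki) in b0.
  have row p : P p -> 20 * N + 8 < p.1 -> p.1 = 20 * N + 11.
    by case/(pointsP) => [[j [k [jN k9 ->]]]|[j jN ->]|[j jJ ->]] /=;
    [|move=> ?|have := origin_le t_gt0 jJ; case: ifP]; lia.
  by have := row _ (occ_in oc (l := 100) isT); have := row _ (occ_in oc (l := 101) isT); lia.
rewrite inE => /eqP -> oc.
have [i [_ _ [_ ki _ _] [_ ki' [e _] _]]] := @adjacent_slots _ _ 0 1 KL KH 105 oc isT isT isT isT.
have [i' [_ _ [_ ki1 [e' _] _] [_ ki2 _ _]]] := @adjacent_slots _ _ 1 2 KH KX 106 oc isT isT isT isT.
have i0 := kind_at_L ki; have ii : i' = 1 by lia.
by move: ki2; rewrite ii /kind_at; case: eqP.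
Qed.

Lemma avoids_triples u u' u'' v : ~ occ P (triple_pat u u' u'') v.
Proof.
move=> oc.
have [|||i [_ _ [_ _ [_ b0] _] [_ _ [t2 _] _]]] := @adjacent_slots _ _ 0 2 u u'' 105 oc isT.
1-3: by case: u {oc}; case: u'; case: u''.
have [|i' [_ _ [t1 b1] _]] := @slot_located t t_gt0 _ v 1 u' oc.
  by case: u {oc}; case: u'; case: u''.
have h := occ_lt1 oc (x := bottom 0) (y := top 1) isT; have h' := occ_lt1 oc (x := bottom 1) (y := top 2) isT.
by lia.
Qed.

(** Both 100 and 101 land on links by [right_point], and [link_key_lt] makes rows and columns of
    links increase together. *)
Lemma avoids_fifo u u' v : ~ occ P (fifo_pat u u') v.
Proof.
move=> oc.
have [|i [iN _ [t0 b0] [_ r0]]] := @slot_located t t_gt0 _ v 0 u oc.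
  by case: u {oc}; case: u'.
have [|i' [iN' _ [t1 b1] [l1 r1]]] := @slot_located t t_gt0 _ v 1 u' oc.
  by case: u {oc r0}; case: u'.
have h0 := occ_lt1 oc (x := 100) (y := top 0) isT; have h1 := occ_lt1 oc (x := bottom 0) (y := 101) isT.
have h2 := occ_lt1 oc (x := 101) (y := top 1) isT.
have h3 : (v (rightmost 1 u')).2 < (v 101).2.
  by apply: (occ_lt2 oc); case: u {oc r0}; case: u' {r1}.
have h4 : (v 101).2 < (v 100).2.
  by apply: (occ_lt2 oc); case: u {oc r0}; case: u' {r1 h3}.
have pv l : l \in [:: 100; 101] -> P (v l).
  move=> lv; apply: (occ_in oc); move: lv; rewrite !inE => /orP[] /eqP->; by case: u {oc r0}; case: u' {r1 h3}.
have [||j [j0 cj rj]] := @right_point t t_gt0 (v 100) i' (pv 100 isT); try by lia.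
have [||j' [j0' cj' rj']] := @right_point t t_gt0 (v 101) i' (pv 101 isT); try by lia.
by have := @link_key_lt j' j; lia.
Qed.

(** Deleting the blanks turns every mismatch pattern into this one, so the link and its row offset
    are located once for all three families. *)
Lemma mismatch_located u u' w w' v : occ P (mismatch_pat 0 0 (u, u') (w, w')) v -> w = KX \/ w = KH ->
  exists i, [/\ (v (bottom 0)).1 = 20 * i + 8, (v (top 1)).1 = 20 * i.+1 &
    if w == KH then (v 100).1 = 20 * i + 10 /\ u <> KX else (v 100).1 = 20 * i + 12].
Proof.
move=> oc wXH.
have [||||i [iN wi [_ _ [_ b0] [l0 _]] [_ _ [t1 b1] _]]] := @adjacent_slots _ _ 0 1 u u' 105 oc.
1-4: by case: u {oc}; case: u'; case: w {wXH}; case: w'.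
have [||||k [kN wk [_ _ [t2 b2] [_ r2]] [_ _ _ [l3 _]]]] := @adjacent_slots _ _ 2 3 w w' 106 oc.
1-4: by case: u {oc wi}; case: u'; case: w {wXH}; case: w'.
have o1 : (v (bottom 0)).1 < (v 100).1.
  by apply: (occ_lt1 oc); case: u {oc wi}; case: u'; case: w {wXH wk r2}; case: w'.
have o2 : (v 100).1 < (v (top 1)).1.
  by apply: (occ_lt1 oc); case: u {oc wi}; case: u'; case: w {wXH wk r2}; case: w'.
have o3 : (v (rightmost 2 w)).2 < (v 100).2.
  by apply: (occ_lt2 oc); case: u {oc wi}; case: u'; case: w {wXH wk r2}; case: w'.
have o4 : (v 100).2 < (v (leftmost 3)).2.
  by apply: (occ_lt2 oc); case: u {oc wi}; case: u'; case: w {wXH wk r2 o3}; case: w'.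
have o5 : (v (bottom 1)).1 < (v (top 2)).1.
  by apply: (occ_lt1 oc); case: u {oc wi}; case: u'; case: w {wXH wk r2 o3}; case: w'.
have pv : P (v 100).
  by apply: (occ_in oc); case: u {oc wi}; case: u'; case: w {wXH wk r2 o3}; case: w'.
exists i; split=> //.
have [||j [j0 cj]] := @right_point t t_gt0 (v 100) i.+1 pv; try by lia.
have jk : j = k by lia.
move: j0; rewrite {j}jk in cj * => k0.
have {}wk : is_first k = (w == KH) by case: wXH wk => ->; rewrite word_first //; case: ifP.
rewrite wk; case: eqP => wH rk; last by lia.
split; first by lia.
have ok : origin k = i by lia.
by have := origin_first k0; rewrite wk wH ok wi => /(_ isT)[] ->.
Qed.

Lemma avoids_mismatch q v : q \in mismatch_pats -> ~ occ P q v.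
Proof.
have gap b i : P (v b) -> (v (bottom 0)).1 = 20 * i + 8 -> (v (top 1)).1 = 20 * i.+1 ->
    (v (bottom 0)).1 < (v b).1 -> (v b).1 < (v (top 1)).1 -> 20 * i + 10 <= (v b).1 <= 20 * i + 12.
  by move=> pb b0 t1 h1 h2; have [||[]|[]|[]] := @row_gap_point t t_gt0 (v b) i pb; lia.
rewrite mem_cat => /orP[/allpairsP[[[u u'] [w w']] /= [uF wF ->]] oc|].
  have [|i [_ _]] := mismatch_located oc; first by right; case: w wF {oc}.
  by case: w wF {oc} => // _ [_]; case: u uF.
rewrite mem_cat => /orP[] /allpairsP[[[u u'] [w w']] /= [uF wF ->]] oc.
- have [||i [b0 t1]] := @mismatch_located u u' w w' v.
  + by apply: (occ_sub oc); case: u uF {oc} => //; case: u' => // _; case: w wF => //; case: w'.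
  + by left; case: w wF {oc}.
  have -> : (w == KH) = false by case: w wF {oc}.
  move=> r; have o1 := occ_lt1 oc (x := 100) (y := 120) isT; have o2 := occ_lt1 oc (x := 120) (y := top 1) isT.
  by have := gap 120 i (occ_in oc (l := 120) isT); lia.
- have [||i [b0 t1]] := @mismatch_located u u' w w' v.
  + by apply: (occ_sub oc); case: u uF {oc} => //; case: u' => // _; case: w wF => //; case: w'.
  + by right; case: w wF {oc}.
  have -> : (w == KH) by case: w wF {oc}.
  move=> [r _]; have o1 := occ_lt1 oc (x := 110) (y := 100) isT; have o2 := occ_lt1 oc (x := bottom 0) (y := 110) isT.
  have o3 := occ_lt1 oc (x := 110) (y := top 1) isT.
  by have := gap 110 i (occ_in oc (l := 110) isT); lia.
Qed.

Lemma points_avoid q v : q \in forbidden -> ~ occ P q v.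
Proof.
rewrite mem_cat => /orP[/(avoids_interval t_gt0)|]; first exact.
rewrite mem_cat => /orP[/(avoids_links t_gt0)|]; first exact.
rewrite mem_cat => /orP[/avoids_gaps|]; first exact.
rewrite mem_cat => /orP[/avoids_corners|]; first exact.
rewrite mem_cat => /orP[/flatten_mapP[u'' _ /allpairsP[[u u'] [_ _ ->]]]|]; first exact: avoids_triples.
rewrite mem_cat => /orP[/allpairsP[[u u'] [_ _ ->]]|]; first exact: avoids_fifo.
exact: avoids_mismatch.
Qed.

End Avoidance.

(** * Rigidity of the chains *)

Lemma increasing_from_nil lo f : increasing_from lo f [::].
Proof. by []. Qed.

Lemma increasing_frame_end lo d0 ds al k : k < 10 -> lo <= (nth d0 ds k).1.1 ->
  increasing_from lo (fun l => (assign d0 ds al l).1) (frame k).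
Proof. by move=> k10 lok; rewrite -[frame k]cats0; apply: increasing_frame. Qed.

Lemma increasing_frameC_end lo d0 ds al k t : k < 10 -> lo <= (nth d0 ds k).1.2 ->
  (nth d0 ds k).2 = t -> increasing_from lo (fun l => (assign d0 ds al l).2) (frameC k t).
Proof. by move=> k10 lok tk; rewrite -[frameC k t]cats0; apply: increasing_frameC. Qed.

Arguments frame : simpl never.
Arguments frameC : simpl never.
Arguments assign : simpl never.
Arguments block_pt : simpl never.

Ltac arith := rewrite /assign /block_pt /=; lia.

Ltac inc :=
  repeat lazymatch goal with
  | |- is_true (increasing_from _ _ [::]) => apply: increasing_from_nil
  | |- is_true (increasing_from _ _ (blanks _ ++ _)) => cbn [blanks iota cat]
  | |- is_true (increasing_from _ _ (iota _ _ ++ _)) => cbn [iota cat]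
  | |- is_true (increasing_from _ _ ((_ :: _) ++ _)) => cbn [cat]
  | |- is_true (increasing_from _ _ (frame _ ++ _)) =>
      apply: increasing_frame; [by [] | by arith | ]
  | |- is_true (increasing_from _ _ (frameC _ _ ++ _)) =>
      apply: increasing_frameC; [by [] | by arith | by [] | ]
  | |- is_true (increasing_from _ _ (frame _)) => apply: increasing_frame_end; [by [] | by arith]
  | |- is_true (increasing_from _ _ (frameC _ _)) =>
      apply: increasing_frameC_end; [by [] | by arith | by []]
  | |- is_true (increasing_from _ _ (_ :: _)) => apply: increasing_from_cons; [by arith | ]
  end.

(** * Constraints imposed by the forbidden patterns *)

Section Refutations.

Variables (n : nat) (s : 'S_n).
Hypothesis av : avoids_all forbidden s.
Let G := graph s.

Definition col_of x := if insub x is Some i then nat_of_ord (s (i : 'I_n)) else 0.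

Lemma graphE x y : G (x, y) <-> x < n /\ y = col_of x.
Proof.
rewrite /col_of; split=> [[i [-> ->]]|[xn ->]]; first by rewrite valK.
by case: insubP => [i _ <-|]; [exists i|rewrite xn].
Qed.

Lemma row_col_of x : x < n -> G (x, col_of x).
Proof. by move=> xn; apply/graphE. Qed.

Lemma col_of_inj x y : x < n -> y < n -> col_of x = col_of y -> x = y.
Proof.
by move=> xn yn e; apply: (@graph_inj2 _ s _ _ (col_of x)); rewrite -/G graphE.
Qed.

Definition before (d d' : corner) := d.1.1 + 9 <= d'.1.1 /\ d.1.2 + 9 <= d'.1.2.

(** Each row of the gap carries a point, so one row too many fills all blanks of [row_gap_pat], with
    [b] as the label 105. The points of the link give the opposite inequality in [exists_next]. *)
Lemma row_gap_bound d d' b : (d.2, d'.2) \in steps -> is_block s d -> is_block s d' ->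
  before d d' -> G b -> d'.1.1 + 9 <= b.1 -> b.2 < d.1.2 ->
  d'.1.1 <= d.1.1 + 9 + row_gap_len d.2.
Proof.
move: d d' => [[r c] t] [[r' c'] t'] /= st bd bd' [/= lt1 lt2] Gb b1 b2.
rewrite leqNgt; apply/negP => gap.
have [qF _] := gap_pats_forbidden st.
have dn : r' < n by have /col_bound[] := bd' 0 isT; rewrite addn0.
have row x : x < r' -> G (x, col_of x) by move=> h; apply: row_col_of; apply: ltn_trans dn.
pose pt i := (r + 9 + i, col_of (r + 9 + i)).
apply: (refute av (ds := [:: (r, c, t); (r', c', t')])
  (al := (105, b) :: [seq (110 + i, pt i) | i <- iota 0 (row_gap_len t).+1]) qF bd).
- by [].
- by destruct t; split=> //; do ?[split; first by apply: row; rewrite /= in gap *; lia].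
- by destruct t; rewrite /= in gap; cbn [row_gap_len]; inc.
- by destruct t; rewrite /= in gap; cbn [row_gap_len]; inc.
Qed.

Lemma col_gap_bound d d' b : (d.2, d'.2) \in steps -> is_block s d -> is_block s d' ->
  before d d' -> G b -> d'.1.1 + 9 <= b.1 -> b.2 < d.1.2 ->
  d'.1.2 <= d.1.2 + 9 + col_gap_len d.2 d'.2.
Proof.
move: d d' => [[r c] t] [[r' c'] t'] /= st bd bd' [/= lt1 lt2] Gb b1 b2.
rewrite leqNgt; apply/negP => gap.
have [_ qF] := gap_pats_forbidden st.
have dn : c' < n by have /col_bound[_] := bd' 7 isT; rewrite /block_pt /=; apply: leq_ltn_trans; lia.
have [x xP] : exists x, forall y, y < c' -> G (x y, y).
  suff h y : exists x, y < c' -> G (x, y) by exists (fun y => projT1 (constructive_indefinite_description _ (h y))) => y; case: constructive_indefinite_description.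
  have [yc|_] := boolP (y < c'); last by exists 0.
  by have [x Gx] := @col_point _ s y (ltn_trans yc dn); exists x.
have [m em m12] : exists2 m, col_gap_len t t' = m & m = 1 \/ m = 2.
  by eexists; first reflexivity; rewrite /col_gap_len; case: ifP; [left|right].
rewrite em in gap; pose pt i := (x (c + 9 + i), c + 9 + i).
apply: (refute av (ds := [:: (r, c, t); (r', c', t')])
  (al := (105, b) :: [seq (110 + i, pt i) | i <- iota 0 m.+1]) qF bd).
- by [].
- by move: gap; case: m12 => -> gap; split=> //; do ?[split; first by apply: xP; rewrite /= in gap *; lia].
- by rewrite ?em; move: gap; case: m12 => -> gap; rewrite /= in gap; inc.
- by rewrite ?em; move: gap; case: m12 => -> gap; rewrite /= in gap; inc.
Qed.

Lemma top_L r c : is_block s (r, c, KL) -> r = 0.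
Proof.
move=> bd; apply/eqP; rewrite -leqn0 leqNgt; apply/negP => r0.
have [qF _ _ _] := corner_pats_forbidden.
have rn : r < n by have /col_bound[] := bd 0 isT; rewrite /= addn0.
apply: (refute av (ds := [:: (r, c, KL)]) (al := [:: (100, (r.-1, col_of r.-1))]) qF bd).
- by [].
- by split=> //; apply: row_col_of; lia.
- by inc.
- by inc.
Qed.

Lemma left_L_bound r c : is_block s (r, c, KL) -> c <= 1.
Proof.
move=> bd; rewrite leqNgt; apply/negP => c1.
have [_ qF _ _] := corner_pats_forbidden.
have cn : c < n by have /col_bound[_] := bd 7 isT; rewrite /= addn0.
have [x Gx] := @col_point _ s 0 ltac:(lia).
have [x' Gx'] := @col_point _ s 1 ltac:(lia).
apply: (refute av (ds := [:: (r, c, KL)]) (al := [:: (100, (x, 0)); (101, (x', 1))]) qF bd).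
- by [].
- by split=> //; split.
- by inc.
- by inc.
Qed.

Lemma bottom_R r c : is_block s (r, c, KR) -> n <= r + 10.
Proof.
move=> bd; rewrite leqNgt; apply/negP => c1.
have [_ _ qF _] := corner_pats_forbidden.
apply: (refute av (ds := [:: (r, c, KR)])
  (al := [:: (100, (r + 9, col_of (r + 9))); (101, (r + 10, col_of (r + 10)))]) qF bd).
- by [].
- by split; [|split=> //]; apply: row_col_of; lia.
- by inc.
- by inc.
Qed.

Lemma no_triple d d' d'' b : is_block s d -> is_block s d' -> is_block s d'' ->
  before d d' -> before d' d'' -> G b -> d''.1.1 + 9 <= b.1 -> b.2 < d.1.2 -> False.
Proof.
move=> bd bd' bd'' [h1 h2] [h3 h4] Gb b1 b2.
apply: (refute av (ds := [:: d; d'; d'']) (al := [:: (105, b)]) (triple_pat_forbidden d.2 d'.2 d''.2) bd).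
- by [].
- by [].
- by inc.
- by inc.
Qed.

Lemma fifo d d' p q : is_block s d -> is_block s d' -> before d d' -> G p -> G q ->
  p.1 < d.1.1 -> d.1.1 + 9 <= q.1 < d'.1.1 -> d'.1.2 + 9 <= q.2 -> p.2 < q.2.
Proof.
move: p q => [x y] [x' y'] /= bd bd' [h1 h2] Gp Gq p1 /andP[q1 q1'] q2.
rewrite ltnNge; apply/negP; rewrite leq_eqVlt => /orP[/eqP e|qp].
  by subst y'; have := graph_inj2 Gp Gq; lia.
apply: (refute av (ds := [:: d; d']) (al := [:: (100, (x, y)); (101, (x', y'))])
  (fifo_pat_forbidden d.2 d'.2) bd).
- by [].
- by [].
- by inc.
- by inc.
Qed.

(** Here [u] is the link pushed by [d1] and popped by [d2], while [b] ties [d1] to [d1'] and [b']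
    ties [d2] to [d2']. *)
Lemma no_mismatch m m' d1 d1' d2 d2' b b' u :
  mismatch_pat m m' (d1.2, d1'.2) (d2.2, d2'.2) \in forbidden ->
  (m, m') \in [:: (0, 0); (0, 2); (2, 0)] ->
  is_block s d1 -> is_block s d1' -> is_block s d2 -> is_block s d2' ->
  before d1 d1' -> before d1' d2 -> before d2 d2' -> G b -> G b' -> G u ->
  d1'.1.1 + 9 <= b.1 < d2.1.1 -> b.2 < d1.1.2 ->
  d2'.1.1 + 9 <= b'.1 -> d1'.1.2 + 9 <= b'.2 < d2.1.2 ->
  d1.1.1 + 9 + m <= u.1 -> u.1 + m' < d1'.1.1 -> d2.1.2 + 9 <= u.2 < d2'.1.2 -> False.
Proof.
move=> qF mm bd1 bd1' bd2 bd2' [h1 h2] [h3 h4] [h5 h6] Gb Gb' Gu b1 b2 b'1 b'2 u1 u1' u2.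
have dn : d1'.1.1 < n by have /col_bound[] := bd1' 0 isT; rewrite /block_pt /= addn0.
pose pt i := (i, col_of i).
have ptG i : i < d1'.1.1 -> G (pt i) by move=> h; apply: row_col_of; apply: ltn_trans dn.
pose al := [:: (100, u); (105, b); (106, b')].
pose bl k x := [seq (k + i, pt (x + i)) | i <- iota 0 2].
have good k x : x + 2 <= d1'.1.1 -> foldr (fun p P => G p /\ P) True (unzip2 (al ++ bl k x)).
  by move=> xd; do 5!(split=> //; try by apply: ptG; lia).
have good0 : foldr (fun p P => G p /\ P) True (unzip2 al) by [].
move: mm; rewrite !inE => /or3P[] /eqP[em em']; subst m m'.
- apply: (refute av (ds := [:: d1; d1'; d2; d2']) (al := al) qF bd1).
  + by [].
  + exact: good0.
  + by inc.
  + by inc.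
(* The blanks are the two rows just below the link. *)
- apply: (refute av (ds := [:: d1; d1'; d2; d2']) (al := al ++ bl 120 u.1.+1) qF bd1).
  + by [].
  + by apply: good; lia.
  + by inc.
  + by inc.
(* The blanks are the first two rows of the gap. *)
- apply: (refute av (ds := [:: d1; d1'; d2; d2']) (al := al ++ bl 110 (d1.1.1 + 9)) qF bd1).
  + by [].
  + by apply: good; lia.
  + by inc.
  + by inc.
Qed.

Lemma not_start r c r' c' r'' c'' b b' : is_block s (r, c, KL) -> is_block s (r', c', KH) ->
  is_block s (r'', c'', KX) -> before (r, c, KL) (r', c', KH) -> before (r', c', KH) (r'', c'', KX) ->
  G b -> G b' -> r' + 9 <= b.1 < r'' -> b.2 < c -> r'' + 9 <= b'.1 -> c + 9 <= b'.2 < c' -> False.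
Proof.
move=> bd bd' bd'' [/= h1 h2] [/= h3 h4] Gb Gb' b1 b2 b'1 b'2.
have [_ _ _ qF] := corner_pats_forbidden.
apply: (refute av (ds := [:: (r, c, KL); (r', c', KH); (r'', c'', KX)])
  (al := [:: (105, b); (106, b')]) qF bd).
- by [].
- by [].
- by inc.
- by inc.
Qed.

End Refutations.

(** With gaps of exact length the points of a link are named by offsets: the gap rows start at
    offset 9, the popped link is in the first gap column and the low point of the next block in the
    last one. *)
Definition exact_next n (s : 'S_n) (d d' : corner) :=
  [/\ (d.2, d'.2) \in steps, is_block s d', d'.1.1 = d.1.1 + 9 + row_gap_len d.2
    & d'.1.2 = d.1.2 + 9 + col_gap_len d.2 d'.2] /\
  [/\ exists x, [/\ x < n, d'.1.1 + 9 <= x & col_of s x < d.1.2],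
    match d.2 with
    | KL => d'.1.2 + 9 <= col_of s (d.1.1 + 9)
    | KX => col_of s (d.1.1 + 9) < d.1.2 /\ d'.1.2 + 9 <= col_of s (d.1.1 + 10)
    | _ => d'.1.2 + 9 <= col_of s (d.1.1 + 9) < col_of s (d.1.1 + 11) /\
           col_of s (d.1.1 + 10) < d.1.2
    end,
    ~~ is_L d.2 -> exists x, x < d.1.1 /\ col_of s x = d.1.2 + 9 &
    ~~ is_R d'.2 -> exists x, [/\ x < n, d'.1.1 + 9 <= x & (col_of s x).+1 = d'.1.2]].

Section Chain.

Variables (n : nat) (s : 'S_n).
Hypothesis av : avoids_all forbidden s.
Hypothesis nu : forall r, ~ unlinked blocks links s r.

Lemma exists_next d : is_block s d -> d.2 <> KR -> exists d', exact_next s d d'.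
Proof.
move=> bd nR; have [d' ls] := exists_step av nu bd nR; exists d'.
case: ls => -[st bd' cd] [[b [Gb b1 b2]] gap pop zL].
have rd : d.1.1 + 9 <= d'.1.1.
  move: gap; case: (d.2).
  - by case=> p [_ h _]; lia.
  - by case=> a [p [_ _ h _]]; lia.
  - by case=> a [p [p' [_ h _]]]; lia.
  - by case=> a [p [p' [_ h _]]]; lia.
have bf : before d d' by split.
have h1 := row_gap_bound av st bd bd' bf Gb b1 b2.
have h2 := col_gap_bound av st bd bd' bf Gb b1 b2.
have G2 x y : graph s (x, y) -> x < n /\ y = col_of s x by move/graphE.
move: d d' Gb b1 b2 gap pop zL st bd bd' cd nR rd bf h1 h2 => [[r c] t] [[r' c'] t'] /=.
case: b => bx cb; move=> /G2[bn ->] {cb} /= b1 b2 gap pop zL st bd bd' cd nR rd _ h1 h2.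
rewrite /exact_next /=.
(* The points of the link already fill the gap, which gives the lower bounds. *)
have rE : r' = r + 9 + row_gap_len t.
  move: gap h1; case: t {st bd pop zL h2} nR => // nR /=.
  - by case=> p [_ h _] h1; lia.
  - by case=> a [p [_ _ h _]] h1; lia.
  - by case=> a [p [p' [_ h _]]] h1; lia.
have cE : c' = c + 9 + col_gap_len t t'.
  move: h2 pop zL; rewrite /col_gap_len; case: (is_L t) => /= h2 pop zL.
    by have [z [_ _ h]] := zL isT; lia.
  have [u [_ _ h hz]] := pop isT; move: h2 hz; case: (is_R t') => /= h2 hz; first by lia.
  by have [z [_ _ h']] := hz isT; lia.
split; first by split.
split.
- by exists bx.
- move: gap rE; case: t {st bd pop zL h2 h1 cE} nR => // nR /=.
  + case=> -[px py] /= [/G2[_ ->] /= h hp] rE.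
    have e : px = r + 9 by lia.
    by rewrite -e.
  + case=> -[ax ay] [[px py]] /= [/G2[_ ->] /G2[_ ->] /= h hp] rE.
    have e : ax = r + 9 by lia.
    have e' : px = r + 10 by lia.
    by rewrite -e -e'.
  + case=> -[px py] [[ax ay]] [[qx qy]] /= [[/G2[_ ->] /G2[_ ->] /G2[_ ->]] /= h hp] rE.
    have e : px = r + 9 by lia.
    have e' : ax = r + 10 by lia.
    have e'' : qx = r + 11 by lia.
    by rewrite -e -e' -e''; case: hp.
- move=> nL; have [[ux uy] [/G2[un ->] /= h1' h2' hz]] := pop nL.
  exists ux; split=> //; move: cE; rewrite /col_gap_len (negbTE nL) /=; case E : (is_R t') hz => hz cE.
    by lia.
  by have [[zx zy] [/G2[zn ->] /= z1 z2]] := hz isT; lia.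
- move=> nR'; case E : (is_L t) zL pop => zL pop.
    have [[zx zy] [/G2[zn ->] /= z1 z2]] := zL isT; exists zx; split=> //.
    by move: cE; rewrite /col_gap_len E /=; lia.
  have [[ux uy] [/G2[un ->] /= h1' h2' hz]] := pop isT.
  have [[zx zy] [/G2[zn ->] /= z1 z2]] := hz nR'; exists zx; split=> //.
  by move: cE; rewrite /col_gap_len E (negbTE nR') /=; lia.
Qed.

Lemma chain_exists d0 : is_block s d0 -> d0.2 = KL -> exists N D,
  [/\ D 0 = d0, forall i, i <= N -> is_block s (D i), forall i, i < N -> exact_next s (D i) (D i.+1)
    & (D N).2 = KR].
Proof.
move=> b0 k0.
pose nxt d := match excluded_middle_informative (exists d', exact_next s d d') with
  | left h => proj1_sig (constructive_indefinite_description _ h) | right _ => d end.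
have nxtP d : is_block s d -> d.2 != KR -> exact_next s d (nxt d).
  move=> bd /eqP nR; rewrite /nxt; case: excluded_middle_informative => [h|nh].
    by case: constructive_indefinite_description.
  by case: nh; apply: exists_next.
pose D i := iter i nxt d0.
have DP m : (forall i, i < m -> (D i).2 != KR) -> is_block s (D m) /\ m <= (D m).1.1.
  elim: m => // m IH h.
  have [bm mm] := IH (fun i im => h i (ltnW im)).
  by have [[_ bm' e _] _] := nxtP _ bm (h m (ltnSn m)); split=> //; rewrite /D /= e; lia.
(* Each step moves down, so a chain without last block would leave the permutation after [n]
   steps. *)
have ex : exists i, (D i).2 == KR.
  case: (asbP (exists i, (D i).2 == KR)) => // ne.
  have [bn nn] := DP n (fun i _ => introN idP (fun e => ne (ex_intro _ i e))).
  by have /col_bound[] := bn 0 isT; rewrite /block_pt /=; lia.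
case: (ex_minnP ex) => N /eqP NR Nmin.
have nR i : i < N -> (D i).2 != KR.
  by move=> iN; apply/negP => /Nmin; lia.
have bl i : i <= N -> is_block s (D i).
  by move=> iN; have [] := DP i (fun j ji => nR j (leq_trans ji iN)).
exists N, D; split=> // i iN; apply: nxtP; [exact: bl (ltnW iN)|exact: nR].
Qed.

End Chain.

(** * Points and kinds along a chain *)

Lemma stepsP t t' : (t, t') \in steps ->
  [/\ t <> KR, t' <> KL, t = KL -> t' = KH & t' = KR -> t = KH].
Proof. by case: t; case: t'. Qed.

(** From position 3 on, the pushing block, its successor and the popping block are distinct, as
    [mismatch_pat] requires. *)
Lemma origin_lt2 j : 2 < j -> 0 < origin j /\ (origin j).+1 < j.
Proof.
move=> j2; rewrite /origin; have := round_pos_gt0 (ltnW (ltnW j2)); have := round_posP j.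
case: (round_pos j) => -[//|[|r]] c /= [e h] _; first by move: e; rewrite /=; lia.
have := round_start_mono (leq0n r); case: c e h => [|c] /= e h; last by lia.
by case: r e h => [|r] /= e h; lia.
Qed.

Section Structure.

Variables (n : nat) (s : 'S_n).
Hypothesis av : avoids_all forbidden s.
Variables (N : nat) (D : nat -> corner).
Hypothesis kind0 : (D 0).2 = KL.
Hypothesis blockD : forall i, i <= N -> is_block s (D i).
Hypothesis nextD : forall i, i < N -> exact_next s (D i) (D i.+1).
Hypothesis kindN : (D N).2 = KR.

Notation R i := (D i).1.1.
Notation C i := (D i).1.2.
Notation T i := (D i).2.
Notation col := (col_of s).

Lemma corner_eta i : D i = (R i, C i, T i).
Proof. by case: (D i) => -[]. Qed.

Lemma stepD i : i < N -> (T i, T i.+1) \in steps.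
Proof. by move/nextD=> [[]]. Qed.

Lemma rowS i : i < N -> R i.+1 = R i + 9 + row_gap_len (T i).
Proof. by move/nextD=> [[]]. Qed.

Lemma colS i : i < N -> C i.+1 = C i + 9 + col_gap_len (T i) (T i.+1).
Proof. by move/nextD=> [[]]. Qed.

Lemma kind_notR i : i < N -> T i <> KR.
Proof. by move/stepD/stepsP=> []. Qed.

Lemma kind_notL i : 0 < i <= N -> T i <> KL.
Proof. by case: i => // i /andP[_ /stepD/stepsP[]]. Qed.

Lemma is_L_inner i : 0 < i <= N -> is_L (T i) = false.
Proof. by move/kind_notL; case: (T i). Qed.

Lemma is_R_inner i : i < N -> is_R (T i) = false.
Proof. by move/kind_notR; case: (T i). Qed.

Lemma kind_inner i : 0 < i < N -> T i = KX \/ T i = KH.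
Proof.
move=> /andP[i0 iN]; have := kind_notR iN; have := @kind_notL i; rewrite i0 (ltnW iN).
by case: (T i) => //; [move=> /(_ isT)|left|right].
Qed.

Lemma N_gt1 : 1 < N.
Proof.
have N0 : 0 < N by case: N kindN kind0 => // ->.
have [_ _ /(_ kind0) h _] := stepsP (stepD N0).
by move: N0 kindN h; case: N => [//|[|//]] _ ->.
Qed.

Lemma kind1 : T 1 = KH.
Proof. by have [_ _ /(_ kind0)] := stepsP (stepD (ltnW N_gt1)). Qed.

Lemma kind_last : T N.-1 = KH.
Proof.
have h := N_gt1; have /stepD/stepsP[_ _ _] : N.-1 < N by lia.
by rewrite prednK; [apply|lia].
Qed.

Lemma col_gap_gt0 t t' : 0 < col_gap_len t t'.
Proof. by rewrite /col_gap_len; case: ifP. Qed.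

Lemma row_gap_gt0 t : t <> KR -> 0 < row_gap_len t.
Proof. by case: t. Qed.

Lemma D_mono i j : i < j <= N -> R i + 9 < R j /\ C i + 9 < C j.
Proof.
case/andP; elim: j => // j IH; rewrite ltnS leq_eqVlt => /orP[/eqP <-|ij] jN.
  rewrite rowS // colS //; have := col_gap_gt0 (T i) (T i.+1).
  by have := row_gap_gt0 (kind_notR jN); split; lia.
have [h1 h2] := IH ij (ltnW jN).
by rewrite rowS // colS //; split; lia.
Qed.

Lemma D_before i j : i < j <= N -> before (D i) (D j).
Proof. by case/D_mono => h1 h2; split; apply: ltnW. Qed.

Lemma row_first : R 0 = 0.
Proof.
by have := blockD (leq0n N); rewrite corner_eta kind0 => /(top_L av).
Qed.

Lemma col_first : C 0 = 1.
Proof.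
have := blockD (leq0n N); rewrite corner_eta kind0 => /(left_L_bound av) /= h.
have [_ [[x [_ _ xc]] _ _ _]] := nextD (ltnW N_gt1).
by rewrite /= in h; lia.
Qed.

(** One row follows the last block: the low point tying it to its predecessor needs one, and
    [below_R] forbids two. *)
Lemma size_eq : n = R N + 10.
Proof.
have h := N_gt1.
have [_ [[x [xn]]]] : exact_next s (D N.-1) (D N.-1.+1) by apply: nextD; lia.
rewrite prednK; last by lia.
move=> xR _ _ _ _; have := blockD (leqnn N); rewrite {1}corner_eta kindN => /(bottom_R av).
by lia.
Qed.

Lemma row_lt_size i : i <= N -> R i + 10 <= n.
Proof.
rewrite size_eq leq_eqVlt => /orP[/eqP -> //|iN].
by have [] := @D_mono i N; rewrite ?iN //; lia.
Qed.

Lemma locate x : x < n -> [\/ exists2 i, i <= N & R i <= x < R i + 9,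
  exists2 i, i < N & R i + 9 <= x < R i.+1 | x = R N + 9].
Proof.
rewrite size_eq => xN; have [->|xN'] := eqVneq x (R N + 9); first by constructor 3.
have {xN xN'} : x < R N + 9 by lia.
have key m : m <= N -> x < R m + 9 -> (exists2 i, i <= N & R i <= x < R i + 9) \/
    exists2 i, i < N & R i + 9 <= x < R i.+1.
  elim: m => [_|i IH iN] xi; first by left; exists 0; rewrite // row_first in xi *.
  have [h|h] := leqP (R i.+1) x; first by left; exists i.+1; rewrite ?h.
  have [h'|h'] := leqP (R i + 9) x; first by right; exists i; rewrite ?h' ?h.
  exact: IH (ltnW iN) h'.
by case/(key N (leqnn N)); [constructor 1|constructor 2].
Qed.

Lemma block_col i k : i <= N -> k < 9 -> col (R i + k) = C i + index k (colword (T i)).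
Proof. by move=> iN k9; have /graphE[_ ->] := blockD iN k9. Qed.

Lemma block_row_col i x : i <= N -> R i <= x < R i + 9 -> C i <= col x < C i + 9.
Proof.
move=> iN h; have -> : x = R i + (x - R i) by lia.
rewrite block_col //; last by lia.
have : x - R i \in colword (T i).
  have : x - R i \in iota 0 9 by rewrite mem_iota; lia.
  by rewrite -(@perm_mem _ (colword (T i))) //; case: (T i).
rewrite -index_mem (_ : size _ = 9); last by case: (T i).
by lia.
Qed.

Lemma block_col_row i x : i <= N -> x < n -> C i <= col x < C i + 9 -> R i <= x < R i + 9.
Proof.
move=> iN xn h; pose k := nth 0 (colword (T i)) (col x - C i).
have sz : size (colword (T i)) = 9 by case: (T i).
have k9 : k < 9.
  have : k \in colword (T i) by rewrite mem_nth // sz; lia.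
  by rewrite (@perm_mem _ _ (iota 0 9)) ?mem_iota //; case: (T i).
have e : col (R i + k) = col x.
  rewrite block_col // /k index_uniq ?sz; [lia|lia|by case: (T i)].
have <- : R i + k = x by apply: col_of_inj e => //; have := row_lt_size iN; lia.
by lia.
Qed.

Definition low i := R i + (if T i is KH then 10 else 9).

Lemma low_gap i : 0 < i < N -> R i + 9 <= low i < R i.+1.
Proof.
move=> h; have /andP[i0 iN] := h; rewrite /low rowS //.
by case: (kind_inner h) => ->; rewrite /=; lia.
Qed.

Lemma low_lt_size i : 0 < i <= N -> low i < n.
Proof.
case/andP=> i0; rewrite leq_eqVlt => /orP[/eqP ->|iN].
  by rewrite /low kindN size_eq; lia.
have := low_gap (introT andP (conj i0 iN)); have := row_lt_size iN; lia.
Qed.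

(** The point below block [j.+1] and left of block [j] is not below block [j.+2] by [no_triple], and
    the other rows of the gap after [j.+1] hold links, which are further right; so its row is
    [low j.+1]. Likewise it stays right of block [j.-1], and if the gap there has two columns, the
    first is taken by the popped link. *)
Lemma low_col j : j < N -> (col (low j.+1)).+1 = C j.
Proof.
move=> jN; have [_ [[x [xn xR xC]] _ _ _]] := nextD jN.
have Gx : graph s (x, col x) by apply: row_col_of.
have xE : x = low j.+1.
  move: jN; rewrite leq_eqVlt => /orP[/eqP e|jN'].
    by rewrite /low e kindN in xR *; move: xn; rewrite size_eq; lia.
  have jjN : j < N by apply: ltnW.
  have h3 : x < R j.+2 + 9.
    rewrite ltnNge; apply/negP => h.
    apply: (no_triple av (blockD (ltnW jjN)) (blockD jjN) (blockD jN') _ _ Gx) => //;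
      by apply: D_before; lia.
  have h2 : x < R j.+2.
    rewrite ltnNge; apply/negP => h.
    have := @block_row_col j.+2 x jN'; rewrite h h3 => /(_ isT).
    have [_] := @D_mono j j.+2 ltac:(lia); lia.
  have [_ [_ gap _ _]] := nextD jN'.
  have [_ h4] := @D_mono j j.+2 ltac:(lia).
  have h1 := rowS jN'.
  move: gap h1; rewrite /low; case: (kind_inner (i := j.+1)) => [|->|->] //= gap h1.
    have [//|ne] := eqVneq x (R j.+1 + 9).
    have e : x = R j.+1 + 10 by lia.
    by move: gap; rewrite -e; lia.
  have [e|ne] := eqVneq x (R j.+1 + 9); first by move: gap; rewrite -e; lia.
  have [e|ne'] := eqVneq x (R j.+1 + 11); first by move: gap; rewrite -e; lia.
  by lia.
rewrite -xE; case: j jN xR xC xE => [|i] jN xR xC xE; first by move: xC; rewrite col_first; lia.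
have iN : i < N by apply: ltnW.
have h1 : C i <= col x.
  rewrite leqNgt; apply/negP => h.
  by apply: (no_triple av (blockD (ltnW iN)) (blockD iN) (blockD jN) _ _ Gx) => //;
    apply: D_before; lia.
have h2 : C i + 9 <= col x.
  rewrite leqNgt; apply/negP => h.
  have := @block_col_row i x (ltnW iN) xn; rewrite h1 h => /(_ isT).
  by have [] := @D_mono i i.+2 ltac:(lia); lia.
have cS := colS iN; rewrite /col_gap_len in cS.
have nR : is_R (T i.+1) = false by case: (T i.+1) (kind_notR jN).
rewrite nR orbF in cS; case E : (is_L (T i)) cS => cS; first by lia.
have [_ [_ _ /(_ (negbT E))[y [yR yC]] _]] := nextD iN.
have [e|ne] := eqVneq (col x) (C i + 9); last by lia.
have := @col_of_inj _ s x y xn; rewrite e yC => /(_ _ erefl) ee.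
have := row_lt_size (ltnW iN); have [] := @D_mono i i.+2 ltac:(lia).
by move=> *; rewrite ee in xR; lia.
Qed.

(* Row of the first or last link pushed by block [i]. *)
Definition push i (fst : bool) := R i + (if fst then 9 else if T i is KX then 10 else 11).
Definition pushes i fst := i < N /\ if fst then T i = KL \/ T i = KH else T i = KX \/ T i = KH.

Lemma push_gap i f : pushes i f -> R i + 9 <= push i f < R i.+1.
Proof.
by rewrite /push; case: f => -[iN] [] e; rewrite (rowS iN) e /=; lia.
Qed.

Lemma push_lt_size i f : pushes i f -> push i f < n.
Proof. by move=> p; have [iN _] := p; have := push_gap p; have := row_lt_size iN; lia. Qed.

Lemma push_col i f : pushes i f -> C i.+1 + 9 <= col (push i f).
Proof.
case=> iN; have [_ [_ gap _ _]] := nextD iN.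
rewrite /push; case: f => -[] e; rewrite e in gap *; lia.
Qed.

Lemma row_class x : x < n -> [\/ exists2 i, i <= N & R i <= x < R i + 9,
  exists2 i, 0 < i <= N & x = low i | exists i f, pushes i f /\ x = push i f].
Proof.
case/locate=> [|[i iN h]|->]; first by constructor 1.
  have := rowS iN; have := kind_notR iN; have Tpos := @kind_notL i; rewrite (ltnW iN) andbT in Tpos.
  case E : (T i) => //= _ e; rewrite E in Tpos.
  - constructor 3; exists i, true; rewrite /pushes /push E /=; split; [by split; last left|lia].
  - have i0 : 0 < i by case: i E {h iN e Tpos} => //; rewrite kind0.
    have [ex|ne] := eqVneq x (R i + 9).
      by constructor 2; exists i; rewrite ?i0 ?(ltnW iN) // /low E.
    constructor 3; exists i, false; rewrite /pushes /push E /=; split; [by split; last left|lia].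
  - have i0 : 0 < i by case: i E {h iN e Tpos} => //; rewrite kind0.
    have [ex|ne] := eqVneq x (R i + 10).
      by constructor 2; exists i; rewrite ?i0 ?(ltnW iN) // /low E.
    constructor 3; have [ex|ne'] := eqVneq x (R i + 9).
      by exists i, true; rewrite /pushes /push E /=; split=> //; split; last right.
    by exists i, false; rewrite /pushes /push E /=; split; [split; last right|lia].
constructor 2; exists N; last by rewrite /low kindN.
by rewrite leqnn andbT ltnW // N_gt1.
Qed.

Lemma push_disjoint i f j : pushes i f -> 0 < j <= N -> push i f <> low j.
Proof.
move=> p /andP[j0 jN] e; have [iN _] := p; have pg := push_gap p.
have [ij|ij|ij] := ltngtP i j.
- have lj : R j + 9 <= low j by rewrite /low; case: (T j); lia.
  have : R i.+1 <= R j by move: ij; rewrite leq_eqVlt => /orP[/eqP -> //|ij]; have [] := @D_mono i.+1 j; lia.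
  by lia.
- have jN' : 0 < j < N by lia.
  have := low_gap jN'; have : R j.+1 <= R i by move: ij; rewrite leq_eqVlt => /orP[/eqP -> //|ij]; have [] := @D_mono j.+1 i; lia.
  by lia.
- subst j; move: {pg} e p; rewrite /low /push => e [_].
  by have := @kind_notL i; rewrite j0 jN => /(_ isT); case: f e => e nl [] h; rewrite h in e nl;
    solve [by case: nl | lia].
Qed.

Lemma row_mono i j : i <= j <= N -> R i <= R j.
Proof.
case/andP; rewrite leq_eqVlt => /orP[/eqP -> //|ij] jN.
by have [] := @D_mono i j; lia.
Qed.

Lemma push_increasing i f j g : pushes i f -> pushes j g -> push i f < push j g ->
  col (push i f) < col (push j g).
Proof.
move=> p q pq; have [iN pT] := p; have [jN qT] := q.
have pg := push_gap p; have qg := push_gap q.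
have [ij|ij|ij] := ltngtP i j.
- have Gp : graph s (push i f, col (push i f)) by apply/row_col_of/push_lt_size.
  have Gq : graph s (push j g, col (push j g)) by apply/row_col_of/push_lt_size.
  apply: (@fifo _ _ av _ _ _ _ (blockD (ltnW jN)) (blockD jN) (D_before _) Gp Gq) => //=.
  + by lia.
  + by have := @row_mono i.+1 j; lia.
  + exact: push_col q.
- by have := @row_mono j.+1 i; lia.
- subst j; have [_ [_ gap _ _]] := nextD iN.
  rewrite /push in pq *; case: f g pT qT pq {p q pg qg} => -[] [] e [] e' pq;
    solve [by rewrite e in e' | by rewrite e in gap pq *; lia].
Qed.

Lemma push_increasing' i f j g : pushes i f -> pushes j g -> col (push i f) < col (push j g) ->
  push i f < push j g.
Proof.
move=> p q; have [//|h|->] := ltngtP (push i f) (push j g); last by rewrite ltnn.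
by have := push_increasing q p h; lia.
Qed.

Lemma col_gap2 i : 0 < i < N.-1 -> C i.+1 = C i + 11.
Proof.
move=> /andP[i0 iN]; have iN1 : i < N by lia.
rewrite colS // /col_gap_len.
by rewrite is_L_inner ?is_R_inner //=; lia.
Qed.

(** The column is in a gap, so its point is not in a block. By [low_col] a low point is in the last
    column of a gap, which differs from the first unless the next block is the last one, and no low
    point lies just before that. *)
Lemma popped i : 0 < i < N -> exists j f, pushes j f /\ col (push j f) = C i + 9.
Proof.
move=> /andP[i0 iN]; have [_ [_ _ pop _]] := nextD iN.
have [|x [xR xC]] := pop; first by rewrite is_L_inner // i0 ltnW.
have Cn := colS iN; have Cpos := col_gap_gt0 (T i) (T i.+1).
case: (@row_class x) => [|[j jN /(block_row_col jN)]|[[//|j] jN e]|[j [f [p e]]]].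
- by have := row_lt_size (ltnW iN); lia.
- have [ij|ij|<-] := ltngtP i j; last by lia.
    have : C i.+1 <= C j by move: ij; rewrite leq_eqVlt => /orP[/eqP -> //|ij]; have [] := @D_mono i.+1 j; lia.
    by lia.
  by have [] := @D_mono j i; lia.
- have := low_col jN; rewrite -e xC => e'.
  have [ij|ij|ij] := ltngtP i j; last by subst; lia.
    have h := @col_gap2 i; have : C i.+1 <= C j.
      by move: ij; rewrite leq_eqVlt => /orP[/eqP -> //|ij]; have [] := @D_mono i.+1 j; lia.
    by lia.
  by have [] := @D_mono j i; lia.
- by exists j, f; rewrite -e.
Qed.

(** By [origin_next] the next link is the second one of the same H-block or the first one pushed by
    the next block. Knowing the kinds up to [i] suffices because [origin i.+1 <= i]. *)
Lemma next_pushed i : 0 < i -> i.+1 < N -> (forall j, j <= i -> T j = word j) ->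
  [/\ pushes (origin i.+1) (is_first i.+1),
      push (origin i) (is_first i) < push (origin i.+1) (is_first i.+1) &
      forall j f, pushes j f -> push (origin i) (is_first i) < push j f ->
        push (origin i.+1) (is_first i.+1) <= push j f].
Proof.
move=> i0 iN wd; have oi := origin_lt i0; have oi1 := origin_lt (ltn0Sn i).
have k1N : origin i.+1 < N by lia.
have kN : origin i < N by lia.
have wk := wd _ (ltnW oi); have wk1 := wd (origin i.+1) oi1.
have push_word k j : 0 < j -> origin j = k -> k < N -> T k = word k -> pushes k (is_first j).
  move=> j0 <- kN' wk'; split=> //; rewrite wk'; case: ifP => [f1|/negbT f1]; first exact: origin_first.
  by case: (origin_last f1); [right|left].
have pk1 : pushes (origin i.+1) (is_first i.+1) by apply: push_word.
have pk : pushes (origin i) (is_first i) by apply: push_word.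
have pg := push_gap pk; have pg1 := push_gap pk1.
have above j f : pushes j f -> push (origin i) (is_first i) < push j f -> origin i <= j.
  move=> p lt; rewrite leqNgt; apply/negP => jk; have := push_gap p.
  have := @row_mono j.+1 (origin i); lia.
case: (origin_next i0) => [[f0 [wH [e f1]]]|[hk [e w1]]].
- rewrite e (negbTE f1) f0 in pk1 pg1 wk1 above *; rewrite f0 in pk pg.
  have TH : T (origin i) = KH by rewrite wk1.
  split=> //; first by rewrite /push TH; lia.
  move=> j f p lt; have := above _ _ p lt; rewrite leq_eqVlt => /orP[/eqP ej|ij].
    by move: p lt; rewrite -ej /push TH; case: f => -[_ _]; lia.
  by have := push_gap p; have := @row_mono (origin i).+1 j; have [] := p; lia.
- have lt01 : push (origin i) (is_first i) < push (origin i.+1) (is_first i.+1).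
    by rewrite e in pg1 *; lia.
  split=> // j f p lt; have := above _ _ p lt; rewrite leq_eqVlt => /orP[/eqP ej|ij].
    exfalso; move: p lt; rewrite -ej /push => -[_].
    have [_ pT] := pk; case: hk => [/negbTE nf|wL].
      rewrite nf in pT *; case: f => -[] qT; case: pT => e'; rewrite e' in qT *; by [|lia].
    have TL : T (origin i) = KL by rewrite wk.
    rewrite TL in pT *; case: (is_first i) pT => -[] // _; case: f => -[] //; lia.
  move: ij; rewrite leq_eqVlt => /orP[/eqP ej|ij].
    rewrite e in wk1 *; rewrite w1 in wk1; rewrite -ej in p *; have [_ pT] := p.
    rewrite /push; case: (is_first i.+1) wk1 pT => -> ; case: f {p lt}; by [lia|move=> []|lia].
  by rewrite e in pg1 *; have := push_gap p; have := @row_mono (origin i).+2 j; have [] := p; lia.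
Qed.

(** Kinds and popped links are determined together. As links keep their order, the link popped at
    [i.+1] is the one pushed next after that popped at [i]; its pusher and its rank there leave a
    single kind by the mismatch patterns. *)
Lemma word_kind i : i < N -> T i = word i /\
  (0 < i -> pushes (origin i) (is_first i) /\ col (push (origin i) (is_first i)) = C i + 9).
Proof.
elim/ltn_ind: i => i IH iN.
have wd j : j < i -> T j = word j by move=> ji; have [] := IH j ji (ltn_trans ji iN).
case: i IH iN wd => [|i] IH iN wd; first by rewrite kind0.
have [j [f [p pc]]] := @popped i.+1 iN.
suff [pk kc] : pushes (origin i.+1) (is_first i.+1) /\ col (push (origin i.+1) (is_first i.+1)) = C i.+1 + 9.
  split=> //; have := origin_lt (ltn0Sn i) => ko.
  have wk := wd _ ko.
  (* Positions 1 and 2 are too early for a mismatch pattern; [steps] and [start_pat] settle them. *)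
  have [i1|i1] := leqP i.+1 2.
    have [->|e1] : i = 0 \/ i = 1 by lia.
      by rewrite kind1.
    subst i; case: (@kind_inner 2 iN) => // TX; exfalso.
    have := @not_start _ _ av (R 0) (C 0) (R 1) (C 1) (R 2) (C 2) (low 1, col (low 1)) (low 2, col (low 2)).
    rewrite -kind0 -kind1 -TX -!corner_eta.
    have N2 := N_gt1.
    move=> /(_ (blockD _) (blockD _) (blockD _) (D_before _) (D_before _)).
    apply=> //; rewrite ?kind0 ?kind1 ?TX ?(ltnW N2) //=.
    + by apply/row_col_of/low_lt_size; lia.
    + by apply/row_col_of/low_lt_size; lia.
    + by apply: low_gap; lia.
    + by have := @low_col 0; lia.
    + by rewrite /low TX.
    + by have := low_col N2; have := colS (ltnW N2); rewrite kind0 kind1 /col_gap_len /=; lia.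
  have [k0 kj] := @origin_lt2 i.+1 i1.
  have jN1 : i.+2 <= N by [].
  have kN : (origin i.+1).+1 < N by lia.
  have mis m m' := @no_mismatch _ _ av m m' (D (origin i.+1)) (D (origin i.+1).+1) (D i.+1) (D i.+2)
    (low (origin i.+1).+1, col (low (origin i.+1).+1)) (low i.+2, col (low i.+2))
    (push (origin i.+1) (is_first i.+1), col (push (origin i.+1) (is_first i.+1))).
  have {}mis m m' : mismatch_pat m m' (T (origin i.+1), T (origin i.+1).+1) (T i.+1, T i.+2) \in forbidden ->
      (m, m') \in [:: (0, 0); (0, 2); (2, 0)] ->
      R (origin i.+1) + 9 + m <= push (origin i.+1) (is_first i.+1) ->
      push (origin i.+1) (is_first i.+1) + m' < R (origin i.+1).+1 -> False.
    move=> qF mm h1 h2; apply: (mis m m' qF mm) => //=.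
    + by apply: blockD; lia.
    + by apply: blockD; lia.
    + by apply: blockD; lia.
    + by apply: blockD; lia.
    + by apply: D_before; lia.
    + by apply: D_before; lia.
    + by apply: D_before; lia.
    + by apply/row_col_of/low_lt_size; lia.
    + by apply/row_col_of/low_lt_size; lia.
    + by apply/row_col_of/push_lt_size.
    + by have := @low_gap (origin i.+1).+1; have := @row_mono (origin i.+1).+2 i.+1; lia.
    + by have := @low_col (origin i.+1); lia.
    + by rewrite /low; case: (T i.+2); lia.
    + by have := @low_col i.+1; have [] := @D_mono (origin i.+1).+1 i.+1; lia.
    + by rewrite kc; have := colS iN; have := col_gap_gt0 (T i.+1) (T i.+2); lia.
  have rk := @rowS (origin i.+1) ltac:(lia).
  have st1 := @stepD (origin i.+1) ltac:(lia).
  have st2 := @stepD i.+1 iN.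
  have [_ pT] := pk.
  have M := mismatch_pats_forbidden (T i.+2) (@kind_notR (origin i.+1).+1 kN).
  rewrite word_first //; case: (@kind_inner i.+1 iN) => TI; rewrite TI in st2 mis *.
  + case E : (is_first i.+1) => //; exfalso; rewrite E /push in pT mis; clear M.
    have kL := @kind_notL (origin i.+1) (introT andP (conj k0 (ltnW (ltnW kN)))).
    have TH : T (origin i.+1) = KH by case: pT.
    rewrite TH in rk st1 mis; rewrite /= in rk; move: (mis 0 2) => {mis} mis.
    have := mismatch_pats_forbidden (T i.+2) (@kind_notR (origin i.+1).+1 kN).
    by case=> _ M _; apply: (mis (M st1 st2) isT); clear M mis; lia.
  + case E : (is_first i.+1) => //; exfalso; rewrite E /push in pT mis.
    case: pT => TK; rewrite TK in rk st1 mis; rewrite /= in rk.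
      by case: M => M _ _; apply: (mis 0 0 (M st1 st2) isT); clear M mis; rewrite /=; lia.
    by case: M => _ _ M; apply: (mis 2 0 (M st1 st2) isT); clear M mis; rewrite /=; lia.
(* The first pop takes the link of the L-block: any later link would be further right, and
   [push_col] already puts the L-link at [C 1 + 9] or beyond. *)
have [i0|i0] := posnP i.
  subst i; have p0 : pushes 0 true by split; [lia|left].
  have e : push j f = push 0 true.
    have [h|h|//] := ltngtP (push j f) (push 0 true).
      have := push_gap p; have := @row_mono 0 j; have [] := p.
      by move: h; rewrite /push row_first; lia.
    by have := push_increasing p0 p h; have := push_col p0; lia.
  by have [-> ->] : origin 1 = 0 /\ is_first 1 = true by []; rewrite -e.
have [pi ci] := (IH i (ltnSn i) (ltnW iN)).2 i0.
have [pk lt next] := next_pushed i0 iN wd.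
split=> //.
have ltx : push (origin i) (is_first i) < push j f.
  by apply: push_increasing' => //; rewrite ci pc; have [] := @D_mono i i.+1; lia.
(* A skipped link would have its column strictly between [C i + 9] and [C i.+1 + 9]. These columns
   are [C i + 10], taken by a low point, and those of block [i.+1]. *)
have := next j f p ltx; rewrite leq_eqVlt => /orP[/eqP -> //|h]; exfalso.
have h1 := push_increasing pi pk lt; have h2 := push_increasing pk p h.
rewrite ci in h1; rewrite pc in h2.
have cg : C i.+1 = C i + 11 by apply: col_gap2; lia.
have pg := push_gap pk; have pkn := push_lt_size pk; have [kN _] := pk.
have [e|ne] := eqVneq (col (push (origin i.+1) (is_first i.+1))) (C i + 10).
  have lc := low_col iN.
  apply: (push_disjoint pk (j := i.+2)); first by lia.
  by apply: (@col_of_inj _ s) => //; [apply: low_lt_size; lia|lia].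
have := @block_col_row i.+1 _ (ltnW iN) pkn; move/(_ ltac:(lia)) => hr.
have [ij|ij|ij] := ltngtP (origin i.+1) i.+1.
- by have := @row_mono (origin i.+1).+1 i.+1; lia.
- by have := @row_mono i.+2 (origin i.+1); have := @rowS i.+1; lia.
- by have := origin_lt (ltn0Sn i); rewrite ij ltnn.
Qed.

End Structure.

(** * Size and uniqueness of the rigid permutations *)

Fixpoint word_row i := if i is j.+1 then word_row j + 9 + row_gap_len (word j) else 0.

Lemma word_rowS i : word_row i.+1 = word_row i + 9 + row_gap_len (word i).
Proof. by []. Qed.

(** With their gaps L, X and H take 10, 11 and 12 rows, and one L and [t.-1] H precede round [t]. *)
Lemma word_row_start t : 0 < t -> word_row (round_start t) + 2 = 11 * round_start t + t.
Proof.
case: t => // t _; elim: t => // t IH.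
have key c : 0 < c <= t.+1 -> word_row (round_start t.+1 + c) + 1 = 11 * (round_start t.+1 + c) + t.+1.
  elim: c => // c IHc /andP[_ ct]; rewrite (addnS (round_start t.+1) c) word_rowS.
  have [->|c0] := posnP c; first by rewrite addn0 word_start //=; rewrite /= in IH *; lia.
  by rewrite wordS //; have := IHc ltac:(lia); rewrite /=; lia.
by have := key t.+1; rewrite -round_startS // leqnn => /(_ isT); lia.
Qed.

(** On [A] both permutations use, in increasing order, the columns left over by the other rows; the
    first row of disagreement is contradictory. *)
Lemma perm_eq_increasing n (s s' : 'S_n) (A : nat -> Prop) :
  (forall x, x < n -> A x \/ col_of s x = col_of s' x) ->
  (forall x y, A x -> A y -> x < y < n -> col_of s x < col_of s y) ->
  (forall x y, A x -> A y -> x < y < n -> col_of s' x < col_of s' y) -> s = s'.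
Proof.
move=> cl inc inc'.
have key (p q : 'S_n) x : x < n -> (forall y, y < x -> col_of p y = col_of q y) ->
    (forall x, x < n -> A x \/ col_of p x = col_of q x) -> A x ->
    (forall x y, A x -> A y -> x < y < n -> col_of q x < col_of q y) ->
    col_of q x <= col_of p x.
  move=> xn IH clp Ax incq; rewrite leqNgt; apply/negP => lt.
  have [_ pn] := col_bound (row_col_of p xn).
  have [y /graphE[yn e]] := col_point q pn.
  have xy : x <> y by move=> xy; rewrite e xy ltnn in lt.
  have [yx|yx|yx] := ltngtP y x; last by case: xy.
    by apply: xy; apply: (@col_of_inj _ p) => //; rewrite (IH y yx).
  case: (clp y yn) => [Ay|e'].
    by have := incq _ _ Ax Ay; rewrite yx yn => /(_ isT); lia.
  by apply: xy; apply: (@col_of_inj _ p) => //; rewrite e'.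
have {}key : forall x, x < n -> col_of s x = col_of s' x.
  elim/ltn_ind => z IH zn.
  have {}IH y : y < z -> col_of s y = col_of s' y by move=> yz; apply: IH => //; apply: ltn_trans zn.
  case: (cl z zn) => // Az; apply/eqP; rewrite eqn_leq; apply/andP; split; apply: key => //.
  - by move=> y /IH ->.
  - by move=> y /cl[]; [left|right].
apply/permP => i; apply: ord_inj; have := key i (ltn_ord i).
by rewrite /col_of !valK.
Qed.

Definition good n (s : 'S_n) :=
  candidate forbidden (blocks_of KL) s /\ forall r, ~ unlinked blocks links s r.

Lemma good_chain n (s : 'S_n) : good s -> exists N D,
  [/\ (D 0).2 = KL, forall i, i <= N -> is_block s (D i),
      forall i, i < N -> exact_next s (D i) (D i.+1) & (D N).2 = KR].
Proof.
case=> [[av [q qL [v oc]]] nu].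
have [b eq] : exists b, q = (block 0, blockC 0 KL b) by case/mapP: qL => b _ ->; exists b.
rewrite eq in oc; have [_ sd] := occ_signed av oc.
have [b0 _] := block_linked av nu sd; rewrite b0 in sd.
have [N [D [e h1 h2 h3]]] := chain_exists av nu sd erefl.
by exists N, D; split=> //; rewrite e.
Qed.

(** Only an H-block precedes R, so the last block comes right after the first block of a round. *)
Lemma chain_size n (s : 'S_n) N D : avoids_all forbidden s ->
  (D 0).2 = KL -> (forall i, i <= N -> is_block s (D i)) ->
  (forall i, i < N -> exact_next s (D i) (D i.+1)) -> (D N).2 = KR ->
  exists t, [/\ 0 < t, N = (round_start t).+1 & n = 11 * round_start t + t + 20].
Proof.
move=> av k0 bD nD kN; have N1 := N_gt1 k0 nD kN.
have wk i (iN : i < N) := (word_kind av k0 bD nD kN iN).1.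
have rE i : i <= N -> (D i).1.1 = word_row i.
  elim: i => [_|i IH iN]; first by rewrite (row_first av k0 bD).
  by rewrite (rowS nD) //= IH ?(ltnW iN) // wk.
have Nr : round_pos N.-1 = ((round_pos N.-1).1, 0).
  have := kind_last k0 nD kN; rewrite wk ?word_first; [|lia|lia].
  by rewrite /is_first; case: (round_pos N.-1) => r c /=; case: eqP => [->|].
have := round_posP N.-1; rewrite Nr addn0 => -[Ne _].
have t0 : 0 < (round_pos N.-1).1 by apply: round_pos_gt0; lia.
exists (round_pos N.-1).1; split=> //; first by rewrite -Ne; lia.
rewrite (size_eq av k0 bD nD kN) rE //.
have -> : N = N.-1.+1 by lia.
rewrite word_rowS Ne word_start //=; have := word_row_start t0; rewrite -Ne; lia.
Qed.

Lemma good_unique n (s s' : 'S_n) : good s -> good s' -> s = s'.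
Proof.
move=> gs gs'; have [av _] := gs.1; have [av' _] := gs'.1.
have [N [D [k0 bD nD kN]]] := good_chain gs.
have [N' [D' [k0' bD' nD' kN']]] := good_chain gs'.
have NN : N' = N.
  have [t [t0 eN en]] := chain_size av k0 bD nD kN.
  have [t' [t0' eN' en']] := chain_size av' k0' bD' nD' kN'.
  rewrite eN eN'; case: (ltngtP t t') => [h|h|-> //].
    by have := round_start_mono (ltnW h); lia.
  by have := round_start_mono (ltnW h); lia.
subst N'; have N1 := N_gt1 k0 nD kN.
have kE i : i <= N -> (D i).2 = (D' i).2.
  rewrite leq_eqVlt => /orP[/eqP -> |iN]; first by rewrite kN kN'.
  by rewrite (word_kind av k0 bD nD kN iN).1 (word_kind av' k0' bD' nD' kN' iN).1.
have DE i : i <= N -> D i = D' i.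
  elim: i => [_|i IH iN].
    rewrite [LHS]corner_eta [RHS]corner_eta k0 k0' (row_first av k0 bD) (row_first av' k0' bD').
    by rewrite (col_first av k0 bD nD kN) (col_first av' k0' bD' nD' kN').
  rewrite [LHS]corner_eta [RHS]corner_eta (kE i.+1 iN) (rowS nD iN) (rowS nD' iN).
  by rewrite (colS nD iN) (colS nD' iN) (kE i.+1 iN) (IH (ltnW iN)).
have pE i f : pushes N D i f -> push D i f = push D' i f /\ pushes N D' i f.
  by case=> iN h; rewrite /push /pushes -(DE i (ltnW iN)).
apply: (@perm_eq_increasing _ _ _ (fun x => exists i f, pushes N D i f /\ x = push D i f)).
- move=> x xn; case: (row_class av k0 bD nD kN xn) => [[i iN xi]|[[//|j] jN ->]|h]; [right|right|by left].
    have -> : x = (D i).1.1 + (x - (D i).1.1) by lia.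
    have b' := bD' i iN; rewrite -(DE i iN) in b'.
    have k9 : x - (D i).1.1 < 9 by lia.
    by have /graphE[_ <-] := bD i iN _ k9; have /graphE[_ <-] := b' _ k9.
  have e := low_col av k0 bD nD kN jN; have e' := low_col av' k0' bD' nD' kN' jN.
  have le : low D' j.+1 = low D j.+1 by rewrite /low -(DE j.+1 jN).
  by rewrite le -(DE j (ltnW jN)) in e'; lia.
- move=> x y [i [f [p ->]]] [j [g [q ->]]] /andP[h _].
  exact: (push_increasing av k0 bD nD kN p q h).
- move=> x y [i [f [p ->]]] [j [g [q ->]]] /andP[h _].
  have [e p'] := pE _ _ p; have [e' q'] := pE _ _ q; rewrite e e' in h *.
  exact: (push_increasing av' k0' bD' nD' kN' p' q' h).
Qed.

Lemma good_size n (s : 'S_n) : good s -> exists2 t, 0 < t & n = 11 * round_start t + t + 20.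
Proof.
move=> gs; have [av _] := gs.1; have [N [D [k0 bD nD kN]]] := good_chain gs.
by have [t [t0 _ en]] := chain_size av k0 bD nD kN; exists t.
Qed.

(** * Existence of the rigid permutations *)

Section Existence.

Variable t : nat.
Hypothesis t_gt0 : 0 < t.

Let N := (round_start t).+1.
Local Notation points := (points t).
Local Notation kind_at := (kind_at t).
Local Notation block_at := (block_at t).
Let P (p : pt) : Prop := p \in points.

Lemma step_at i : i < N -> (kind_at i, kind_at i.+1) \in steps.
Proof.
move=> iN; rewrite /kind_at; rewrite ltn_eqF //.
case: eqP => [[->]|iN']; first by rewrite word_start.
have [->|i0] := posnP i; first by [].
by rewrite !word_first //; case: ifP; case: ifP.
Qed.

(** [a] and [b] stand for the links pushed by block [i]; which ones they are depends on its kind, by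
    [origin_push_first] and [origin_push_last]. *)
Definition link_map i a b l : pt :=
  if l < 10 then block_at i l else if l < 20 then block_at i.+1 (l - 10)
  else if l == 100 then link_at i else if l == 101 then low_at i.-1 else if l == 102 then a
  else if l == 103 then b else if l == 105 then low_at i else low_at i.+1.

Lemma link_map_in i a b q : i < N -> P a -> P b -> (0 < i) || (101 \notin q.1 ++ q.2) && (100 \notin q.1 ++ q.2) ->
  (i.+1 < N) || (106 \notin q.1 ++ q.2) ->
  {subset q.1 ++ q.2 <= iota 0 9 ++ iota 10 9 ++ [:: 100; 101; 102; 103; 105; 106]} ->
  forall l, l \in q.1 ++ q.2 -> P (link_map i a b l).
Proof.
move=> iN Pa Pb hi hN sub l lq; have := sub l lq.
rewrite mem_cat mem_iota => /orP[/andP[_ l9]|].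
  by rewrite /link_map ifT; [apply: block_in => //; lia|lia].
rewrite mem_cat mem_iota => /orP[/andP[l10 l9]|].
  by rewrite /link_map ifF ?ifT; [apply: block_in => //; lia|lia|lia].
have i0 : l = 100 \/ l = 101 -> 0 < i.
  by case/orP: hi => // /andP[h1 h2] [] e; rewrite e ?(negbTE h1) ?(negbTE h2) in lq.
have iN' : l = 106 -> i.+1 < N.
  by case/orP: hN => // h e; rewrite e (negbTE h) in lq.
have iJ : 0 < i -> 0 < i <= round_start t.+1 + 1 by move=> ->; rewrite (round_startS t_gt0); lia.
rewrite in_cons => /orP[/eqP e|]; first by rewrite /link_map e; apply: (link_in t_gt0); apply: iJ; apply: i0; left.
rewrite in_cons => /orP[/eqP e|]; first by rewrite /link_map e; apply: low_in => //; lia.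
rewrite in_cons => /orP[/eqP e|]; first by rewrite /link_map e.
rewrite in_cons => /orP[/eqP e|]; first by rewrite /link_map e.
rewrite in_cons => /orP[/eqP e|]; first by rewrite /link_map e; apply: low_in.
by rewrite inE => /eqP e; rewrite /link_map e; apply: low_in => //; apply: iN'.
Qed.

Lemma link_located i : i < N -> exists w,
  occ P (link (kind_at i) (kind_at i.+1) false false) w /\ w 1 = block_at i 1.
Proof.
move=> iN; have st := step_at iN.
have it : i <= round_start t by [].
have ki : kind_at i = word i by rewrite /kind_at ltn_eqF.
have first_pt : word i = KL \/ word i = KH -> exists j, [/\ 0 < j, P (20 * i + 10, 20 * j.+1 + 10), i < j &
    forall j', 0 < j' -> origin j' = i -> is_first j' = false -> j < j'].
  move=> wi; have [j [jJ oj fj]] := origin_push_first it t_gt0 wi; have /andP[j0 _] := jJ; exists j; split=> //.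
  - by have := link_in t_gt0 jJ; rewrite /link_at oj fj.
  - by have := origin_lt j0; rewrite oj.
  - move=> j' j0' oj' fj'; have [//|h|e] := ltngtP j j'; last by rewrite e fj' in fj.
    by have := @link_key_lt j' j; rewrite j0' h oj oj' fj fj' => /(_ isT); lia.
have last_pt : word i <> KL -> exists j, [/\ 0 < j, P (20 * i + 12, 20 * j.+1 + 10), i < j, origin j = i & is_first j = false].
  move=> wi; have [j [jJ oj fj]] := origin_push_last it wi; have /andP[j0 _] := jJ; exists j; split=> //.
  - by have := link_in t_gt0 jJ; rewrite /link_at oj fj.
  - by have := origin_lt j0; rewrite oj.
have [a [b [Pa Pb [[ca1 ca2] cb]]]] : exists a b, [/\ P a, P b &
   (20 * i.+2 + 8 < a.2 /\ a.1 = 20 * i + (if word i == KX then 12 else 10)) /\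
   (word i = KH -> a.2 < b.2 /\ b.1 = 20 * i + 12)].
  case E : (word i) => /=.
  - have [j [j0 Pj ij _]] := first_pt (or_introl E); exists (20 * i + 10, 20 * j.+1 + 10); eexists.
    by split; [exact: Pj|exact: Pj|split=> //=; split=> //; lia].
  - have [|j [j0 Pj ij _ _]] := last_pt; first by rewrite E.
    by exists (20 * i + 12, 20 * j.+1 + 10); eexists; split; [exact: Pj|exact: Pj|split=> //=; split=> //; lia].
  - have [j [j0 Pj ij jlt]] := first_pt (or_intror E); have [|j' [j0' Pj' ij' oj' fj']] := last_pt; first by rewrite E.
    exists (20 * i + 10, 20 * j.+1 + 10), (20 * i + 12, 20 * j'.+1 + 10); split=> //=.
    by have := jlt j' j0' oj' fj'; split=> //; [split=> //; lia|move=> _; split=> //; lia].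
  - by have := @word_neq_R i; rewrite E.
exists (link_map i a b); split; last by [].
have i_gt0 : kind_at i <> KL -> 0 < i by case: (i) ki.
have pl2 : (link_at i).2 = 20 * i.+1 + 10 by [].
have pl1 : kind_at i <> KL -> (link_at i).1 < 20 * i.
  by move=> /i_gt0 i0; have := origin_lt i0; rewrite /link_at /=; case: (is_first i); lia.
have lE : kind_at i <> KL -> (low_at i.-1).1 = 20 * i + 11 /\ (low_at i.-1).2 = 20 * i - 8.
  by move=> /i_gt0 i0; rewrite /low_at /=; split; lia.
suff [h1 h2] : sorted ltn [seq (link_map i a b l).1 | l <- (link (kind_at i) (kind_at i.+1) false false).1] /\
    sorted ltn [seq (link_map i a b l).2 | l <- (link (kind_at i) (kind_at i.+1) false false).2].
  split=> //; apply: link_map_in => //.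
  - by have [i0|//] := posnP i; move: ki; rewrite i0 => ->; case: (kind_at 1).
  - case: (ltnP i.+1 N) => // iN'; have -> : i.+1 = N by apply/eqP; rewrite eqn_leq iN' iN.
    by rewrite {2 4}/kind_at eqxx; case: (kind_at i).
  - by apply/allP; case: (kind_at i); case: (kind_at i.+1).
rewrite -ki in ca2 cb *; rewrite /link_map; move: (link_at i) (low_at i.-1) pl1 pl2 lE i_gt0 ca1 ca2 cb.
have [u eu] : exists u, kind_at i = u by eexists.
have [u' eu'] : exists u, kind_at i.+1 = u by eexists.
move=> p q; rewrite /block_at /low_at eu eu'; rewrite eu eu' in st; clear ki first_pt last_pt eu eu' Pa Pb.
move: u u' st; apply: steps_ind => pl1 pl2 lE i_gt0 ca1 ca2 cb.
1: by clear pl1 lE i_gt0 cb; rewrite /= in ca1 ca2 *; split; do ?(apply/andP; split); lia.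
all: have {lE}[|lE1 lE2] := lE; first by [].
all: have {}pl1 := pl1 ltac:(discriminate).
1,2: clear i_gt0 cb; rewrite /= in ca1 ca2 *; split; do ?(apply/andP; split); lia.
all: have {cb}[|cb1 cb2] := cb; first by [].
all: clear i_gt0; rewrite /= in ca1 ca2 *; split; do ?(apply/andP; split); lia.
Qed.

Lemma start_located : occ P (block 0, blockC 0 KL false) (block_at 0).
Proof.
split.
- move=> l lq; apply: block_in => //; move: l lq; apply/allP; by vm_compute.
- by [].
- by [].
Qed.

Lemma final_located : occ P (block 0, blockC 0 KR false) (block_at N).
Proof.
split.
- move=> l lq; apply: block_in => //; move: l lq; apply/allP; by vm_compute.
- by rewrite /=; do ?(apply/andP; split); lia.
- by rewrite /= /kind_at eqxx /=; do ?(apply/andP; split); lia.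
Qed.

Lemma points_uniq : uniq points.
Proof.
rewrite cat_uniq; apply/and3P; split.
- apply: allpairs_uniq; rewrite ?iota_uniq // => -[i k] [i' k'].
  move=> /allpairsP[[a b] [_ h [-> ->]]] /allpairsP[[a' b'] [_ h' [-> ->]]] /(f_equal fst).
  by rewrite !mem_iota in h h'; rewrite /= in h h' * => e; congr pair; lia.
- apply/hasPn => p; rewrite mem_cat => hp; apply/negP => /allpairsP[[i k] [_ hk ep]]; move: hp; rewrite ep.
  rewrite mem_iota in hk.
  by case/orP => /mapP[j _] /(f_equal fst) /=; [|case: ifP]; rewrite /= in hk; lia.
rewrite cat_uniq map_inj_uniq ?iota_uniq; last by move=> i j /(f_equal fst) /=; lia.
rewrite map_inj_in_uniq ?iota_uniq; last by move=> i j _ _ /(f_equal snd) /=; lia.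
rewrite andbT; apply/hasPn => p /mapP[j _ ->]; apply/negP => /mapP[j' _] /(f_equal fst) /=.
by case: ifP; lia.
Qed.

Theorem good_exists : exists s : 'S_(11 * round_start t + t + 20), good s.
Proof.
pose le (p q : pt) := p.1 <= q.1; pose l := sort le points.
have memE p : (p \in l) = (p \in points) by rewrite mem_sort.
have ul : uniq l by rewrite sort_uniq points_uniq.
have rows : sorted ltn [seq p.1 | p <- l].
  rewrite ltn_sorted_uniq_leq map_inj_in_uniq; last by move=> p q; rewrite !memE; apply: row_inj.
  by rewrite ul sorted_map; apply: sort_sorted => p q; apply: leq_total.
have cols : uniq [seq p.2 | p <- l].
  by rewrite map_inj_in_uniq // => p q; rewrite !memE; apply: col_inj.
have inP q v : occ (fun p => p \in l) q v <-> occ P q v.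
  by split=> -[h ? ?]; split=> // x /h; rewrite /P memE.
rewrite -size_points // -(size_sort le); exists (points_perm rows cols).
have to q v : occ P q v -> occ (graph (points_perm rows cols)) q (to_graph l \o v).
  by move=> /inP; apply: occ_to_graph.
have of_ q v : occ (graph (points_perm rows cols)) q v -> occ P q (of_graph l \o v).
  by move=> /(@occ_of_graph _ rows cols _ _)/inP.
split; first split.
- by move=> q qF [v /of_]; apply: points_avoid.
- exists (block 0, blockC 0 KL false); first by vm_compute.
  by exists (to_graph l \o block_at 0); apply: to; apply: start_located.
(* Every occurrence of a block is a block of the model, which starts a link or is the last block. *)
move=> r [[q [v [qB oc vr]]]]; apply.
have [u [b eq]] : exists u b, q = (block 0, blockC 0 u b).
  by case/flatten_mapP: qB => u _ /mapP[b _ ->]; exists u, b.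
rewrite eq in oc; have [_ [i [iN ki vi]]] := block_located t_gt0 (of_ _ _ oc).
have [w [qw [qK ow w1]]] : exists w qw, [/\ qw \in links, occ P qw w & w 1 = block_at i 1].
  move: iN; rewrite leq_eqVlt => /orP[/eqP ->|iN].
    exists (block_at N), (block 0, blockC 0 KR false); split=> //; last exact: final_located.
  have [w [ow w1]] := link_located iN; exists w; eexists; split; [|exact: ow|exact: w1].
  rewrite mem_cat; apply/orP; left; rewrite inE; apply/orP; right.
  by apply/allpairsP; exists ((kind_at i, kind_at i.+1), false); split=> //; apply: step_at.
exists qw, (to_graph l \o w); split=> //; first exact: to.
rewrite /= w1 -(vi 1) // -vr /=; have [vG _ _] := oc.
by have [|_] := @of_graphP _ rows cols (v 1); [apply: vG|move=> /(f_equal fst) /= ->].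
Qed.

End Existence.

(** * P-recursive sequences *)

Section PRecursive.

Import GRing.Theory Num.Theory Order.TTheory.
Local Open Scope ring_scope.

(** Membership in the span of [e] over the rational functions of [n], with denominators cleared. *)
Definition spanned (e : seq (nat -> int)) (c : nat -> int) := exists D : {poly int}, exists p : nat -> {poly int},
  D != 0 /\ forall n : nat, D.[n%:Z] * c n = \sum_(i < size e) (p i).[n%:Z] * nth (fun=> 0) e i n.

Definition shifts (a : nat -> int) k := [seq (fun n => a (n + i)%N) | i <- iota 0 k].

Lemma nth_shifts a k i n : (i < k)%N -> nth (fun=> 0) (shifts a k) i n = a (n + i)%N.
Proof. by move=> ik; rewrite (nth_map 0%N) ?size_iota // nth_iota. Qed.

Lemma spannedB e e' c c' : spanned e c -> spanned e' c' -> spanned (e ++ e') (fun n => c n - c' n).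
Proof.
case=> D [p [D0 h]] [D' [p' [D0' h']]].
exists (D * D'), (fun i => if (i < size e)%N then D' * p i else - (D * p' (i - size e)%N)).
split=> [|n]; first by rewrite mulf_neq0.
rewrite size_cat big_split_ord /= hornerM mulrBr.
congr (_ + _).
  rewrite (mulrC D.[_]) -mulrA h mulr_sumr; apply: eq_bigr => i _.
  by rewrite ltn_ord nth_cat ltn_ord hornerM mulrA.
rewrite -mulrA h' -mulrN -sumrN mulr_sumr; apply: eq_bigr => i _.
by rewrite ltnNge leq_addr /= nth_cat ltnNge leq_addr /= addKn hornerN hornerM mulrN mulNr mulrA.
Qed.

Lemma horner_shift (p : {poly int}) (m n : int) : (p \Po ('X + m%:P)).[n] = p.[n + m].
Proof. by rewrite horner_comp hornerD hornerX hornerC. Qed.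

Lemma shift_neq0 (p : {poly int}) (m : int) : p != 0 -> p \Po ('X + m%:P) != 0.
Proof.
apply: contraNneq => e.
have -> : p = (p \Po ('X + m%:P)) \Po ('X - m%:P).
  by rewrite -comp_polyA comp_polyD comp_polyX comp_polyC subrK comp_polyXr.
by rewrite e comp_poly0.
Qed.

(** Dropping vanishing top coefficients makes the leading one nonzero, so that [a (n + k)] can be
    eliminated in [spanned_shifts]. *)
Lemma P_recursive_forward a : P_recursive a -> exists k (p : nat -> {poly int}),
  p k != 0 /\ forall n : nat, \sum_(i < k.+1) (p i).[n%:Z] * a (n + i)%N = 0.
Proof.
case=> qs [/(has_nthP 0)[m mq qm] h].
have [K Kq] : exists K, size qs = K.+1 by case: (size qs) mq => // K _; exists K.
pose p i := nth 0 qs (K - i)%N \Po ('X + K%:Z%:P).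
have pm : exists i, (p i != 0) && (i <= K)%N.
  exists (K - m)%N; rewrite leq_subr andbT /p subKn; last by rewrite Kq in mq.
  by rewrite shift_neq0.
have ub i : (p i != 0) && (i <= K)%N -> (i <= K)%N by case/andP.
have [k /andP[pk kK] kmax] := ex_maxnP pm ub.
exists k, p; split=> // n.
have := h (n + K)%N; rewrite Kq ltnS leq_addl => /(_ isT).
rewrite (reindex_inj rev_ord_inj) /= => s0.
have {s0} : \sum_(0 <= i < K.+1) (p i).[n%:Z] * a (n + i)%N = 0.
  rewrite big_mkord -[RHS]s0; apply: eq_bigr => i _; rewrite /p horner_shift subSS PoszD.
  by rewrite -addnBA ?leq_subr // subKn // -ltnS.
have z : \sum_(k.+1 <= i < K.+1) (p i).[n%:Z] * a (n + i)%N = 0.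
  rewrite big_nat big1 // => i /andP[ki iK]; have -> : p i = 0; last by rewrite horner0 mul0r.
  by apply/eqP; apply: contraLR ki => pi; rewrite -leqNgt; apply: kmax; rewrite pi.
by rewrite (big_cat_nat (n := k.+1)) //= z addr0 big_mkord.
Qed.

Lemma P_recursive_backward a k (p : nat -> {poly int}) m : (m <= k)%N -> p m != 0 ->
  (forall n : nat, \sum_(i < k.+1) (p i).[n%:Z] * a (n + i)%N = 0) -> P_recursive a.
Proof.
move=> mk pm h; exists (mkseq (fun i => p (k - i)%N \Po ('X + (- k%:Z)%:P)) k.+1); split.
  apply/(has_nthP 0); exists (k - m)%N; rewrite ?size_mkseq ?nth_mkseq ?ltnS ?leq_subr //.
  by rewrite subKn // shift_neq0.
move=> n; rewrite size_mkseq ltnS => kn; rewrite -[RHS](h (n - k)%N) (reindex_inj rev_ord_inj).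
apply: eq_bigr => i _; rewrite /= subSS nth_mkseq ?ltnS ?leq_subr // horner_shift.
have ik : (i <= k)%N by rewrite -ltnS.
by rewrite subKn // -subzn //; congr (_ * a _); lia.
Qed.

(** By induction on the shift: replace [n] by [n.+1] in the relation, multiply by the leading
    coefficient, and eliminate the single term [a (n + k)] by the recurrence. *)
Lemma spanned_shifts a k (p : nat -> {poly int}) : p k != 0 ->
  (forall n : nat, \sum_(i < k.+1) (p i).[n%:Z] * a (n + i)%N = 0) ->
  forall j, spanned (shifts a k) (fun n => a (n + j)%N).
Proof.
move=> pk h j; have [jk|kj] := ltnP j k.
  exists 1, (fun i => if i == j then 1 else 0); split=> [|n]; first exact: oner_neq0.
  rewrite hornerE mul1r size_map size_iota (bigD1 (Ordinal jk)) //= eqxx hornerE mul1r nth_shifts //.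
  by rewrite big1 ?addr0 // => i; rewrite -val_eqE /= => /negbTE ->; rewrite horner0 mul0r.
rewrite -(subnKC kj); elim: (j - k)%N => [|d [D [q [D0 IH]]]].
  exists (p k), (fun i => - p i); split=> // n; rewrite addn0 size_map size_iota.
  have := h n; rewrite big_ord_recr /= addrC => /eqP; rewrite addr_eq0 => /eqP ->.
  by rewrite -sumrN; apply: eq_bigr => i _; rewrite nth_shifts // hornerN mulNr.
pose q1 i := q i \Po ('X + 1%:P).
exists (p k * (D \Po ('X + 1%:P))), (fun i => (if i is i'.+1 then p k * q1 i' else 0) - q1 k.-1 * p i).
split=> [|n]; first by rewrite mulf_neq0 // shift_neq0.
rewrite hornerM horner_shift size_map size_iota -mulrA.
have -> : n%:Z + 1 = n.+1%:Z by lia.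
rewrite (_ : (n + (k + d.+1) = n.+1 + (k + d))%N) ?IH ?size_map ?size_iota; last by lia.
case: k pk h {kj D D0 IH} => [|k] pk h; first by rewrite !big_ord0 mulr0.
have {}h : (p k.+1).[n%:Z] * a (n + k.+1)%N = - \sum_(i < k.+1) (p i).[n%:Z] * a (n + i)%N.
  by have := h n; rewrite big_ord_recr /= addrC => /eqP; rewrite addr_eq0 => /eqP.
rewrite big_ord_recr /= mulrDr nth_shifts // addSnnS.
rewrite [p k.+1]lock mulrCA -lock h mulrN.
transitivity (\sum_(i < k.+1) (if nat_of_ord i is i'.+1 then p k.+1 * q1 i' else 0 : {poly int}).[n%:Z] * a (n + i)%N
   - \sum_(i < k.+1) (q1 k * p i).[n%:Z] * a (n + i)%N); last first.
  rewrite -sumrB; apply: eq_bigr => i _; rewrite nth_shifts // -mulrBl -hornerN -hornerD //.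
congr (_ - _).
  rewrite big_ord_recl /= horner0 mul0r add0r mulr_sumr; apply: eq_bigr => i _.
  rewrite nth_shifts ?ltnS ?(ltnW (ltn_ord i)) // hornerM horner_shift addSnnS mulrA.
  by have -> : n%:Z + 1 = n.+1%:Z by lia.
rewrite mulr_sumr; apply: eq_bigr => i _; rewrite hornerM horner_shift mulrA.
by have -> : n%:Z + 1 = n.+1%:Z by lia.
Qed.

Lemma spanned_dependent e (c : nat -> nat -> int) : (forall j, spanned e (c j)) ->
  exists (w : nat -> {poly int}) m, [/\ (m <= size e)%N, w m != 0 &
    forall n : nat, \sum_(j < (size e).+1) (w j).[n%:Z] * c j n = 0].
Proof.
move=> sp; have [D [p Dp]] : exists (D : nat -> {poly int}) (p : nat -> nat -> {poly int}),
    forall j, D j != 0 /\ forall n : nat, (D j).[n%:Z] * c j n = \sum_(i < size e) (p j i).[n%:Z] * nth (fun=> 0) e i n.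
  have D_ j := constructive_indefinite_description _ (sp j).
  have p_ j := constructive_indefinite_description _ (proj2_sig (D_ j)).
  by exists (fun j => proj1_sig (D_ j)), (fun j => proj1_sig (p_ j)) => j; exact: proj2_sig (p_ j).
(* The zero last column makes the matrix square and singular; a vector of its left kernel is the
   dependency. *)
pose A := \matrix_(j < (size e).+1, i < (size e).+1) if (i < size e)%N then p j i else 0.
have /det0P[u u0 uA] : \det A == 0.
  by rewrite (expand_det_col _ ord_max) big1 // => j _; rewrite mxE ltnn mul0r.
have [m um] : exists m, u 0 m != 0.
  by apply/existsP; apply: contraNT u0; rewrite negb_exists => /forallP z; apply/eqP/rowP => i;
    have := z i; rewrite negbK mxE => /eqP.
exists (fun j => u 0 (inord j) * D j), m; split; first by rewrite -ltnS.
  by rewrite inord_val mulf_neq0 // (Dp m).1.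
move=> n; under eq_bigr => j _ do rewrite inord_val hornerM -mulrA (Dp j).2 mulr_sumr.
rewrite exchange_big big1 //= => i _.
transitivity (((u *m A) 0 (widen_ord (leqnSn _) i)).[n%:Z] * nth (fun=> 0) e i n).
  rewrite mxE horner_sum mulr_suml; apply: eq_bigr => j _.
  by rewrite !mxE /= ltn_ord hornerM mulrA.
by rewrite uA mxE horner0 mul0r.
Qed.

Lemma P_recursiveB a b : P_recursive a -> P_recursive b -> P_recursive (fun n => a n - b n).
Proof.
move=> /P_recursive_forward[k [p [pk hp]]] /P_recursive_forward[l [q [ql hq]]].
have [|w [m [mK wm h]]] := @spanned_dependent (shifts a k ++ shifts b l) (fun j n => a (n + j)%N - b (n + j)%N).
  by move=> j; apply: spannedB; [apply: spanned_shifts hp _|apply: spanned_shifts hq _].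
exact: P_recursive_backward mK wm h.
Qed.

Lemma dvdz_horner (p : {poly int}) (m x y : int) : (m %| x - y)%Z -> (m %| p.[x] - p.[y])%Z.
Proof.
move=> mxy; elim/poly_ind: p => [|p c IH]; first by rewrite !horner0 subrr dvdz0.
rewrite !hornerE.
have -> : p.[x] * x + c - (p.[y] * y + c) = p.[x] * (x - y) + (p.[x] - p.[y]) * y by ring.
by apply: rpredD; [apply: dvdz_mull|apply: dvdz_mulr].
Qed.

Lemma nonroot_nat (p : {poly int}) : p != 0 -> exists x : nat, p.[x%:Z] != 0.
Proof.
move=> p0; pose r := [seq x%:Z | x <- iota 0 (size p)].
have : ~~ all (root p) r.
  apply/negP => al; have := max_poly_roots p0 al; rewrite size_map size_iota ltnn.
  by rewrite map_inj_uniq ?iota_uniq => [/(_ isT)//|i j []].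
by rewrite -has_predC => /hasP[_ /mapP[x _ ->] px]; exists x.
Qed.

(** At some [x] the coefficients do not all vanish. Let [2 ^ B] be the largest power of 2 dividing
    all of them there, and let coefficient [j] not be divisible by [2 ^ B.+1]. For [n = f t + j]
    congruent to [x] modulo [2 ^ B.+1], every other [a (n - i)] is even, so every term but the
    [j]-th vanishes modulo that power. *)
Lemma not_P_recursive_sparse (a : nat -> int) (f : nat -> nat) :
  (forall n, ~~ (2 %| a n)%Z <-> exists t, n = f t) ->
  (forall t, f t + t < f t.+1)%N ->
  (forall K (c : int) T, exists t, (T <= t)%N /\ ((2 ^+ K)%R %| (f t)%:Z - c)%Z) ->
  ~ P_recursive a.
Proof.
move=> odd_a gap dense [qs [/(has_nthP 0)[m mq qm] rec]].
have [x qx] := nonroot_nat qm; have [k ek] : exists k, size qs = k by eexists.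
rewrite ek in mq rec; pose p i := nth 0 qs i; pose q i := (p i).[x%:Z].
pose Q b := ~~ [forall i : 'I_k, ((2 ^+ b)%R %| q i)%Z].
have exb : exists b, Q b.
  exists `|q m|%N; rewrite /Q negb_forall; apply/existsP; exists (Ordinal mq) => /=.
  apply/negP; rewrite dvdzE abszX => /dvdn_leq; rewrite absz_gt0 => /(_ qx).
  by rewrite leqNgt ltn_expl.
have [[|B] QB Bmin] := ex_minnP exb.
  by case/negP: QB; apply/forallP => i; rewrite expr0 dvd1z.
have divB i : (i < k)%N -> ((2 ^+ B)%R %| q i)%Z.
  move=> ik; have : ~~ Q B by apply/negP => /Bmin; rewrite ltnn.
  by rewrite negbK => /forallP/(_ (Ordinal ik)).
have [j nj] : exists j : 'I_k, ~~ ((2 ^+ B.+1)%R %| q j)%Z by move: QB; rewrite /Q negb_forall => /existsP.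
(* Taking [t] at least [k] makes the gaps on both sides of [f t] longer than the reach of the
   recurrence. *)
have [t [kt ft]] := dense B.+1 (x%:Z - j%:Z) k.
have f_mono u v : (u < v)%N -> (f u + v.-1 < f v)%N.
  elim: v => // v IH; rewrite ltnS leq_eqVlt => /orP[/eqP ->|/IH]; first exact: gap.
  by have := gap v; lia.
have f_ge u : (u <= f u)%N by elim: u => // u IH; have := gap u; lia.
pose n := (f t + j)%N.
have qn i : ((2 ^+ B.+1)%R %| (p i).[n%:Z] - q i)%Z.
  by apply: dvdz_horner; have -> : n%:Z - x%:Z = (f t)%:Z - (x%:Z - j%:Z) by rewrite PoszD; ring.
have size_n : (k <= n.+1)%N by rewrite /n; have := f_ge t; lia.
have nf : (n - j)%N = f t by rewrite addnK.
have odd_ft : ~~ (2 %| a (f t))%Z by apply/odd_a; exists t.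
have := rec n size_n; rewrite (bigD1 j) //= nf => /eqP; rewrite addr_eq0 => /eqP e; case/negP: nj.
have dvd_p : ((2 ^+ B.+1)%R %| (p j).[n%:Z])%Z.
  rewrite -(@Gauss_dvdzl _ _ (a (f t))); last first.
    by apply: coprimezXl; rewrite coprimezE prime_coprime -?dvdzE.
  rewrite e rpredN; apply: rpred_sum => i ij; rewrite exprSr; apply: dvdz_mul.
    have := divB i (ltn_ord i); have := qn i; rewrite exprSr => h1 h2.
    rewrite -[_.[_]](subrK (q i)); apply: rpredD => //; apply: dvdz_trans h1; exact: dvdz_mulr.
  apply: contraR ij => /odd_a[u e']; apply/eqP/ord_inj; rewrite /n in e'.
  have ik := ltn_ord i; have jk := ltn_ord j; have ft_ge := f_ge t.
  case: (ltngtP t u) => [tu|/f_mono h|tu].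
  - by have h := f_mono _ _ tu; clear -e' h ik jk ft_ge kt tu; lia.
  - by clear -e' h ik jk ft_ge kt; lia.
  - by clear -e' tu ik jk ft_ge kt; subst u; lia.
have -> : q j = (p j).[n%:Z] - ((p j).[n%:Z] - q j) by rewrite opprB addrC subrK.
exact: rpredB.
Qed.

(** The shift by one absorbs the condition that the round [t] of the last H-block be positive. *)
Definition peak t := (11 * round_start t.+1 + t.+1 + 20)%N.

Lemma peak_gap t : (peak t + t < peak t.+1)%N.
Proof. by rewrite /peak /=; lia. Qed.

(** Since [round_start t.+1] is one plus a triangular number, odd indices give a polynomial with
    integer coefficients. Its quadratic coefficient is even and its linear one odd, which makes it
    bijective modulo powers of 2. *)
Lemma peak_odd v : (peak v.*2.+1)%:Z = 22 * (v.+1)%:Z ^+ 2 - 9 * (v.+1)%:Z + 31.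
Proof.
have e t : (2 * round_start t.+1 = 2 + t * t.+1)%N.
  by elim: t => // t IH; rewrite [round_start _]/= -/(round_start t.+1) mulnDr IH; lia.
by have := e v.*2.+1; rewrite /peak -mul2n; nia.
Qed.

(** Hensel lifting: passing from [v] to [v + 2 ^ K] changes [g] by an odd multiple of [2 ^ K], which
    repairs the next binary digit. *)
Lemma peak_dense K (c : int) T : exists t, (T <= t)%N /\ ((2 ^+ K)%R %| (peak t)%:Z - c)%Z.
Proof.
pose g (v : int) : int := 22 * v ^+ 2 - 9 * v + 31.
have eK L : (2 ^ L)%N%:Z = 2 ^+ L :> int by rewrite -!natz natrX.
have [v gv] : exists v : nat, ((2 ^+ K)%R %| g v%:Z - c)%Z.
  elim: K => [|K [v /dvdzP[w gw]]]; first by exists 0%N; rewrite expr0 dvd1z.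
  have [w' [ew|ew]] : exists w', w = w' * 2 \/ w = w' * 2 + 1 by exists (w %/ 2)%Z; lia.
    by exists v; apply/dvdzP; exists w'; rewrite gw ew exprS; ring.
  exists (v + 2 ^ K)%N; apply/dvdzP; exists (w' + 22 * v%:Z + 11 * 2 ^+ K - 4).
  have -> : g (v + 2 ^ K)%N%:Z - c = g v%:Z - c + (44 * v%:Z + 22 * 2 ^+ K - 9) * 2 ^+ K.
    by rewrite /g PoszD eK; ring.
  by rewrite gw ew exprS; ring.
(* The summand [T * 2 ^ K] passes [T] without changing the residue, and [(2 ^ K).-1] absorbs the
   successor in [peak_odd]. *)
exists (v + T * 2 ^ K + (2 ^ K).-1).*2.+1; have K0 : (0 < 2 ^ K)%N by rewrite expn_gt0.
split; first by have : (T <= T * 2 ^ K)%N by [rewrite leq_pmulr|]; lia.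
rewrite peak_odd.
have -> : (v + T * 2 ^ K + (2 ^ K).-1).+1 = (v + T.+1 * 2 ^ K)%N by lia.
rewrite -/(g _) -[_ - c](addrNK (g v%:Z - c)); apply: rpredD => //.
have -> : g (v + T.+1 * 2 ^ K)%N%:Z - c - (g v%:Z - c) =
   (44 * v%:Z + 22 * T.+1%:Z * 2 ^+ K - 9) * T.+1%:Z * 2 ^+ K.
  by rewrite /g PoszD PoszM eK; ring.
exact: dvdz_mull.
Qed.

End PRecursive.

(* Counting candidates and conclusion *)
#[local] Opaque forbidden.

Lemma avoids_pats (L : seq pat) n (s : 'S_n) : all wf_pat L ->
  all (avoids s) (map pat_of L) = asb (avoids_all L s).
Proof.
move=> /allP wf; rewrite all_map; apply/allP/asbP => h q qL.
  by move/(occ_contains _ (wf q qL)); apply/negP; apply: h.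
by apply/negP => /(occ_contains _ (wf q qL)); apply: h.
Qed.

Lemma Cn_pats (L : seq pat) n : all wf_pat L ->
  Cn (map pat_of L) n = #|[set s : 'S_n | asb (avoids_all L s)]|.
Proof. by move=> wf; apply: eq_card => s; rewrite !inE avoids_pats. Qed.

Lemma count_candidates (F P : seq pat) n : all wf_pat (F ++ P) ->
  Cn (map pat_of F) n = Cn (map pat_of (F ++ P)) n + #|[set s : 'S_n | asb (candidate F P s)]|.
Proof.
move=> wf; have wfF : all wf_pat F by move: wf; rewrite all_cat => /andP[].
rewrite (Cn_pats n wfF) (Cn_pats n wf).
rewrite -(cardsID [set s : 'S_n | asb (avoids_all (F ++ P) s)]).
congr (_ + _); apply: eq_card => s; rewrite !inE.
  apply/andP/asbP => [[_ /asbP //]|h]; split; apply/asbP => // q qF; apply: h.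
  by rewrite mem_cat qF.
apply/andP/asbP => [[/asbP h /asbP a]|[a [q qP cq]]].
  split=> //; apply: NNPP => nq; apply: h => q.
  by rewrite mem_cat => /orP[/a //|qP] cq; apply: nq; exists q.
split; apply/asbP => // h; apply: (h q) cq; by rewrite mem_cat qP orbT.
Qed.

Lemma blocks_adjacent n (s : 'S_n) q v : avoids_all forbidden s -> q \in blocks -> occ (graph s) q v ->
  (v 2).1 = (v 1).1.+1 /\ ((v 2).2 == (v 1).2.+1) || ((v 1).2 == (v 2).2.+1).
Proof.
move=> av /flatten_mapP[u _ /mapP[b _ ->]] oc; have [rows cols] := block_consecutive av oc.
split; first by rewrite (rows 1) // (rows 2) // addnS.
have [p [p8 e]] : exists p, p < 8 /\ (nth 0 (signed_cols u b) p, nth 0 (signed_cols u b) p.+1) \in [:: (1, 2); (2, 1)].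
  by case: u b {oc cols} => -[]; first [by exists 5 | by exists 6].
have p9 : p.+1 < 9 by []. have p9' : p < 9 by apply: ltnW.
have := cols p.+1 p9; have := cols p p9'; move: e; rewrite !inE => /orP[] /eqP[-> ->] -> ->;
by rewrite addnS eqxx ?orbT.
Qed.

Lemma odd_candidates n :
  odd #|[set s : 'S_n | asb (candidate forbidden (blocks_of KL) s)]| <-> exists t, n = peak t.
Proof.
rewrite (candidate_parity forbidden_wf blocks_links_full forbidden_closed blocks_closed links_closed
  blocks_L_closed _ (@blocks_adjacent n) blocks_labels); last first.
  by move=> q qN; rewrite mem_cat; apply/orP; right.
rewrite -/(good _); split=> [o|[t ->]].
  have [s gs] : exists s : 'S_n, good s.
    apply: NNPP => ng; move: o; rewrite (_ : [set _ | _] = set0) ?cards0 //.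
    by apply/setP => s; rewrite !inE; apply/asbP => gs; apply: ng; exists s.
  have [[|t] // _ ->] := good_size gs.
  by exists t.
have [s gs] := good_exists (ltn0Sn t).
rewrite (_ : [set _ | _] = [set s]) ?cards1 //.
apply/setP => s'; rewrite !inE; apply/asbP/eqP => [gs'|->]; last exact: gs.
exact: good_unique gs' gs.
Qed.

Lemma partial_pats (L : seq pat) :
  all wf_pat L -> all (fun q : pat => (size q.1 <= 80) && (size q.2 <= 80)) L ->
  forall P, List.In P (map pat_of L) ->
    [/\ (prows P <= 80)%N, (pcols P <= 80)%N & is_partial_pattern (pmx P)].
Proof.
elim: L => // q L IH /= /andP[wq wL] /andP[/andP[q1 q2] sL] P [<-|]; last exact: IH.
by split=> //; apply: pat_mx_partial.
Qed.

Theorem theorem4p3 :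
  exists F : seq pattern,
    (size F <= 6854)%N /\
    (forall P, List.In P F ->
       [/\ (prows P <= 80)%N, (pcols P <= 80)%N & is_partial_pattern (pmx P)]) /\
    ~ P_recursive (fun n => Posz (Cn F n)).
Proof.
have /andP[size_le small] := forbidden_small.
have wf : all wf_pat (forbidden ++ blocks_of KL) by rewrite all_cat forbidden_wf.
(* If the count for [forbidden] is P-recursive, the witness is its extension by the two signed
   starting blocks, since the difference of the counts is not P-recursive. *)
have [r1|n1] := classic (P_recursive (fun n => Posz (Cn (map pat_of forbidden) n))).
  exists (map pat_of (forbidden ++ blocks_of KL)); split.
    by rewrite size_map size_cat; apply: leq_trans (leq_add size_le (leqnn _)) _.
  split; first by apply: partial_pats wf _; rewrite all_cat small.
  move=> r2; have := P_recursiveB r1 r2; apply: (@not_P_recursive_sparse _ peak).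
  - move=> n; rewrite (count_candidates n wf) PoszD -odd_candidates GRing.addrC GRing.addKr.
    rewrite dvdzE dvdn2 negbK; exact: iff_refl.
  - exact: peak_gap.
  - exact: peak_dense.
exists (map pat_of forbidden); split; first by rewrite size_map; apply: leq_trans size_le _.
split; last exact: n1.
exact: partial_pats forbidden_wf small.
Qed.
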